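(* Let $i,j\in\{1,\dots,N\}$, $k,l\in\{1,\dots,M\}$, $r_0,r_1\in\{1,\dots,R\}$, $s\ge 0$. In the gap acceptance model described in the context, the partial service-time Laplace–Stieltjes transform of a customer, jointly with the event that he is of type $(j,l,r_1)$ (i.e. $J_{n+1}=(j,l,r_1)$), given that his predecessor was of type $(i,k,r_0)$ (i.e. $J_n=(i,k,r_0)$), is $$\tilde{G}^{(j,l,r_1)}_{(i,k,r_0)}(s)=\tilde{G}_{(j,l,r_1)}(s,\bar u_{(i,k,r_0)})\left(1-\bar f_{(i,k,r_0)}\right)+\left(\int_{0}^{\bar u_{(i,k,r_0)}}\lambda e^{-\lambda x}\,\tilde{G}_{(j,l,r_1)}(s,\bar u_{(i,k,r_0)}-x)\,dx+\tilde{G}_{(j,l,r_1)}(s,0)\,e^{-\lambda\bar u_{(i,k,r_0)}}\right)\bar f_{(i,k,r_0)},$$ where $$\bar f_{(i,k,r)}=\frac{f_{(i,k,r)}(0)}{\pi_{(i,k,r)}\,p_{(i,k,r)}\,p_r},\qquad \bar u_{(i,k,r)}=u_{(i,k,r)}-\Delta_r .$$ Here (empty products equal $1$): (a) $f_{(i,k,r_0)}(0)$ is obtained by solving the system of equations, for all $(j,l,r_1)$ and $|z|\le 1$, $$z f_{(j,l,r_1)}(z)-\sum_{r_0=1}^R\sum_{k=1}^M\sum_{i=1}^N A^{(j,l,r_1)}_{(i,k,r_0)}(z) f_{(i,k,r_0)}(z)=\sum_{r_0=1}^R\sum_{k=1}^M\sum_{i=1}^N\left(B(z)A^{*(j,l,r_1)}_{(i,k,r_0)}(z)-A^{(j,l,r_1)}_{(i,k,r_0)}(z)\right)f_{(i,k,r_0)}(0).$$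 (b) $\tilde G_{(j,l,r)}(s,y)$ is given by $\tilde{G}_{(1,l,r)}(s,y)=p_r\,p_{(1,l,r)}e^{-q\max\{u_{(1,l,r)}-y,0\}}e^{-s\Delta_r}$ and, for $j=2,\dots,N$, $$\tilde{G}_{(j,l,r)}(s,y)=p_r\,p_{(j,l,r)}\left(1-\mathbb E\left[e^{-(s+q)\max\{T_{(1,r)}-y,0\}}\right]\right)e^{-(s(y+\Delta_r)+qu_{(j,l,r)})}\left(\frac{q}{s+q}\right)^{j-1}\prod_{m=2}^{j-1}\left(1-\mathbb E\left[e^{-(s+q)T_{(m,r)}}\right]\right).$$ (c) $\pi_{(i,k,r)}=P_{(i,k,r)}\prod_{m=1}^{i-1}\left(1-\sum_{k_m=1}^M p_{(m,k_m,r)}P_{(m,k_m,r)}\right)$, where $P_{(i,k,r)}=e^{-qu_{(i,k,r)}}$ for $i\ge2$, and the $P_{(1,k,r)}$ can be found by solving the linear system, for $k\in\{1,\dots,M\}$ and $r\in\{1,\dots,R\}$, $$P_{(1,k,r)}+\sum_{r_0=1}^R\sum_{l=1}^M\left(-p_{r_0}e^{-q\hat v^{(1,k,r)}_{(1,l,r_0)}}+c_{(k,r_0,r)}\right)p_{(1,l,r_0)}P_{(1,l,r_0)}$$ $$=\sum_{r_0=1}^R\sum_{l=1}^M\sum_{i=1}^N\left(1-e^{-\lambda\check v^{(1,k,r)}_{(i,l,r_0)}}-e^{-q\hat v^{(1,k,r)}_{(i,l,r_0)}}+\frac{\lambda}{\lambda+q}e^{-(\lambda+q)\check v^{(1,k,r)}_{(i,l,r_0)}-qv^{(1,k,r)}_{(i,l,r_0)}}+\frac{q}{\lambda+q}e^{-\lambda\bar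 u_{(i,l,r_0)}-qu_{(1,k,r)}}\right)f_{(i,l,r_0)}(0)+\sum_{r_0=1}^Rc_{(k,r_0,r)},$$ with $v^{(1,k,r)}_{(i,l,r_0)}=u_{(1,k,r)}-u_{(i,l,r_0)}+\Delta_{r_0}$, $\hat v=\max\{v,0\}$, $\check v=\max\{-v,0\}$, and $$c_{(k,r_0,r)}=\sum_{l=1}^M\sum_{i=2}^{N}p_{r_0}p_{(i,l,r_0)}e^{-q(u_{(i,l,r_0)}+\hat v^{(1,k,r)}_{(i,l,r_0)})}\prod_{m=2}^{i-1}\left(1-\mathbb E\left[e^{-qT_{(m,r_0)}}\right]\right).$$
   Context: **Traffic and drivers.** Vehicles on a major road pass according to a Poisson process of rate $q>0$ and are not hindered by the minor road; $\tau_q$ denotes an exponential($q$) interarrival time on the major road. On the minor road, batches (platoons) of vehicles arrive according to an independent Poisson process of rate $\lambda>0$; batch sizes are i.i.d. copies of a random variable $B\ge1$, and $B(z)=\mathbb E[z^B]$. Each minor-road vehicle independently has profile $r\in\{1,\dots,R\}$ with probability $p_r$, $\sum_r p_r=1$. The attempt number is in $\{1,\dots,N\}$, $N$ being the maximum number of possible attempts. At his $i$-th attempt a driver of profile $r$ samples, independently of his previous attempts, a critical gap (headway) $T_{(i,r)}$ with $\mathbb P(T_{(i,r)}=u_{(i,k,r)})=p_{(i,k,r)}$, $k=1,\dots,M$, $\sum_k p_{(i,k,r)}=1$. The merging time of a profile-$r$ vehicle is the constant $\Delta_r$, less than its critical gaps. A driver accepts the gap (the time until the next major-road vehicle, as seen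 by him) if it is at least his sampled critical gap; otherwise the attempt fails, he waits until the end of that gap, and then makes his next attempt with the next gap between successive major-road vehicles. **Service.** Vehicles on the minor road are served one by one in order of arrival. The service time of a vehicle is the time spent at the front of the queue scanning for gaps (possibly zero) plus its merging time; it departs at the end of merging. If a vehicle of profile $r_0$ accepts a gap at attempt $i$ with critical gap $u_{(i,k,r_0)}$, then the part $\bar u_{(i,k,r_0)}=u_{(i,k,r_0)}-\Delta_{r_0}$ of the critical gap is left over at its departure and may be used by its successor. If the successor was already queueing, he faces at the start of scanning a leftover gap $y=\bar u_{(i,k,r_0)}$. If the queue was empty at the departure, the next batch arrives after an exponential($\lambda$) time $x$ and the first vehicle of that batch faces a leftover gap $y=\max\{\bar u_{(i,k,r_0)}-x,0\}$. $E_y$ denotes the event that there is a predecessor gap available of length $y$: the first gap seen by the driver then has length $y+\tau_q$. **Standing assumption (limited gap reusability).** At most one driver can reuse the remaining part of a critical gap accepted by his predecessor; equivalently, $u_{(1,l,r_1)}\ge u_{(i,k,r_0)}-\Delta_{r_0}$ for all $i\in\{1,\dots,N\}$, $k,l\in\{1,\dots,M\}$, $r_0,r_1\in\{1,\dots,R\}$. **Queueing quantities.** $X_n$ is the number of vehicles on the minor road behind the $n$-th vehicle at its departure; $G^{(n)}$ is the service time of the $n$-th vehicle; $A_n$ is the number of minor-road vehicle arrivals during $G^{(n)}$. $J_n=(i,k,r)$ records that the $(n-1)$-th vehicle had profile $r$ and succeeded at its $i$-th attempt with critical gap $u_{(i,k,r)}$; thus $J_{n+1}$ is the type of the $n$-th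 vehicle and $J_n$ that of its predecessor. Throughout, the stability condition $\lim_{n\to\infty}\mathbb E[A_n\mid X_{n-1}\ge1]<1$ holds and all quantities are in steady state ($n\to\infty$). Define - $f_{(j,l,r)}(z)=\lim_{n\to\infty}\mathbb E[z^{X_n}1\{J_{n+1}=(j,l,r)\}]$, so $f_{(j,l,r)}(0)=\lim_{n\to\infty}\mathbb P(X_n=0,J_{n+1}=(j,l,r))$; - $A^{(j,l,r_1)}_{(i,k,r_0)}(z)=\lim_{n\to\infty}\mathbb E[z^{A_n}1\{J_{n+1}=(j,l,r_1)\}\mid J_n=(i,k,r_0),X_{n-1}\ge1]$ and $A^{*(j,l,r_1)}_{(i,k,r_0)}(z)=\lim_{n\to\infty}\mathbb E[z^{A_n}1\{J_{n+1}=(j,l,r_1)\}\mid J_n=(i,k,r_0),X_{n-1}=0]$; - $\tilde G_{(j,l,r_1)}(s,y)=\mathbb E[e^{-sG^{(n)}}1\{J_{n+1}=(j,l,r_1)\}\mid E_y]$ for $0\le y\le u_{(i,k,r_0)}-\Delta_{r_0}$, where $(i,k,r_0)$ is the type of the predecessor; - $\tilde G^{(j,l,r_1)}_{(i,k,r_0)}(s)=\mathbb E[e^{-sG^{(n)}}1\{J_{n+1}=(j,l,r_1)\}\mid J_n=(i,k,r_0)]$ (steady state); - $\pi_{(i,k,r)}$: the probability that an arbitrary driver of profile $r$ succeeds in his $i$-th attempt with critical headway $u_{(i,k,r)}$ (given that this is the value sampled for the $i$-th attempt), so that in steady state $\mathbb P(J_n=(i,k,r))=\pi_{(i,k,r)}p_{(i,k,r)}p_r$;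 - $P_{(i,k,r)}$: the probability that a driver of profile $r$ who makes an $i$-th attempt with critical headway $u_{(i,k,r)}$ succeeds in that attempt.
   Formalization: N may be infinite; (a) and the linear system for P_(1,k,r) assume every driver almost surely succeeds within N attempts. For finite N this is impossible, since the N-th attempt succeeds only with probability e^{-qu}<1, so these two parts have content for N infinite. *)

(* Defs.v *)
From HB Require Import structures.
From mathcomp Require Import all_boot all_order all_algebra.
From mathcomp Require Import complex.
From mathcomp Require Import all_classical all_reals all_analysis.

Set Implicit Arguments.
Unset Strict Implicit.
Unset Printing Implicit Defensive.

Import Order.TTheory GRing.Theory Num.Theory.
Import numFieldNormedType.Exports.

Local Open Scope classical_set_scope.
Local Open Scope ring_scope.

Section Probability.
Context {R : realType} {d : measure_display} {T : measurableType d}.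
Variable P : probability T R.

Definition prob (A : set T) : R := fine (P A).
Definition cprob (A E : set T) : R := prob (A `&` E) / prob E.

Definition expect (Y : T -> R) : R := fine ('E_P[Y])%E.
Definition cexpect (Y : T -> R) (E : set T) : R :=
  expect (fun w => Y w * \1_E w) / prob E.

Definition expectC (Z : T -> R[i]) : R[i] :=
  Complex (expect (fun w => complex.Re (Z w)))
          (expect (fun w => complex.Im (Z w))).
Definition cexpectC (Z : T -> R[i]) (E : set T) : R[i] :=
  expectC (fun w => Z w * real_complex R (\1_E w)) / real_complex R (prob E).

(* Mutual independence of a family of sigma-algebras, F i being the events of
   the i-th one: product rule for every finite injective choice of indices. *)
Definition mutually_independent (I : Type) (F : I -> set (set T)) : Prop :=
  forall (m : nat) (e : 'I_m -> I) (A : 'I_m -> set T),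
    injective e -> (forall a, F (e a) (A a)) ->
    prob (\big[setI/setT]_(a < m) A a) = \prod_(a < m) prob (A a).

End Probability.

Definition limC {R : realType} (a : nat -> R[i]) : R[i] :=
  Complex (limn (fun n => complex.Re (a n))) (limn (fun n => complex.Im (a n))).

(* Attempts are numbered from 1, as are vehicles. Critical-gap indices
   k = 1..M and profiles r = 1..R are the ordinals of 'I_nK and 'I_nR.
   maxN is the maximum number N of attempts; None stands for N = oo.
   pk i k r, u i k r are p_(i,k,r), u_(i,k,r); they are meaningful only for
   attempts i in 1..N. *)
Record params (R : realType) := Params {
  nK : nat;
  nR : nat;
  maxN : option nat;
  q : R;
  lam : R;
  pr : 'I_nR -> R;
  pk : nat -> 'I_nK -> 'I_nR -> R;
  u : nat -> 'I_nK -> 'I_nR -> R;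
  Delta : 'I_nR -> R
}.
Arguments pr {R} prm _ : rename.
Arguments pk {R} prm _ _ _ : rename.
Arguments u {R} prm _ _ _ : rename.
Arguments Delta {R} prm _ : rename.

Notation vtype prm := (nat * 'I_(nK prm) * 'I_(nR prm))%type.

Section Params.
Context {R : realType}.
Variable prm : params R.

Definition attempt_le (i : nat) : bool :=
  (0 < i)%N && (if maxN prm is Some N then (i <= N)%N else true).

Definition is_type (t : vtype prm) : bool := attempt_le t.1.1.

Definition ubar (t : vtype prm) : R := u prm t.1.1 t.1.2 t.2 - Delta prm t.2.

Record valid_params : Prop := ValidParams {
  q_gt0 : 0 < q prm;
  lam_gt0 : 0 < lam prm;
  pr_ge0 : forall r, 0 <= pr prm r;
  pr_sum : \sum_r pr prm r = 1;
  pk_ge0 : forall i k r, attempt_le i -> 0 <= pk prm i k r;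
  pk_sum : forall i r, attempt_le i -> \sum_k pk prm i k r = 1;
  Delta_ge0 : forall r, 0 <= Delta prm r;
  Delta_lt_u : forall i k r, attempt_le i -> Delta prm r < u prm i k r;
  limited_reuse : forall i k r0 l r1, attempt_le i ->
    u prm i k r0 - Delta prm r0 <= u prm 1 l r1
}.

(* \sum_(a <= i <= N) F i; for N = oo, the limit of the partial sums. *)
Definition sumN (a : nat) (F : nat -> R) : R :=
  limn (fun n => \sum_(a <= i < n.+1 | attempt_le i) F i).
Definition sumNC (a : nat) (F : nat -> R[i]) : R[i] :=
  limC (fun n => \sum_(a <= i < n.+1 | attempt_le i) F i).

(* E[h(T_(i,r))] *)
Definition expT (i : nat) (r : 'I_(nR prm)) (h : R -> R) : R :=
  \sum_k pk prm i k r * h (u prm i k r).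

(* v^(1,k,r)_(i,l,r0) with its positive and negative parts, and c_(k,r0,r). *)
Definition v (k : 'I_(nK prm)) (r : 'I_(nR prm)) (t : vtype prm) : R :=
  u prm 1 k r - u prm t.1.1 t.1.2 t.2 + Delta prm t.2.
Definition vhat k r t : R := Num.max (v k r t) 0.
Definition vcheck k r t : R := Num.max (- v k r t) 0.

Definition cc (k : 'I_(nK prm)) (r0 r : 'I_(nR prm)) : R :=
  \sum_(l < nK prm) sumN 2 (fun i =>
    pr prm r0 * pk prm i l r0 * expR (- q prm * (u prm i l r0 + vhat k r (i, l, r0)))
    * \prod_(2 <= m < i) (1 - expT m r0 (fun x => expR (- q prm * x)))).

End Params.

(* The randomness of the model. By the lack of memory of the two Poisson
   processes, the part of the traffic that matters for vehicle n is described
   afresh, in terms of exponential interarrival times: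
   - init: the pair (X_0, J_1);
   - prof n: profile of vehicle n;
   - crit n i r: index k of the critical gap u_(i,k,r) that vehicle n samples at
     attempt i if its profile is r;
   - tau n i: the variable tau_q in the i-th gap seen by vehicle n;
   - ibt n 0, bsize n 0: if vehicle n - 1 leaves an empty queue behind, time
     until the next batch, and size of that batch;
   - ibt n m, bsize n m, m >= 1: interarrival times, counted from the start of
     the service of vehicle n, and sizes of the subsequent batches. *)
Record traffic (R : realType) (prm : params R) (T : Type) := Traffic {
  init : T -> nat * vtype prm;
  prof : nat -> T -> 'I_(nR prm);
  crit : nat -> nat -> 'I_(nR prm) -> T -> 'I_(nK prm);
  tau : nat -> nat -> T -> R;
  ibt : nat -> nat -> T -> R;
  bsize : nat -> nat -> T -> nat
}.

Inductive source (m : nat) : Type :=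
| Init
| Prof of nat
| Crit of nat & nat & 'I_m
| Tau of nat & nat
| Ibt of nat & nat
| Bsize of nat & nat.

Section Dynamics.
Context {R : realType} {prm : params R} {T : Type}.
Variable tr : traffic prm T.

Definition seen_gap (n : nat) (y : R) (i : nat) (w : T) : R :=
  if i == 1%N then y + tau tr n 1 w else tau tr n i w.

Definition accepts (n : nat) (y : R) (i : nat) (w : T) : bool :=
  let r := prof tr n w in u prm i (crit tr n i r w) r <= seen_gap n y i w.

(* The junk value 0 is taken when no gap is ever accepted. *)
Definition attempt (n : nat) (y : R) (w : T) : nat :=
  if pselect (exists i, (0 < i)%N && accepts n y i w) is left h
  then ex_minn h else 0%N.

Definition type_of (n : nat) (y : R) (w : T) : vtype prm :=
  let r := prof tr n w in let i := attempt n y w in (i, crit tr n i r w, r).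

(* Service time of vehicle n when E_y holds. *)
Definition service (n : nat) (y : R) (w : T) : R :=
  \sum_(1 <= i < attempt n y w) seen_gap n y i w + Delta prm (prof tr n w).

(* Number of batches in the first t time units of the service of vehicle n:
   the least m such that batch m + 1 arrives after t (junk value 0). *)
Definition batches (n : nat) (t : R) (w : T) : nat :=
  if pselect (exists m, t < \sum_(1 <= j < m.+2) ibt tr n j w) is left h
  then ex_minn h else 0%N.

Definition arrivals (n : nat) (t : R) (w : T) : nat :=
  (\sum_(1 <= m < (batches n t w).+1) bsize tr n m w)%N.

(* Leftover gap faced by vehicle n when s = (X_(n-1), J_n). *)
Definition leftover (n : nat) (s : nat * vtype prm) (w : T) : R :=
  if s.1 == 0%N then Num.max (ubar s.2 - ibt tr n 0 w) 0 else ubar s.2.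

(* (X_n, J_(n+1)) *)
Fixpoint state (n : nat) (w : T) : nat * vtype prm :=
  if n is n'.+1 then
    let s := state n' w in
    let y := leftover n s w in
    let x := if s.1 == 0%N then bsize tr n 0 w else s.1 in
    ((x + arrivals n (service n y w) w).-1, type_of n y w)
  else init tr w.

Definition X (n : nat) (w : T) : nat := (state n w).1.
(* J is used for n >= 1 only. *)
Definition J (n : nat) (w : T) : vtype prm := (state n.-1 w).2.

Definition Y (n : nat) (w : T) : R := leftover n (state n.-1 w) w.
Definition G (n : nat) (w : T) : R := service n (Y n w) w.
Definition A (n : nat) (w : T) : nat := arrivals n (G n w) w.

Definition makes_attempt (n i : nat) (w : T) : Prop :=
  forall m, (1 <= m < i)%N -> ~~ accepts n (Y n w) m w.

End Dynamics.

Section Model.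
Context {R : realType} {prm : params R}.
Context {d : measure_display} {T : measurableType d}.
Variables (P : probability T R) (tr : traffic prm T).

Definition source_events (s : source (nR prm)) : set (set T) :=
  match s with
  | Init => [set init tr @^-1` B | B in setT]
  | Prof n => [set prof tr n @^-1` B | B in setT]
  | Crit n i r => [set crit tr n i r @^-1` B | B in setT]
  | Tau n i => [set tau tr n i @^-1` B | B in measurable]
  | Ibt n m => [set ibt tr n m @^-1` B | B in measurable]
  | Bsize n m => [set bsize tr n m @^-1` B | B in setT]
  end.

Record gap_model : Prop := GapModel {
  source_measurable : forall s, source_events s `<=` measurable;
  source_independent : mutually_independent P source_events;
  init_type : forall w, is_type (init tr w).2;
  prof_law : forall n r, prob P (prof tr n @^-1` [set r]) = pr prm r;
  crit_law : forall n i r k, attempt_le prm i ->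
    prob P (crit tr n i r @^-1` [set k]) = pk prm i k r;
  tau_law : forall n i (B : set R), measurable B ->
    P (tau tr n i @^-1` B) = exponential_prob (q prm) B;
  ibt_law : forall n m (B : set R), measurable B ->
    P (ibt tr n m @^-1` B) = exponential_prob (lam prm) B;
  bsize_law : forall n m b,
    prob P (bsize tr n m @^-1` [set b]) = prob P (bsize tr 0 0 @^-1` [set b]);
  bsize_ge1 : forall n m, P [set w | (1 <= bsize tr n m w)%N] = 1%E
}.

(* N is the maximum number of attempts that a driver needs: all types are
   almost surely in the range 1..N. This holds automatically for N = oo. *)
Definition attempts_bounded : Prop :=
  forall n, P [set w | is_type (J tr n.+1 w)] = 1%E.

Definition B (z : R[i]) : R[i] := expectC P (fun w => z ^+ bsize tr 0 0 w).

(* lim_n E[A_n | X_(n-1) >= 1] < 1; A_n need not be integrable a priori. *)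
Definition stable : Prop :=
  exists2 a : \bar R, (a < 1)%E &
    (fun n => 'E_P[fun w => ((A tr n.+1 w)%:R * (1 <= X tr n w)%N%:R)%R]
              * ((prob P [set w | (1 <= X tr n w)%N])^-1)%:E)%E @ \oo --> a.

(* (X_n, J_(n+1)) converges in distribution to a proper limit. *)
Definition steady_state : Prop :=
  let p n (s : nat * vtype prm) := prob P (state tr n @^-1` [set s]) in
  (forall s, cvgn (fun n => p n s)) /\
  (\esum_(s in setT) (limn (fun n => p n s))%:E = 1)%E.

Definition f (t : vtype prm) (z : R[i]) : R[i] :=
  limC (fun n => expectC P (fun w => z ^+ X tr n w * (J tr n.+1 w == t)%:R)).

(* f_t(0) is the real number lim_n P(X_n = 0, J_(n+1) = t), since 0 ^+ 0 = 1. *)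
Definition f0 (t : vtype prm) : R := complex.Re (f t 0).

(* The predecessor's type is the argument t, that of the vehicle itself t'. *)
Definition Apgf (t t' : vtype prm) (z : R[i]) : R[i] :=
  limC (fun n => cexpectC P
    (fun w => z ^+ A tr n.+1 w * (J tr n.+2 w == t')%:R)
    [set w | J tr n.+1 w = t /\ (1 <= X tr n w)%N]).

Definition Astar (t t' : vtype prm) (z : R[i]) : R[i] :=
  limC (fun n => cexpectC P
    (fun w => z ^+ A tr n.+1 w * (J tr n.+2 w == t')%:R)
    [set w | J tr n.+1 w = t /\ X tr n w = 0%N]).

(* E[e^(-s G) 1{type = t'} | E_y] *)
Definition Gy (t' : vtype prm) (s y : R) : R :=
  limn (fun n => expect P
    (fun w => expR (- s * service tr n y w) * (type_of tr n y w == t')%:R)).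

(* E[e^(-s G^(n)) 1{J_(n+1) = t'} | J_n = t] *)
Definition Gt (t t' : vtype prm) (s : R) : R :=
  limn (fun n => cexpect P
    (fun w => expR (- s * G tr n w) * (J tr n.+1 w == t')%:R)
    [set w | J tr n w = t]).

Definition samples (n : nat) (t : vtype prm) : set T :=
  [set w | prof tr n w = t.2 /\ crit tr n t.1.1 t.2 w = t.1.2].

Definition piS (t : vtype prm) : R :=
  limn (fun n => cprob P [set w | attempt tr n (Y tr n w) w = t.1.1]
                         (samples n t)).

Definition makes (n : nat) (t : vtype prm) : set T :=
  [set w | makes_attempt tr n t.1.1 w] `&` samples n t.

Definition PS (t : vtype prm) : R :=
  limn (fun n => cprob P [set w | accepts tr n (Y tr n w) t.1.1 w]
                         (makes n t)).

Definition fbar (t : vtype prm) : R :=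
  f0 t / (piS t * pk prm t.1.1 t.1.2 t.2 * pr prm t.2).

End Model.

(* Main.v *)
Require Import Defs.
From HB Require Import structures.
From mathcomp Require Import all_boot all_order all_algebra.
From mathcomp Require Import complex.
From mathcomp Require Import all_classical all_reals all_analysis.
From mathcomp Require Import measurable_realfun zify ring lra.

(** Given the state [s = (X_n, J_(n+1))], the course of vehicle [n + 1] depends
    on its own sources only, which are independent of the past and whose joint
    law does not depend on the vehicle. Hence the expectation of a bounded
    quantity attached to vehicle [n + 1] is that of a fixed bounded function of
    the state. As the limit law of the state is proper, the expectation of any
    bounded function of the state converges, and the limit functional is linear
    and sums over the types. Every formula of the theorem is an identity between
    functions of the state, to which this functional is applied.

    For the transforms (b), the gaps seen at the successive attempts are
    independent exponential variables, the first one lengthened by [y]; in the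
    main formula, after an idle period, [y] is what the exponential time until
    the next batch leaves of the predecessor's gap. In (c), the probability of an [i]-th attempt by profile [r]
    is [p_r] minus the probabilities of the earlier successes. The system for
    [P_(1,k,r)] compares the first attempt after a busy and after an idle
    departure; by limited gap reusability all [v] are nonnegative, so that
    [vhat = v] and [vcheck = 0]. In (a), [z ^ (X_(n+1) + 1)] is
    [z ^ (x + A_(n+1))], where [x] is [X_n], or the size of a new batch if
    [X_n = 0]. *)

Set Implicit Arguments.
Unset Strict Implicit.
Unset Printing Implicit Defensive.

Import Order.TTheory GRing.Theory Num.Theory.
Import numFieldNormedType.Exports.

Local Open Scope classical_set_scope.
Local Open Scope ring_scope.

(** * Bounded random variables *)

(** [expect] is the [fine] part of an integral, hence linear only on integrable functions. All
    computations are therefore kept inside the class [bmf], and quantities that are bounded only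
    almost surely are first replaced by bounded versions. The model states independence as a product
    rule for finitely many events, one per source. To use it for functions, [T] is regarded with the
    smaller sigma-algebra generated by a set of sources: depending on these sources then means being
    measurable for it. Measurability lemmas are proved for an arbitrary set of sources, so that they
    also yield independence. Random indices (state, profile, critical gap, number of batches) are
    treated by cutting along countable fibres. The limit law enters only through its point masses.
    Finitely many states carry almost all of the mass, which permits exchanging limits with the
    series over attempts when [maxN] is [None]. Conditional quantities may be junk where the
    conditioning event has probability 0, and such degenerate cases are settled apart. *)

Definition bmf {R : realType} d (T : measurableType d) (f : T -> R) : Prop :=
  measurable_fun setT f /\ exists C : R, forall w, `|f w| <= C.

Section BoundedMeasurable.
Context {R : realType} {d : measure_display} {T : measurableType d}.
Implicit Types (f g : T -> R) (E : set T).

Lemma bmf_cst (c : R) : bmf (fun _ : T => c).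
Proof. by split; [exact: measurable_cst | exists `|c|]. Qed.

Lemma bmf_add f g : bmf f -> bmf g -> bmf (fun w => f w + g w).
Proof.
move=> [mf [C hf]] [mg [D hg]]; split; first exact: measurable_funD.
by exists (C + D) => w; rewrite (le_trans (ler_normD _ _))// lerD.
Qed.

Lemma bmf_mul f g : bmf f -> bmf g -> bmf (fun w => f w * g w).
Proof.
move=> [mf [C hf]] [mg [D hg]]; split; first exact: measurable_funM.
by exists (C * D) => w; rewrite normrM ler_pM.
Qed.

Lemma bmf_opp f : bmf f -> bmf (fun w => - f w).
Proof.
move=> [mf [C hf]]; split; first exact: measurableT_comp.
by exists C => w; rewrite normrN.
Qed.

Lemma bmf_sub f g : bmf f -> bmf g -> bmf (fun w => f w - g w).
Proof. by move=> hf hg; apply: bmf_add => //; exact: bmf_opp. Qed.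

Lemma bmf_sum (I : Type) (s : seq I) (Q : pred I) (F : I -> T -> R) :
  (forall i, bmf (F i)) -> bmf (fun w => \sum_(i <- s | Q i) F i w).
Proof.
move=> hF; elim: s => [|i s IH].
  by under eq_fun do rewrite big_nil; exact: bmf_cst.
under eq_fun do rewrite big_cons.
by case: (Q i) => //; exact: bmf_add.
Qed.

Lemma bmf_indic E : measurable E -> bmf (\1_E : T -> R).
Proof.
move=> mE; split; first exact: measurable_indic.
by exists 1 => w; rewrite indicE; case: (_ \in _); rewrite ?normr0 ?normr1.
Qed.

Lemma bool_indic (b : T -> bool) : (fun w => (b w)%:R : R) = \1_[set w | b w] :> (T -> R).
Proof.
apply/funext => w; rewrite indicE; suff -> : (w \in [set w | b w]) = b w by [].
by apply/idP/idP => [/set_mem//|bw]; apply/mem_set.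
Qed.

Lemma bmf_bool (b : T -> bool) :
  measurable [set w | b w] -> bmf (fun w => (b w)%:R : R).
Proof. by move=> mb; rewrite bool_indic; exact: bmf_indic. Qed.

End BoundedMeasurable.

Lemma bmf_comp {R : realType} d (T : measurableType d) d' (T' : measurableType d')
    (X : T -> T') (f : T' -> R) :
  measurable_fun setT X -> bmf f -> bmf (fun w => f (X w)).
Proof.
move=> mX [mf [C fC]]; split; first exact: measurableT_comp mf mX.
by exists C.
Qed.

Section Expectation.
Context {R : realType} {d : measure_display} {T : measurableType d}.
Variable P : probability T R.
Implicit Types (f g : T -> R) (E : set T).

Lemma expectE f : expect P f = (\int[P]_w f w)%R.
Proof. by rewrite /expect unlock. Qed.

Lemma bmf_integrable f : bmf f -> P.-integrable setT (EFin \o f).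
Proof.
move=> [mf [C fC]]; apply: measurable_bounded_integrable => //.
  by rewrite -ge0_fin_numE// fin_num_measure.
exists C; split; first exact: num_real.
by move=> x Cx w _; exact: le_trans (fC w) (ltW Cx).
Qed.

Lemma probE E : measurable E -> (prob P E)%:E = P E.
Proof. by move=> mE; rewrite /prob fineK// fin_num_measure. Qed.

Lemma prob_expect E : measurable E -> prob P E = expect P (fun w => \1_E w).
Proof. by move=> mE; rewrite expectE /Rintegral integral_indic// setIT. Qed.

Lemma expect_cst (c : R) : expect P (fun=> c) = c.
Proof. by rewrite expectE Rintegral_cst//= probability_setT mulr1. Qed.

Lemma expectD f g : bmf f -> bmf g ->
  expect P (fun w => f w + g w) = expect P f + expect P g.
Proof. by move=> hf hg; rewrite !expectE RintegralD//; exact: bmf_integrable. Qed.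

Lemma expectB f g : bmf f -> bmf g ->
  expect P (fun w => f w - g w) = expect P f - expect P g.
Proof. by move=> hf hg; rewrite !expectE RintegralB//; exact: bmf_integrable. Qed.

Lemma expectZ (c : R) f : bmf f -> expect P (fun w => c * f w) = c * expect P f.
Proof. by move=> hf; rewrite !expectE RintegralZl//; exact: bmf_integrable. Qed.

Lemma expectZr (c : R) f : bmf f -> expect P (fun w => f w * c) = expect P f * c.
Proof. by move=> hf; rewrite !expectE RintegralZr//; exact: bmf_integrable. Qed.

Lemma expect_sum (I : Type) (s : seq I) (F : I -> T -> R) :
  (forall i, bmf (F i)) ->
  expect P (fun w => \sum_(i <- s) F i w) = \sum_(i <- s) expect P (F i).
Proof.
move=> hF; elim: s => [|i s IH].
  by rewrite big_nil; under eq_fun do rewrite big_nil; rewrite expect_cst.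
rewrite big_cons -IH -expectD//; last exact: bmf_sum.
by congr expect; apply/funext => w; rewrite big_cons.
Qed.

Lemma expect_le f g : bmf f -> bmf g -> (forall w, f w <= g w) ->
  expect P f <= expect P g.
Proof.
move=> hf hg fg; rewrite !expectE.
by apply: le_Rintegral => //; exact: bmf_integrable.
Qed.

Lemma expect_norm_le f g : bmf f -> bmf g -> (forall w, `|f w| <= g w) ->
  `|expect P f| <= expect P g.
Proof.
move=> hf hg fg; rewrite ler_norml; apply/andP; split.
  rewrite -subr_ge0 opprK -expectD// -(expect_cst 0).
  apply: expect_le; [exact: bmf_cst | exact: bmf_add |] => w.
  by have := fg w; rewrite ler_norml => /andP[]; lra.
by apply: expect_le => // w; exact: le_trans (ler_norm _) (fg w).
Qed.

Lemma ae_prob1 E : measurable E -> P E = 1%E -> {ae P, forall w, E w}.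
Proof.
move=> mE PE; exists (~` E); split; first exact: measurableC.
  by apply: etrans (probability_setC P mE) _; rewrite PE subee.
by move=> w.
Qed.

Lemma ae_expect f g : measurable_fun setT f -> measurable_fun setT g ->
  {ae P, forall w, f w = g w} -> expect P f = expect P g.
Proof.
move=> mf mg fg; rewrite !expectE /Rintegral; congr fine.
apply: ae_eq_integral => //; [exact/measurable_EFinP..|].
by apply: filterS fg => w /= h _; rewrite h.
Qed.

(** Countable additivity of the integral over the fibres of [X], numbered by [pickle]. Asking each
    fibre to contribute 0 avoids any summability question; an equality of expectations follows by
    applying this to a difference. *)
Lemma expect_partition (S : countType) (X : T -> S) f :
  bmf f -> (forall s, measurable (X @^-1` [set s])) ->
  (forall s, expect P (fun w => f w * (X w == s)%:R) = 0) ->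
  expect P f = 0.
Proof.
move=> hf mX h0; rewrite expectE /Rintegral.
(* The fibre with code [k]; it is empty when [k] codes no element of [S]. *)
pose F k := [set w | pickle (X w) = k].
have FE k : F k = if unpickle k is Some s then
    (if pickle s == k then X @^-1` [set s] else set0) else set0.
  apply/seteqP; split=> w.
    by rewrite /F /= => <-; rewrite pickleK eqxx.
  case: unpickle => //= s; case: eqP => //= <-.
  by rewrite /F /= => ->.
have mF k : measurable (F k).
  by rewrite FE; case: unpickle => // s; case: ifP.
have FT : \bigcup_k F k = setT.
  by apply/seteqP; split=> // w _; exists (pickle (X w)).
rewrite -FT integral_bigcup//; last first.
- by rewrite FT; exact: bmf_integrable.
- by move=> i j _ _ [w [/= <- <-]].
rewrite eseries0//= => k _ _; rewrite FE.
case: unpickle => [s|]; last by rewrite integral_set0.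
case: ifP => _; last by rewrite integral_set0.
have hfs : bmf (fun w => f w * (X w == s)%:R).
  apply: bmf_mul => //; apply: bmf_bool.
  by rewrite (_ : [set _ | _] = X @^-1` [set s])//; apply/seteqP; split=> w /eqP.
rewrite integral_mkcond.
transitivity (\int[P]_w (f w * (X w == s)%:R)%:E)%E.
  apply: eq_integral => w _; rewrite patchE /=; case: (eqVneq (X w) s) => h.
    by rewrite mulr1 mem_set.
  by rewrite mulr0 memNset// => /= /eqP; apply/negP.
rewrite -[LHS]fineK; last exact: integrable_fin_num (bmf_integrable hfs).
by have := h0 s; rewrite expectE /Rintegral => ->.
Qed.

End Expectation.

(** * Independence of families of sources *)

Section PiSystems.
Context {R : realType} {d : measure_display} {T : measurableType d}.
Variable P : probability T R.

Lemma measure_eq_g_sigma (G : set (set T)) (m1 m2 : {measure set T -> \bar R}) :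
  G `<=` measurable -> setI_closed G -> G setT -> (m1 setT < +oo)%E ->
  (forall A, G A -> m1 A = m2 A) -> forall A, <<s G >> A -> m1 A = m2 A.
Proof.
move=> GM GI GT m1T m12 A sA.
apply: (g_sigma_algebra_measure_unique G GM (fun=> setT)) => //.
by apply/seteqP; split=> // w _; exists 0%N.
Qed.

Definition indep (C D : set (set T)) : Prop :=
  forall A B, C A -> D B -> prob P (A `&` B) = prob P A * prob P B.

Lemma indep_sym C D : indep C D -> indep D C.
Proof. by move=> CD A B DA CB; rewrite setIC mulrC CD. Qed.

(** For fixed [A], sending [B] to the probability of its intersection with [A], or to the product of
    the two probabilities, defines two finite measures ([mrestr] and [mscale]); they agree on a
    pi-system containing the whole space, hence on the sigma-algebra it generates. *)
Lemma indep_g_sigmar (C G : set (set T)) :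
  C `<=` measurable -> G `<=` measurable -> setI_closed G -> G setT ->
  indep C G -> indep C <<s G >>.
Proof.
move=> CM GM GI GT CG A B CA sB; have mA := CM _ CA.
have mB : measurable B by apply: sB; split=> //; exact: sigma_algebra_measurable.
have pA : 0 <= prob P A by rewrite /prob fine_ge0.
have : (P (B `&` A) = (prob P A)%:E * P B)%E.
  apply: (measure_eq_g_sigma (m1 := mrestr P mA) (m2 := mscale (NngNum pA) P) GM) => //.
    by rewrite /mrestr -ge0_fin_numE// fin_num_measure//; exact: measurableI.
  move=> A' GA'; have mA' := GM _ GA'.
  suff : (P (A' `&` A) = (prob P A)%:E * P A')%E by [].
  by rewrite setIC -!probE ?CG// ?EFinM//; exact: measurableI.
by rewrite setIC /prob => ->; rewrite fineM// fin_num_measure.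
Qed.

Lemma indep_g_sigma (C D : set (set T)) :
  C `<=` measurable -> setI_closed C -> C setT ->
  D `<=` measurable -> setI_closed D -> D setT ->
  indep C D -> indep <<s C >> <<s D >>.
Proof.
move=> CM CI CT DM DI DT CD; apply: indep_g_sigmar => //.
  exact: smallest_sub (@sigma_algebra_measurable _ T) CM.
exact/indep_sym/indep_g_sigmar/indep_sym.
Qed.

End PiSystems.

Section Cylinders.
Context {I : choiceType} {T : pointedType}.
Implicit Types (F : I -> set (set T)) (K : set I).

Definition gen F K : set (set T) := \bigcup_(i in K) F i.

(** Finite intersections of source events; unlike [gen F K] they form a pi-system. The factors are
    prescribed at all indices, so that two cylinders can be combined index by index, with [setT]
    outside of the lists. *)
Definition cylinders F K : set (set T) :=
  [set A | exists s : seq I, exists B : I -> set T,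
     [/\ uniq s, forall i, i \in s -> K i, forall i, F i (B i)
       & A = \big[setI/setT]_(i <- s) B i]].

Lemma big_setI_undup (s : seq I) (B : I -> set T) :
  \big[setI/setT]_(i <- undup s) B i = \big[setI/setT]_(i <- s) B i.
Proof.
apply/seteqP; split=> w; rewrite -!bigcap_seq => h i /= si; apply: h => /=;
  by rewrite ?mem_undup// -mem_undup.
Qed.

Lemma cylinders_setT F K : (forall i, F i setT) -> cylinders F K setT.
Proof. by move=> FT; exists [::], (fun=> setT); split; rewrite ?big_nil. Qed.

Lemma cylinders_setI F K : (forall i, F i setT) -> (forall i, setI_closed (F i)) ->
  setI_closed (cylinders F K).
Proof.
move=> FT FI A A' [s [B [us sK FB ->]]] [s' [B' [us' sK' FB' ->]]].
exists (undup (s ++ s')), (fun i => (if i \in s then B i else setT)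
                             `&` (if i \in s' then B' i else setT)); split.
- exact: undup_uniq.
- by move=> i; rewrite mem_undup mem_cat => /orP[/sK|/sK'].
- by move=> i; apply: FI; case: ifP.
- rewrite big_setI_undup -!bigcap_seq; apply/seteqP; split=> w.
    move=> [h h'] i /=; rewrite mem_cat => _.
    by split; case: ifP => // si; [exact: h | exact: h'].
  move=> h; split=> i /= si.
    by have := h i; rewrite /= mem_cat si => /(_ isT)[].
  by have := h i; rewrite /= mem_cat si orbT => /(_ isT)[]; case: ifP.
Qed.

Lemma g_sigma_cylinders F K : (forall i, F i setT) ->
  <<s gen F K >> = <<s cylinders F K >>.
Proof.
move=> FT; apply/seteqP; split.
  apply: smallest_sub; first exact: smallest_sigma_algebra.
  move=> A [i Ki FiA]; apply: sub_gen_smallest.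
  exists [:: i], (fun j => if j == i then A else setT); split=> //.
  - by move=> j; rewrite inE => /eqP ->.
  - by move=> j; case: eqP => // ->.
  - by rewrite big_seq1 eqxx.
apply: smallest_sub; first exact: smallest_sigma_algebra.
move=> A [s [B [_ sK FB ->]]].
have : forall i, i \in s -> <<s gen F K>> (B i).
  by move=> i si; apply: sub_gen_smallest; exists i => //; exact: sK.
elim: s {sK} => [_|i s IH h].
  by rewrite big_nil; exact: (@measurableT _ (g_sigma_algebraType (gen F K))).
rewrite big_cons; apply: (@measurableI _ (g_sigma_algebraType (gen F K))).
  by apply: h; rewrite mem_head.
by apply: IH => j js; apply: h; rewrite inE js orbT.
Qed.
End Cylinders.

Section Groups.
Context {R : realType} {d : measure_display} {T : measurableType d}.
Variable P : probability T R.
Context {I : choiceType} (F : I -> set (set T)).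
Hypothesis FT : forall i, F i setT.
Hypothesis FI : forall i, setI_closed (F i).
Hypothesis FM : forall i, F i `<=` measurable.
Hypothesis Findep : mutually_independent P F.

Lemma prob_cylinder (s : seq I) (B : I -> set T) : uniq s -> (forall i, F i (B i)) ->
  prob P (\big[setI/setT]_(i <- s) B i) = \prod_(i <- s) prob P (B i).
Proof.
move=> us FB.
(* [nth] needs a default index and [I] may be empty, so the empty intersection is settled
   separately. *)
have [->|/hasP[i0 _ _]] : s = [::] \/ has predT s.
  by case: s {us} => [|i s]; [left | right].
  by rewrite !big_nil /prob probability_setT.
rewrite !(big_nth i0) !big_mkord.
apply: (Findep (e := fun a : 'I_(size s) => nth i0 s a)) => // a b /eqP.
by rewrite nth_uniq// => /eqP /val_inj.
Qed.

Lemma cylinders_measurable K : cylinders F K `<=` measurable.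
Proof.
move=> A [s [B [_ _ FB ->]]]; elim: s => [|i s IH]; first by rewrite big_nil.
by rewrite big_cons; apply: measurableI => //; exact: FM.
Qed.

Lemma gen_measurable K : <<s gen F K>> `<=` measurable.
Proof.
by apply: smallest_sub => [|A [i _]]; [exact: sigma_algebra_measurable | exact: FM].
Qed.

Lemma indep_gen K L : K `&` L = set0 -> indep P <<s gen F K>> <<s gen F L>>.
Proof.
move=> KL; rewrite !g_sigma_cylinders//.
apply: indep_g_sigma; try exact: cylinders_measurable; try exact: cylinders_setT;
  try exact: cylinders_setI.
move=> A A' [s [B [us sK FB ->]]] [s' [B' [us' sL FB' ->]]].
(* As the two lists of indices are disjoint, the factors of both cylinders merge into one family,
   and the product rule applies to the concatenated list. *)
pose C i := if i \in s then B i else B' i.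
have ss' i : i \in s' -> (i \in s) = false.
  move=> s'i; apply/negP => si.
  by have : (K `&` L) i by [split; [exact: sK | exact: sL]]; rewrite KL.
have bigs (R' : Type) (idx : R') op (G : set T -> R') :
    \big[op/idx]_(i <- s) G (B i) = \big[op/idx]_(i <- s) G (C i).
  by apply: eq_big_seq => i si; rewrite /C si.
have bigs' (R' : Type) (idx : R') op (G : set T -> R') :
    \big[op/idx]_(i <- s') G (B' i) = \big[op/idx]_(i <- s') G (C i).
  by apply: eq_big_seq => i si; rewrite /C ss'.
rewrite (bigs _ _ _ id) (bigs' _ _ _ id) -big_cat !prob_cylinder//; last 4 first.
- by move=> i; rewrite /C; case: ifP.
- by move=> i; rewrite /C; case: ifP.
- rewrite cat_uniq us us' andbT; apply/hasPn => i /ss' /= ->; exact: isT.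
- by move=> i; rewrite /C; case: ifP.
by rewrite big_cat.
Qed.

End Groups.

(** * Fubini's theorem for two independent random variables *)

Section DecouplingFubini.
Context {R : realType} {d : measure_display} {T : measurableType d}.
Variable P : probability T R.
Context {d1 d2 : measure_display} {T1 : measurableType d1} {T2 : measurableType d2}.
Variables (X1 : T -> T1) (X2 : T -> T2).
Hypotheses (mX1 : measurable_fun setT X1) (mX2 : measurable_fun setT X2).
Hypothesis X12 : forall A B, measurable A -> measurable B ->
  prob P (X1 @^-1` A `&` X2 @^-1` B) = prob P (X1 @^-1` A) * prob P (X2 @^-1` B).

Lemma bmf_expect_snd (H : T1 * T2 -> R) : bmf H ->
  bmf (fun x => expect P (fun w => H (x, X2 w))).
Proof.
move=> [mH [C hC]].
pose mX2' : {mfun T >-> T2} := HB.pack X2 (isMeasurableFun.Build _ _ _ _ X2 mX2).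
have bH x : bmf (fun w => H (x, X2 w)).
  apply: (bmf_comp (X := fun w => (x, X2 w)) (f := H)); last by split=> //; exists C.
  by apply: measurable_fun_pair => //; exact: measurable_cst.
split; last first.
  exists C => x; rewrite -[leRHS](expect_cst P).
  by apply: expect_norm_le => //; exact: bmf_cst.
(* Tonelli's theorem, which gives the measurability of partial integrals, is about nonnegative
   functions: the bound [C] is added here and subtracted again at the end. *)
pose H' z := (H z + C)%:E.
have H'0 z : (0 <= H' z)%E.
  by rewrite lee_fin; have := hC z; rewrite ler_norml => /andP[]; lra.
have mH' : measurable_fun setT H'.
  by apply/measurable_EFinP; apply: measurable_funD => //; exact: measurable_cst.
have := measurable_fun_fubini_tonelli_F (m2 := distribution P mX2') H' mH' H'0.
rewrite (_ : fubini_F _ _ = EFin \o (fun x => expect P (fun w => H (x, X2 w)) + C)).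
  move=> /measurable_EFinP h.
  rewrite (_ : (fun x => _) = (fun x => expect P (fun w => H (x, X2 w)) + C - C)).
    by apply: measurable_funB => //; exact: measurable_cst.
  by apply/funext => x; rewrite addrK.
apply/funext => x; rewrite /fubini_F.
have bH' : bmf (fun w => H (x, X2 w) + C) by apply: bmf_add => //; exact: bmf_cst.
rewrite integral_distribution//; last first.
- exact: bmf_integrable bH'.
- by apply: (measurableT_comp mH'); apply: measurable_fun_pair => //; exact: measurable_cst.
rewrite /= -[X in _ + X](expect_cst P) -expectD//; last exact: bmf_cst.
by rewrite expectE /Rintegral fineK//; exact: integrable_fin_num (bmf_integrable P bH').
Qed.

(** Independence says that the law of the pair agrees with the product of the two laws on
    rectangles, hence everywhere; Fubini's theorem for the product measure then gives the iterated
    expectation. *)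
Lemma expect_decouple (H : T1 * T2 -> R) : bmf H ->
  expect P (fun w => H (X1 w, X2 w)) =
  expect P (fun w1 => expect P (fun w2 => H (X1 w1, X2 w2))).
Proof.
move=> bH.
pose mX1' : {mfun T >-> T1} := HB.pack X1 (isMeasurableFun.Build _ _ _ _ X1 mX1).
pose mX2' : {mfun T >-> T2} := HB.pack X2 (isMeasurableFun.Build _ _ _ _ X2 mX2).
have mX : measurable_fun setT (fun w => (X1 w, X2 w)) by exact: measurable_fun_pair.
pose mX' : {mfun T >-> (T1 * T2)%type} :=
  HB.pack (fun w => (X1 w, X2 w)) (isMeasurableFun.Build _ _ _ _ _ mX).
pose P1 := distribution P mX1'.
pose P2 := distribution P mX2'.
pose P12 := distribution P mX'.
have E12 A : measurable A -> (P1 \x P2)%E A = P12 A.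
  move=> mA; apply: product_measure_unique => // B C mB mC.
  have h := X12 mB mC.
  have mB' : measurable (X1 @^-1` B) by rewrite -[X in measurable X]setTI; exact: mX1.
  have mC' : measurable (X2 @^-1` C) by rewrite -[X in measurable X]setTI; exact: mX2.
  transitivity (P (X1 @^-1` B `&` X2 @^-1` C)); first by [].
  by rewrite -probE ?h ?EFinM ?probE//; exact: measurableI.
have iH : (P1 \x P2)%E.-integrable setT (EFin \o H).
  case: bH => mH [C hC]; apply: measurable_bounded_integrable => //.
    have h : ((P1 \x P2)%E setT < +oo)%E.
      by rewrite E12// -ge0_fin_numE// fin_num_measure.
    exact: h.
  exists C; split; first exact: num_real.
  by move=> x Cx w _; exact: le_trans (hC w) (ltW Cx).
have bH1 w1 : bmf (fun y => H (X1 w1, y)).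
  by apply: bmf_comp bH; apply: measurable_fun_pair => //; exact: measurable_cst.
transitivity (fine (\int[P12]_z (H z)%:E)%E).
  rewrite expectE /Rintegral; congr fine.
  rewrite integral_distribution//.
    by case: bH => mH _; exact/measurable_EFinP.
  by apply: bmf_integrable; exact: bmf_comp bH.
rewrite (eq_measure_integral (P1 \x P2)%E); last by move=> A mA _; exact/esym/E12.
rewrite -integral12_prod_meas1// /fubini_F.
rewrite expectE /Rintegral; congr fine.
have iP2 w1 : (\int[P2]_y (H (X1 w1, y))%:E =
    (expect P (fun w2 => H (X1 w1, X2 w2)))%:E)%E.
  have bH2 : bmf (fun w2 => H (X1 w1, X2 w2)) by exact: bmf_comp (bH1 w1).
  rewrite integral_distribution//; last first.
  - exact: bmf_integrable bH2.
  - by case: (bH1 w1) => mH _; exact/measurable_EFinP.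
  by rewrite expectE /Rintegral fineK//; exact: integrable_fin_num (bmf_integrable P bH2).
have FE : fubini_F P2 (EFin \o H) \o X1 =
    EFin \o (fun w1 => expect P (fun w2 => H (X1 w1, X2 w2))).
  by apply/funext => w; exact: iP2.
rewrite integral_distribution//.
- by apply: eq_integral => w _; rewrite FE.
- exact: measurable_fubini_F iH.
- rewrite FE; apply: bmf_integrable; split.
    apply/measurable_EFinP; rewrite -FE.
    by apply: measurableT_comp => //; exact: measurable_fubini_F iH.
  case: (bH) => mH [C hC]; exists C => w1.
  rewrite -[leRHS](expect_cst P); apply: expect_norm_le => [||w2].
  - exact: bmf_comp (bH1 w1).
  - exact: bmf_cst.
  - exact: hC.
Qed.

End DecouplingFubini.

Section GroupExpectation.
Context {R : realType} {d : measure_display} {T : measurableType d}.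
Variable P : probability T R.
Context {I : choiceType} (F : I -> set (set T)).
Hypothesis FT : forall i, F i setT.
Hypothesis FI : forall i, setI_closed (F i).
Hypothesis FM : forall i, F i `<=` measurable.
Hypothesis Findep : mutually_independent P F.

Lemma bmf_gen K (f : g_sigma_algebraType (gen F K) -> R) :
  bmf f -> bmf (f : T -> R).
Proof.
move=> [mf [C fC]]; split; last by exists C.
by move=> _ B mB; apply: (gen_measurable FM (K := K)); exact: mf.
Qed.

Lemma expect_decouple_gen K L
    (H : g_sigma_algebraType (gen F K) * g_sigma_algebraType (gen F L) -> R) :
  K `&` L = set0 -> bmf H ->
  expect P (fun w => H (w, w)) =
  expect P (fun w1 => expect P (fun w2 => H (w1, w2))).
Proof.
move=> KL bH.
(* The identity, read as a map to [T] with the sigma-algebra generated by [K], is the random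
   variable that collects all the sources of [K]. *)
pose id' K : T -> g_sigma_algebraType (gen F K) := id.
have mid K' : measurable_fun setT (id' K').
  by move=> _ B mB; rewrite setTI; exact: (gen_measurable FM mB).
apply: (expect_decouple (X1 := id' K) (X2 := id' L)) => // A B mA mB.
exact: (indep_gen FT FI FM Findep KL).
Qed.

Lemma expect_mul_gen K L (f g : T -> R) : K `&` L = set0 ->
  bmf (f : g_sigma_algebraType (gen F K) -> R) ->
  bmf (g : g_sigma_algebraType (gen F L) -> R) ->
  expect P (fun w => f w * g w) = expect P f * expect P g.
Proof.
move=> KL bf bg.
rewrite (expect_decouple_gen
  (H := fun ww : g_sigma_algebraType (gen F K) * g_sigma_algebraType (gen F L) =>
          f ww.1 * g ww.2) KL); last first.
  by apply: bmf_mul; [exact: bmf_comp bf | exact: bmf_comp bg].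
transitivity (expect P (fun w1 => f w1 * expect P g)).
  by congr expect; apply/funext => w1 /=; rewrite expectZ//; exact: bmf_gen bg.
by rewrite expectZr//; exact: bmf_gen bf.
Qed.

End GroupExpectation.

(** * Measurability of the dynamics *)

Section Countable.
Context {d : measure_display} {T : measurableType d}.

(** Freezes a random index: on each fibre of [X] the index is constant, and there are countably many
    fibres. Random profiles, critical gaps, states and numbers of batches are all treated in this
    way. *)
Lemma measurable_fibres (S : countType) (X : T -> S) (A : S -> set T) :
  (forall s, measurable (X @^-1` [set s] `&` A s)) ->
  measurable [set w | A (X w) w].
Proof.
move=> mA; rewrite (_ : [set _ | _] = \bigcup_s (X @^-1` [set s] `&` A s)).
  by apply: countable_bigcupT_measurable => //; exact: countableP.
by apply/seteqP; split=> [w Aw|w [s _ [/= <-]]//]; exists (X w).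
Qed.

Lemma measurable_countable_fun (S : countType) (X : T -> S) (B : set S) :
  (forall s, measurable (X @^-1` [set s])) -> measurable (X @^-1` B).
Proof.
move=> mX; apply: (@measurable_fibres S X (fun s => [set _ | B s])) => s.
case: (pselect (B s)) => Bs.
  by rewrite (_ : [set _ | B s] = setT) ?setIT//; apply/seteqP; split.
by rewrite (_ : [set _ | B s] = set0) ?setI0//; apply/seteqP; split.
Qed.

Lemma measurable_sum_nat {R : realType} (a b : nat) (h : nat -> T -> R) :
  (forall i, (a <= i < b)%N -> measurable_fun setT (h i)) ->
  measurable_fun setT (fun w => \sum_(a <= i < b) h i w).
Proof.
move=> mh; under eq_fun do rewrite big_nat_cond big_mkcond.
apply: measurable_sum => i; case: (boolP (a <= i < b)%N) => [hi|_] /=; first exact: mh.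
exact: measurable_cst.
Qed.

(** Common shape of [attempt] and [batches], which unfold to instances of it, junk value
    included. *)
Definition least (p : pred nat) : nat :=
  if pselect (exists i, p i) is left h then ex_minn h else 0%N.

Lemma leastP (p : pred nat) m : (least p = m) <->
  (p m /\ forall i, (i < m)%N -> ~~ p i) \/ (m = 0%N /\ forall i, ~~ p i).
Proof.
rewrite /least; case: pselect => [h|h].
  case: ex_minnP => k pk kmin; split=> [<-|[[pm mmin]|[_ np]]].
  - by left; split=> // i ik; apply/negP => /kmin; rewrite leqNgt ik.
  - apply/eqP; rewrite eqn_leq kmin// leqNgt; apply/negP => mk.
    by have := mmin k mk; rewrite pk.
  - by have := np k; rewrite pk.
split=> [<-|[[pm _]|[-> _]]//]; last by case: h; exists m.
by right; split=> // i; apply/negP => pi; apply: h; exists i.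
Qed.

(** Whether the least index is [m] is decided by the tests up to [m], except for [m = 0], which is
    also the junk value and may involve all tests. Thanks to this precision, success at attempt [j]
    is seen to involve only the sources of the attempts up to [j]. *)
Lemma measurable_least (p : nat -> T -> bool) m :
  (forall i, (i <= m)%N -> measurable [set w | p i w]) ->
  (m = 0%N -> forall i, measurable [set w | p i w]) ->
  measurable [set w | least (p^~ w) = m].
Proof.
move=> mp mp0.
have mN i : measurable [set w | p i w] -> measurable [set w | ~~ p i w].
  move=> h; rewrite (_ : [set _ | _] = ~` [set w | p i w]); first exact: measurableC.
  by apply/seteqP; split=> w /negP.
rewrite (_ : [set _ | _] =
    ([set w | p m w] `&` \bigcap_(i in [set i | (i < m)%N]) [set w | ~~ p i w])
    `|` (if m == 0%N then \bigcap_i [set w | ~~ p i w] else set0)).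
  apply: measurableU.
    apply: measurableI; first exact: mp.
    have [->|m0] := eqVneq m 0%N.
      by rewrite (_ : [set i | (i < 0)%N] = set0) ?bigcap_set0//; apply/seteqP; split.
    apply: bigcap_measurable; first by exists 0%N; rewrite /= lt0n.
    by move=> i /= im; apply/mN/mp/ltnW.
  case: eqP => // /mp0 {}mp0.
  by apply: bigcapT_measurable => i; exact: mN.
apply/seteqP; split=> w /=.
  move=> /leastP[[pm h]|[-> h]]; first by left.
  by right => i _; exact: h.
move=> h; apply/leastP; case: h => [[pm h]|]; first by left; split=> // i im; exact: h.
by case: eqP => // -> h; right; split=> // i; exact: h.
Qed.

Lemma measurable_least_fun (p : nat -> T -> bool) :
  (forall i, measurable [set w | p i w]) ->
  measurable_fun setT (fun w => least (p^~ w)).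
Proof.
move=> mp _ B mB; rewrite setTI; apply: measurable_countable_fun => m.
by apply: measurable_least => i.
Qed.

End Countable.

(** * Measurability of the dynamics relative to a set of sources *)

Section ModelMeasurability.
Context {R : realType} {prm : params R} {d : measure_display} {T : measurableType d}.
Variable tr : traffic prm T.
Variable K : set (source (nR prm)).
Hypothesis mK : forall a, K a -> source_events tr a `<=` measurable.

Lemma measurable_prof n r : K (Prof _ n) -> measurable [set w | prof tr n w = r].
Proof. by move=> /mK; apply; exists [set r]. Qed.

Lemma measurable_crit n i r k : K (Crit n i r) ->
  measurable [set w | crit tr n i r w = k].
Proof. by move=> /mK; apply; exists [set k]. Qed.

Lemma measurable_tau n i : K (Tau _ n i) -> measurable_fun setT (tau tr n i).
Proof. by move=> /mK h _ B mB; rewrite setTI; apply: h; exists B. Qed.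

Lemma measurable_ibt n m : K (Ibt _ n m) -> measurable_fun setT (ibt tr n m).
Proof. by move=> /mK h _ B mB; rewrite setTI; apply: h; exists B. Qed.

Lemma measurable_bsize n m : K (Bsize _ n m) -> measurable_fun setT (bsize tr n m).
Proof. by move=> /mK h _ B mB; rewrite setTI; apply: h; exists B. Qed.

Section Vehicle.
Variables (n : nat) (y : T -> R).
Hypothesis my : measurable_fun setT y.
Hypothesis Kprof : K (Prof _ n).

Lemma measurable_seen_gap i : K (Tau _ n i) ->
  measurable_fun setT (fun w => seen_gap tr n (y w) i w).
Proof.
rewrite /seen_gap; case: eqP => [->|_] Ki; last exact: measurable_tau.
by apply: measurable_funD => //; exact: measurable_tau.
Qed.

Lemma measurable_accepts i : (forall r, K (Crit n i r)) -> K (Tau _ n i) ->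
  measurable [set w | accepts tr n (y w) i w].
Proof.
move=> Kc Kt; rewrite /accepts.
apply: (@measurable_fibres _ _ _ (prof tr n)
  (fun r w => u prm i (crit tr n i r w) r <= seen_gap tr n (y w) i w)) => r.
apply: measurableI; first exact: measurable_prof.
apply: (@measurable_fibres _ _ _ (crit tr n i r)
  (fun k w => u prm i k r <= seen_gap tr n (y w) i w)) => k.
apply: measurableI; first exact: measurable_crit.
rewrite -[X in measurable X]setTI; apply: measurable_fun_ler => //.
exact: measurable_seen_gap.
Qed.

(** Boolean form of [makes_attempt] for a predecessor gap [y] that may be random; [iota 1 j.-1]
    lists the attempts from 1 to [j - 1]. *)
Definition rejects j w := all (fun m => ~~ accepts tr n (y w) m w) (iota 1 j.-1).

Lemma rejectsP j w :
  reflect (forall m, (1 <= m < j)%N -> ~~ accepts tr n (y w) m w) (rejects j w).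
Proof.
apply: (iffP allP) => h m.
  by case: j h => [|j] h; rewrite ?andbF// => hm; apply: h; rewrite mem_iota.
by rewrite mem_iota => hm; apply: h; case: j hm => //; rewrite addn0; case: m.
Qed.

Lemma measurable_rejects j :
  (forall i r, (i < j)%N -> K (Crit n i r)) -> (forall i, (i < j)%N -> K (Tau _ n i)) ->
  measurable [set w | rejects j w].
Proof.
move=> Kc Kt.
rewrite (_ : [set _ | _] =
  \big[setI/setT]_(i <- iota 1 j.-1) ~` [set w | accepts tr n (y w) i w]); last first.
  rewrite -bigcap_seq; apply/seteqP; split=> w /=.
    by move=> /allP h i /= /h /negP.
  by move=> h; apply/allP => i /h /= /negP.
rewrite big_seq; apply: big_ind => //; first exact: measurableI.
move=> i; rewrite mem_iota => /andP[i0 ij]; apply/measurableC/measurable_accepts.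
- by move=> r; apply: Kc; lia.
- by apply: Kt; lia.
Qed.

Lemma attempt_eq j w : (0 < j)%N ->
  (attempt tr n (y w) w == j) = accepts tr n (y w) j w && rejects j w.
Proof.
move=> j0; apply/eqP/andP => [/leastP[[/andP[_ aj] h]|[j00]]|[aj /rejectsP h]].
- by split=> //; apply/rejectsP => m /andP[m0 mj]; have := h _ mj; rewrite m0.
- by rewrite j00 in j0.
- apply/leastP; left; split; first by rewrite j0.
  by case=> //= i ij; apply: h.
Qed.

(** Type [t] is recognised from the attempts up to [t.1.1] alone. The disjunctions in the hypotheses
    cover the junk attempt number 0, which depends on all attempts and reads the critical gap at
    index 0. *)
Lemma measurable_type_of t :
  (forall i r, (0 < i)%N || (i == t.1.1)%N -> (i <= t.1.1)%N || (t.1.1 == 0)%N ->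
    K (Crit n i r)) ->
  (forall i, (i <= t.1.1)%N || (t.1.1 == 0)%N -> K (Tau _ n i)) ->
  measurable [set w | type_of tr n (y w) w = t].
Proof.
case: t => [[j l] r] /= Kc Kt.
rewrite (_ : [set _ | _] = [set w | attempt tr n (y w) w = j]
   `&` ([set w | crit tr n j r w = l] `&` [set w | prof tr n w = r])); last first.
  apply/seteqP; split=> w /=; rewrite /type_of; first by move=> [<- <- <-].
  by move=> [hj [hc hp]]; rewrite hp hj hc.
apply: measurableI; last first.
  apply: measurableI; last exact: measurable_prof.
  by apply: measurable_crit; apply: Kc; rewrite ?eqxx ?orbT ?leqnn.
have macc i : (i <= j)%N || (j == 0)%N ->
    measurable [set w | (0 < i)%N && accepts tr n (y w) i w].
  case: i => [_|i ij] /=; first by rewrite (_ : [set _ | _] = set0)//; apply/seteqP; split.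
  by apply: measurable_accepts => [r'|]; [exact: Kc | exact: Kt].
apply: measurable_least => [i ij|j0 i]; apply: macc; first by rewrite ij.
by rewrite j0 orbT.
Qed.

(** The service time with the number of attempts frozen at [j]: a sum with deterministic bounds,
    equal to the service time whenever [j] is the actual number. *)
Definition serv j w := \sum_(1 <= i < j) seen_gap tr n (y w) i w + Delta prm (prof tr n w).

Lemma serviceE w : service tr n (y w) w = serv (type_of tr n (y w) w).1.1 w.
Proof. by []. Qed.

Lemma measurable_serv j : (forall i, (i < j)%N -> K (Tau _ n i)) ->
  measurable_fun setT (serv j).
Proof.
move=> Kt; apply: measurable_funD.
  apply: measurable_sum_nat => i /andP[_ ij].
  by apply: measurable_seen_gap; exact: Kt.
move=> _ B mB; rewrite setTI.
apply: (@measurable_countable_fun _ _ _ (prof tr n) (Delta prm @^-1` B)) => r.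
exact: measurable_prof.
Qed.

End Vehicle.

Lemma measurable_batches n (S : T -> R) : measurable_fun setT S ->
  (forall m, (0 < m)%N -> K (Ibt _ n m)) ->
  measurable_fun setT (fun w => batches tr n (S w) w).
Proof.
move=> mS Ki.
apply: (measurable_least_fun (p := fun m w => S w < \sum_(1 <= j < m.+2) ibt tr n j w)) => m.
rewrite -[X in measurable X]setTI; apply: measurable_fun_ltr => //.
by apply: measurable_sum_nat => j /andP[j0 _]; apply: measurable_ibt; exact: Ki.
Qed.

Lemma measurable_arrivals n (S : T -> R) : measurable_fun setT S ->
  (forall m, (0 < m)%N -> K (Ibt _ n m) /\ K (Bsize _ n m)) ->
  measurable_fun setT (fun w => arrivals tr n (S w) w).
Proof.
move=> mS Ki _ B mB; rewrite setTI.
have mb : measurable_fun setT (fun w => batches tr n (S w) w).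
  by apply: measurable_batches => // m /Ki[].
apply: (@measurable_fibres _ _ _ (fun w => batches tr n (S w) w)
  (fun b w => B (\sum_(1 <= m < b.+1) bsize tr n m w)%N)) => b.
apply: measurableI; first by rewrite -[X in measurable X]setTI; exact: mb.
suff ms : measurable_fun setT (fun w => (\sum_(1 <= m < b.+1) bsize tr n m w)%N).
  by rewrite -[X in measurable X]setTI; exact: ms.
elim: b => [|b IH]; first by under eq_fun do rewrite big_nil; exact: measurable_cst.
under eq_fun do rewrite big_nat_recr//=.
by apply: measurable_fun_addn => //; apply: measurable_bsize; case: (Ki b.+1).
Qed.

Lemma measurable_leftover n s : K (Ibt _ n 0) ->
  measurable_fun setT (fun w => leftover tr n s w).
Proof.
move=> Ki; rewrite /leftover; case: (s.1 == 0%N); last exact: measurable_cst.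
apply: measurable_maxr; last exact: measurable_cst.
by apply: measurable_funB; [exact: measurable_cst | exact: measurable_ibt].
Qed.

End ModelMeasurability.

Definition vehicle_le (m n : nat) (a : source m) : Prop :=
  match a with
  | Init => True
  | Prof j | Crit j _ _ | Tau j _ | Ibt j _ | Bsize j _ => (j <= n)%N
  end.

(** Only the sources of vehicles up to [n] are assumed measurable, so the lemma also applies to [T]
    with the events of these sources alone; this is what makes the state independent of vehicle
    [n + 1]. *)
Lemma measurable_state {R : realType} {prm : params R} {d : measure_display}
    {T : measurableType d} (tr : traffic prm T) n s :
  (forall a, vehicle_le n a -> source_events tr a `<=` measurable) ->
  measurable [set w | state tr n w = s].
Proof.
elim: n s => [|n IH] s mK; first by apply: (mK (Init _)) => //; exists [set s].
have {}IH s' : measurable [set w | state tr n w = s'].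
  apply: IH => a an; apply: mK.
  by case: a an => //= *; exact: leqW.
rewrite /=.
pose N s w := ((if s.1 == 0%N then bsize tr n.+1 0 w else s.1)
  + arrivals tr n.+1 (service tr n.+1 (leftover tr n.+1 s w) w) w).-1.
apply: (@measurable_fibres _ _ _ (state tr n) (fun s' => [set w |
  (N s' w, type_of tr n.+1 (leftover tr n.+1 s' w) w) = s])) => s'.
apply: measurableI; first exact: IH.
have my : measurable_fun setT (leftover tr n.+1 s').
  by apply: (measurable_leftover mK); exact: leqnn.
pose S := serv tr n.+1 (leftover tr n.+1 s') s.2.1.1.
(* On the event that the new type is [s.2] the number of attempts is known, and the service time may
   be replaced by its frozen version [S]. *)
rewrite (_ : [set _ | _] = [set w | type_of tr n.+1 (leftover tr n.+1 s' w) w = s.2]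
  `&` [set w | ((if s'.1 == 0%N then bsize tr n.+1 0 w else s'.1)
                + arrivals tr n.+1 (S w) w).-1 = s.1]); last first.
  apply/seteqP; split=> w /=; rewrite /N /S.
    by move=> <- /=; rewrite -serviceE.
  by move=> [h]; rewrite -h -serviceE => h'; rewrite h' h; case: (s).
apply: measurableI.
  by apply: (measurable_type_of mK) => // *; exact: leqnn.
have mS : measurable_fun setT S by apply: (measurable_serv mK) => // *; exact: leqnn.
have ma : measurable_fun setT (fun w => arrivals tr n.+1 (S w) w).
  by apply: (measurable_arrivals mK) => // *; split; exact: leqnn.
have mx : measurable_fun setT (fun w => if s'.1 == 0%N then bsize tr n.+1 0 w else s'.1).
  case: (s'.1 == 0%N); last exact: measurable_cst.
  by apply: (measurable_bsize mK); exact: leqnn.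
have := measurable_fun_addn mx ma.
by move=> /(_ measurableT [set a | a.-1 = s.1]); rewrite setTI; apply.
Qed.

(** * Law of a single vehicle *)

Lemma prob_countable_law {R : realType} {d : measure_display} {T : measurableType d}
    (P : probability T R) (S : countType) (X X' : T -> S) (B : set S) :
  (forall s, measurable (X @^-1` [set s])) -> (forall s, measurable (X' @^-1` [set s])) ->
  (forall s, prob P (X @^-1` [set s]) = prob P (X' @^-1` [set s])) ->
  prob P (X @^-1` B) = prob P (X' @^-1` B).
Proof.
move=> mX mX' XX'; rewrite /prob; congr fine.
pose F (Z : T -> S) k := Z @^-1` (B `&` [set s | pickle s = k]).
have FZ (Z : T -> S) : (forall s, measurable (Z @^-1` [set s])) ->
    P (Z @^-1` B) = (\sum_(0 <= k <oo) P (F Z k))%E.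
  move=> mZ; rewrite (_ : Z @^-1` B = \bigcup_k F Z k); last first.
    apply/seteqP; split=> w; last by move=> [k _ []].
    by move=> Bw; exists (pickle (Z w)).
  rewrite measure_bigcup//.
  - by apply: eq_eseriesl => k; rewrite in_setT.
  - by move=> k _; exact: measurable_countable_fun.
  - by move=> i j _ _ [w [[_ <-] [_ <-]]].
rewrite !FZ//; apply: eq_eseriesr => k _; rewrite /F.
case E : (@unpickle S k) => [s|]; last first.
  by congr (P _); apply/seteqP; split=> w /= [_ h]; rewrite -h pickleK in E.
case: (pselect (B s /\ pickle s = k)) => [[Bs sk]|nB].
  rewrite (_ : B `&` _ = [set s]) -?probE ?XX'//.
  apply/seteqP; split=> [s' [_ h]|s' ->//].
  by rewrite /= -h pickleK in E; case: E.
rewrite (_ : B `&` _ = set0) ?preimage_set0//.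
apply/seteqP; split=> s' // [Bs' h]; apply: nB.
by move: E; rewrite -h pickleK => -[<-].
Qed.

HB.instance Definition _ m := gen_eqMixin (source m).
HB.instance Definition _ m := gen_choiceMixin (source m).

Definition relabel (p : nat) n (a : source p) : source p :=
  match a with
  | Init => Init _ | Prof _ => Prof _ n | Crit _ i r => Crit n i r
  | Tau _ i => Tau _ n i | Ibt _ m => Ibt _ n m | Bsize _ m => Bsize _ n m
  end.

Section SourceEvents.
Context {R : realType} {prm : params R} {d : measure_display} {T : measurableType d}.
Variable tr : traffic prm T.

Lemma source_events_setT a : source_events tr a setT.
Proof. by case: a => *; exists setT. Qed.

Lemma source_events_setI a : setI_closed (source_events tr a).
Proof.
case: a => [|n|n i r|n i|n m|n m] A A' [B mB <-] [B' mB' <-]; exists (B `&` B') => //;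
  exact: measurableI.
Qed.

(* T itself, with the events generated by the sources in K: a random variable
   depends on these sources only if it is measurable on this type. *)
Definition sub_traffic (K : set (source (nR prm))) :=
  g_sigma_algebraType (gen (source_events tr) K).

Lemma sub_trafficP K a : K a ->
  @source_events R prm _ (sub_traffic K) tr a `<=` measurable.
Proof. by move=> Ka A aA; apply: sub_gen_smallest; exists a. Qed.

(* The sources of a single vehicle, labelled by 0; critical gaps of attempts
   outside of 1..N are left out, since their law is arbitrary. *)
Definition vehicle_sources : set (source (nR prm)) :=
  [set a | match a with
           | Init => False
           | Crit j i _ => j = 0%N /\ attempt_le prm i
           | Prof j | Tau j _ | Ibt j _ | Bsize j _ => j = 0%N
           end].

(* The dependence on tr only serves to choose a default point. *)
Definition vehicle_space : Type := let _ := tr in traffic prm unit.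

(** A realisation of the sources of vehicle [n], stored as a traffic over [unit] in which every
    label carries the same data. The dynamics of [coord] at label 0, evaluated at this point, is by
    computation the dynamics of vehicle [n]. *)
Definition vehicle (n : nat) (w : T) : vehicle_space :=
  Traffic (fun _ => init tr w) (fun _ _ => prof tr n w) (fun _ i r _ => crit tr n i r w)
    (fun _ i _ => tau tr n i w) (fun _ m _ => ibt tr n m w) (fun _ m _ => bsize tr n m w).

HB.instance Definition _ := gen_eqMixin vehicle_space.
HB.instance Definition _ := gen_choiceMixin vehicle_space.
HB.instance Definition _ := isPointed.Build vehicle_space (vehicle 0 point).

Definition coord : traffic prm vehicle_space :=
  Traffic (fun x => init x tt) (fun n x => prof x n tt) (fun n i r x => crit x n i r tt)
    (fun n i x => tau x n i tt) (fun n m x => ibt x n m tt) (fun n m x => bsize x n m tt).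

(** The sigma-algebra generated by [set0] is a placeholder that makes [vehicle_space] a measurable
    type, as [source_events] requires; the one of interest, in [vehicle_mspace], is generated by
    these very events. *)
Definition coord_events (a : source (nR prm)) : set (set vehicle_space) :=
  @source_events _ _ _ (g_sigma_algebraType (set0 : set (set vehicle_space))) coord a.

Definition vehicle_mspace := g_sigma_algebraType (gen coord_events vehicle_sources).

Lemma coord_eventsP a : vehicle_sources a ->
  @source_events _ _ _ vehicle_mspace coord a `<=` measurable.
Proof. by move=> Ka A aA; apply: sub_gen_smallest; exists a. Qed.

End SourceEvents.
Arguments coord_events {R prm d T} tr _ _.

Section Independence.
Context {R : realType} {prm : params R} {d : measure_display} {T : measurableType d}.
Context {P : probability T R} {tr : traffic prm T}.
Hypothesis hmodel : gap_model P tr.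

Let FM := source_measurable hmodel.
Let FT := source_events_setT tr.
Let FI := @source_events_setI _ _ _ _ tr.
Let Findep := source_independent hmodel.

Lemma bmf_sub_traffic K (f : sub_traffic tr K -> R) : bmf f -> bmf (f : T -> R).
Proof. exact: bmf_gen. Qed.

Lemma sub_traffic_measurable K (A : set (sub_traffic tr K)) :
  measurable A -> measurable (A : set T).
Proof. exact: gen_measurable. Qed.

Lemma prob_setI_sources K L A B : K `&` L = set0 ->
  measurable (A : set (sub_traffic tr K)) -> measurable (B : set (sub_traffic tr L)) ->
  prob P (A `&` B) = prob P A * prob P B.
Proof. by move=> KL; apply: (indep_gen FT FI FM Findep KL). Qed.

Lemma expect_mul_sources K L (f g : T -> R) : K `&` L = set0 ->
  bmf (f : sub_traffic tr K -> R) -> bmf (g : sub_traffic tr L -> R) ->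
  expect P (fun w => f w * g w) = expect P f * expect P g.
Proof. by move=> KL bf bg; apply: (expect_mul_gen FT FI FM Findep KL). Qed.

Lemma expect_decouple_sources K L (H : sub_traffic tr K * sub_traffic tr L -> R) :
  K `&` L = set0 -> bmf H ->
  expect P (fun w => H (w, w)) =
  expect P (fun w1 => expect P (fun w2 => H (w1, w2))).
Proof. exact: (expect_decouple_gen FT FI FM Findep). Qed.

Lemma relabelK n m a : vehicle_sources (prm := prm) a -> relabel n (relabel m a) = relabel n a.
Proof. by case: a. Qed.

Lemma relabel0 a : vehicle_sources (prm := prm) a -> relabel 0 a = a.
Proof. by case: a => //= *; try (congr Crit); intuition (subst => //). Qed.

Lemma vehicle_preimage n a B : vehicle_sources (prm := prm) a ->
  coord_events tr a B -> source_events tr (relabel n a) (vehicle tr n @^-1` B).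
Proof. by case: a => //= [j|j i r|j i|j m|j m] _ [C mC <-]; exists C. Qed.

Lemma source_law n a B : vehicle_sources a -> coord_events tr a B ->
  prob P (vehicle tr n @^-1` B) = prob P (vehicle tr 0 @^-1` B).
Proof.
case: a => //= [j|j i r|j i|j m|j m].
- move=> -> [C _ <-]; apply: (@prob_countable_law _ _ _ _ _ (prof tr n) (prof tr 0)) => s.
  + by apply: (FM (s := Prof _ n)); exists [set s].
  + by apply: (FM (s := Prof _ 0)); exists [set s].
  + by rewrite !(prof_law hmodel).
- move=> [-> hi] [C _ <-].
  apply: (@prob_countable_law _ _ _ _ _ (crit tr n i r) (crit tr 0 i r)) => s.
  + by apply: (FM (s := Crit n i r)); exists [set s].
  + by apply: (FM (s := Crit 0 i r)); exists [set s].
  + by rewrite !(crit_law hmodel).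
- move=> -> [C mC <-]; rewrite /prob; congr fine.
  exact: (etrans (tau_law hmodel n i mC) (esym (tau_law hmodel 0 i mC))).
- move=> -> [C mC <-]; rewrite /prob; congr fine.
  exact: (etrans (ibt_law hmodel n m mC) (esym (ibt_law hmodel 0 m mC))).
- move=> -> [C _ <-]; apply: (@prob_countable_law _ _ _ _ _ (bsize tr n m) (bsize tr 0 m)) => s.
  + by apply: (FM (s := Bsize _ n m)); exists [set s].
  + by apply: (FM (s := Bsize _ 0 m)); exists [set s].
  + by rewrite (bsize_law hmodel n) (bsize_law hmodel 0).
Qed.

Lemma measurable_vehicle n :
  measurable_fun setT (vehicle tr n : T -> vehicle_mspace tr).
Proof.
have h := @measurability _ _ T (vehicle_mspace tr) setT (vehicle tr n)
  (gen (coord_events tr) vehicle_sources) erefl.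
apply: h => _ [A [a va aA] <-].
rewrite setTI; apply: (FM (s := relabel n a)); exact: vehicle_preimage.
Qed.

(** The laws of [vehicle tr n] and [vehicle tr 0] agree on cylinders, since the sources of a vehicle
    are independent with laws that do not depend on the vehicle; the cylinders form a pi-system
    generating [vehicle_mspace]. *)
Lemma expect_vehicle n (g : vehicle_mspace tr -> R) : bmf g ->
  expect P (fun w => g (vehicle tr n w)) = expect P (fun w => g (vehicle tr 0 w)).
Proof.
move=> bg.
pose V k : {mfun T >-> vehicle_mspace tr} :=
  HB.pack (vehicle tr k : T -> vehicle_mspace tr)
    (isMeasurableFun.Build _ _ _ _ _ (measurable_vehicle k)).
pose Q k := distribution P (V k).
have EQ k : expect P (fun w => g (vehicle tr k w)) = fine (\int[Q k]_x (g x)%:E)%E.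
  rewrite expectE /Rintegral; congr fine; rewrite integral_distribution//.
    by case: bg => mg _; exact/measurable_EFinP.
  by apply: bmf_integrable; apply: bmf_comp bg; exact: measurable_vehicle.
rewrite !EQ; congr fine; apply: eq_measure_integral => A mA _.
have coordT a : coord_events tr a setT by case: a => *; exists setT.
pose C : set (set (vehicle_mspace tr)) := cylinders (coord_events tr) vehicle_sources.
have CT : C setT by exact: cylinders_setT.
have CI : setI_closed C.
  apply: cylinders_setI => // a.
  by case: a => [|j|j i r|j i|j m|j m] ? ? [B mB <-] [B' mB' <-];
    exists (B `&` B') => //; exact: measurableI.
have CE : @measurable _ (vehicle_mspace tr) = <<s C>> by exact: g_sigma_cylinders.
have CM : C `<=` @measurable _ (vehicle_mspace tr).
  by rewrite CE => B CB; exact: sub_gen_smallest.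
have QT : (distribution P (V n) setT < +oo)%E.
  by rewrite -ge0_fin_numE// fin_num_measure.
have mA' : <<s C>> A by rewrite -CE.
apply: (measure_eq_g_sigma (m2 := distribution P (V 0)) CM CI CT QT _ mA').
move=> B [s [D [us sK FD ->]]].
suff h k : prob P (vehicle tr k @^-1` (\big[setI/setT]_(i <- s) D i)) =
      \prod_(i <- s) prob P (vehicle tr 0 @^-1` D i).
  have mB k : measurable (vehicle tr k @^-1` (\big[setI/setT]_(i <- s) D i)).
    rewrite -[X in measurable X]setTI; apply: measurable_vehicle => //.
    by apply: CM; exists s, D.
  transitivity (P (vehicle tr n @^-1` (\big[setI/setT]_(i <- s) D i))) => //.
  by rewrite -probE// h -(h 0%N) probE.
(* The factors [D] are indexed by sources labelled 0, while independence concerns the sources of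
   vehicle [k]; on [vehicle_sources], [relabel 0] undoes [relabel k]. *)
rewrite (_ : vehicle tr k @^-1` _ = \big[setI/setT]_(j <- map (relabel k) s)
     if j \in map (relabel k) s then vehicle tr k @^-1` D (relabel 0 j) else setT);
    last first.
  rewrite big_map -bigcap_seq preimage_bigcap -bigcap_seq.
  apply: eq_bigcapr => i /= si; have vi := sK _ si.
  by rewrite map_f// relabelK// relabel0.
rewrite (prob_cylinder Findep).
- rewrite big_map big_seq [RHS]big_seq; apply: eq_bigr => i si.
  have vi := sK _ si.
  by rewrite map_f// relabelK// relabel0//; exact: (source_law k vi (FD i)).
- rewrite map_inj_in_uniq// => i j si sj /(congr1 (relabel 0)).
  by rewrite !relabelK ?relabel0//; exact: sK.
- move=> j; case: ifP => [/mapP[i si ->]|_]; last exact: source_events_setT.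
  by rewrite relabelK ?relabel0; [apply: vehicle_preimage|..]; rewrite //; exact: sK.
Qed.

End Independence.

(** * Exponential random variables *)

Lemma expRN_le1 {R : realType} (x : R) : 0 <= x -> expR (- x) <= 1.
Proof. by move=> x0; rewrite -[leRHS]expR0 ler_expR oppr_le0. Qed.

Section ExponentialLaw.
Context {R : realType} {d : measure_display} {T : measurableType d}.
Variable P : probability T R.
Variables (l : R) (V : T -> R).
Hypothesis l0 : 0 < l.
Hypothesis mV : measurable_fun setT V.
Hypothesis lawV : forall B, measurable B -> P (V @^-1` B) = exponential_prob l B.
Notation mu := (@lebesgue_measure R).

(** The law of [V] is given on sets only. Its Radon-Nikodym derivative has the same integral over
    every measurable set as [exponential_pdf l], hence coincides with it almost everywhere and may
    be replaced by it under the integral. *)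
Lemma expect_exponential (g : R -> R) : bmf g ->
  expect P (fun w => g (V w)) = (\int[mu]_x (g x * exponential_pdf l x))%R.
Proof.
move=> bg.
pose V' : {mfun T >-> measurableTypeR R} :=
  HB.pack (V : T -> measurableTypeR R) (isMeasurableFun.Build _ _ _ _ (V : T -> measurableTypeR R) mV).
pose Q := distribution P V'.
have QE A : measurable A -> Q A = (\int[mu]_(x in A) (exponential_pdf l x)%:E)%E.
  by move=> mA; exact: lawV.
have Qmu : Q `<< mu.
  apply/null_content_dominatesP => A mA A0.
  rewrite QE//; apply: null_set_integral => //.
  by apply: measurable_funTS; apply/measurable_EFinP; exact: measurable_exponential_pdf.
have bgV : bmf (fun w => g (V w)) by exact: bmf_comp bg.
have mg : measurable_fun setT (EFin \o g) by case: bg => mg _; exact/measurable_EFinP.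
have igQ : Q.-integrable setT (EFin \o g).
  by apply: bmf_integrable.
rewrite expectE /Rintegral; congr fine.
transitivity (\int[Q]_x (g x)%:E)%E.
  rewrite integral_distribution//; exact: bmf_integrable.
have RN := @Radon_Nikodym_change_of_variables _ _ R
   (distribution P V') (@lebesgue_measure R) Qmu (EFin \o g) setT measurableT igQ.
rewrite -RN.
have aeRN : ae_eq mu setT (Radon_Nikodym (charge_of_finite_measure (distribution P V')) mu)
    (EFin \o exponential_pdf l).
  apply: integral_ae_eq => //.
  - exact: Radon_Nikodym_integrable.
  - by apply/measurable_EFinP; exact: measurable_exponential_pdf.
  - by move=> E _ mE; rewrite -Radon_Nikodym_integral// -QE.
apply: ae_eq_integral => //.
- by apply: emeasurable_funM => //; exact: measurable_int (Radon_Nikodym_integrable _).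
- by apply/measurable_EFinP; apply: measurable_funM; [case: bg | exact: measurable_exponential_pdf].
- by apply: filterS aeRN => x h xT; rewrite /= h.
Qed.

Lemma measurable_exponential_ge (a : R) : measurable [set w | a <= V w].
Proof. by rewrite -[X in measurable X]setTI; apply: measurable_fun_ler. Qed.

Lemma measurable_exponential_lt (a : R) : measurable [set w | V w < a].
Proof. by rewrite -[X in measurable X]setTI; apply: measurable_fun_ltr. Qed.

Lemma exponential_ge0 : {ae P, forall w, 0 <= V w}.
Proof.
apply: (@ae_prob1 _ _ _ P [set w | 0 <= V w]); first exact: measurable_exponential_ge.
rewrite (_ : [set _ | _] = V @^-1` `[0, +oo[%classic); last first.
  by apply/seteqP; split=> w /=; rewrite in_itv/= andbT.
rewrite lawV// -(integral_exponential_pdf l0) /exponential_prob.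
rewrite [RHS]integral_mkcond [LHS]integral_mkcond; apply: eq_integral => x _.
rewrite !patchE in_setT; case: ifPn => //; rewrite notin_setE/= in_itv/= andbT.
by move=> /negP; rewrite -ltNge => /lt0_exponential_pdf ->.
Qed.

Lemma expect_exponential_lt (h : R -> R) (a : R) : bmf h -> 0 <= a ->
  expect P (fun w => h (V w) * (V w < a)%R%:R) =
  (\int[mu]_(x in `[0, a]) (l * expR (- l * x) * h x))%R.
Proof.
move=> bh a0.
have blt : bmf (fun x : R => h x * (x < a)%R%:R).
  apply: bmf_mul => //; apply: bmf_bool.
  rewrite (_ : [set _ | _] = `]-oo, a[%classic); first exact: measurable_itv.
  by apply/seteqP; split=> x /=; rewrite in_itv.
rewrite (expect_exponential blt).
rewrite -Rintegral_itv_bndo_bndc; last first.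
  apply: (@measurable_bounded_integrable _ _ _ mu) => //.
  - have h' : (mu `[0%R, a[%classic < +oo)%E.
      by rewrite lebesgue_measure_itv /=; case: ifP => _; rewrite ?ltry// -EFinB ltry.
    exact: h'.
  - apply: measurable_funTS; apply: measurable_funM; last by case: bh.
    have m1 : measurable_fun setT (fun x : R => - l * x) by exact: mulrl_measurable.
    have m2 := measurableT_comp (@measurable_expR R) m1.
    by apply: measurable_funM => //; exact: measurable_cst.
  - case: bh => _ [C hC]; exists (l * C); split; first exact: num_real.
    move=> x Cx y /=; rewrite in_itv /= => /andP[y0 _].
    apply: le_trans (ltW Cx); rewrite normrM ler_pM//.
    have e0 : 0 <= l * expR (- l * y) by rewrite mulr_ge0 ?expR_ge0 ?ltW.
    rewrite (ger0_norm e0) -[leRHS]mulr1 ler_wpM2l// ?(ltW l0)//.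
    by rewrite mulNr expRN_le1// mulr_ge0// ltW.
rewrite [RHS]Rintegral_mkcond; apply: eq_Rintegral => x _.
rewrite patchE; case: ifPn => [|].
  rewrite inE/= in_itv/= => /andP[x0 xa].
  by rewrite xa mulr1 exponential_pdfE// mulrC.
rewrite notin_setE/= in_itv/= => /negP; rewrite negb_and -ltNge -leNgt => /orP[x0|ax].
  by rewrite lt0_exponential_pdf// mulr0.
by rewrite ltNge ax mulr0 mul0r.
Qed.

(** Up to a constant factor the integrand is the exponential density of rate [s + l], so the
    integral is a multiple of an exponential probability. *)
Lemma Rintegral_exponentialZ (c s a : R) : 0 <= s -> 0 <= a ->
  (\int[mu]_(x in `[0, a]) (l * expR (- l * x) * (c * expR (- s * x))))%R =
  c * (l / (s + l) * (1 - expR (- (s + l) * a))).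
Proof.
move=> s0; rewrite le_eqVlt => /predU1P[<-|a0].
  by rewrite mulr0 expR0 subrr !mulr0 set_itv1 Rintegral_set1.
have sl0 : 0 < s + l by rewrite ltr_wpDl.
transitivity (\int[mu]_(x in `[0, a]) (c * (l / (s + l)) * exponential_pdf (s + l) x))%R.
  apply: eq_Rintegral => x; rewrite inE/= in_itv/= => /andP[x0 _].
  rewrite exponential_pdfE// [- (s + l) * x](_ : _ = - l * x + - s * x); last by ring.
  by rewrite expRD; field; rewrite gt_eqF.
rewrite RintegralZl//; last first.
  by apply: (integrableS measurableT) => //; exact: integrable_exponential_pdf.
rewrite -mulrA; congr (_ * (_ * _)); have := exponential_prob_itv0c (s + l) a0.
by rewrite /exponential_prob /Rintegral => ->.
Qed.

Lemma Rintegral_exponential (s a : R) : 0 <= s -> 0 <= a ->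
  (\int[mu]_(x in `[0, a]) (l * expR (- l * x) * expR (- s * x)))%R =
  l / (s + l) * (1 - expR (- (s + l) * a)).
Proof.
move=> s0 a0; rewrite -[RHS]mul1r -Rintegral_exponentialZ//.
by apply: eq_Rintegral => x _; rewrite mul1r.
Qed.

Lemma expect_exp_lt (s a : R) : 0 <= s -> 0 <= a ->
  expect P (fun w => expR (- s * V w) * (V w < a)%R%:R) =
  l / (s + l) * (1 - expR (- (s + l) * a)).
Proof.
move=> s0 a0; rewrite -Rintegral_exponential//.
(* The discount factor is unbounded on the negative reals when [s > 0], and [V] avoids them only
   almost surely; [h] is bounded and agrees with it on the nonnegative reals. *)
pose h x := expR (- s * Num.max x 0).
have hE x : 0 <= x -> h x = expR (- s * x) by move=> x0; rewrite /h max_l.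
have mh : measurable_fun setT h.
  apply: measurableT_comp => //; apply: measurable_funM => //.
  exact: measurable_maxr.
have bh : bmf h.
  split=> //; exists 1 => x; rewrite ger0_norm ?expR_ge0// /h mulNr.
  by rewrite expRN_le1// mulr_ge0// le_max lexx orbT.
transitivity (expect P (fun w => h (V w) * (V w < a)%R%:R)).
  apply: ae_expect.
  - apply: measurable_funM; last by case: (bmf_bool (R := R) (measurable_exponential_lt a)).
    apply: measurableT_comp => //; exact: measurable_funM.
  - apply: measurable_funM; last by case: (bmf_bool (R := R) (measurable_exponential_lt a)).
    exact: measurableT_comp mh mV.
  - by apply: filterS exponential_ge0 => w /= /hE ->.
rewrite expect_exponential_lt//; apply: eq_Rintegral => x; rewrite inE /= in_itv /=.
by move=> /andP[/hE ->].
Qed.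

Lemma prob_exponential_ge (a : R) : prob P [set w | a <= V w] = expR (- l * Num.max a 0).
Proof.
have [a0|a0] := leP 0 a; last first.
  rewrite mulr0 expR0 prob_expect; last exact: measurable_exponential_ge.
  rewrite -[RHS](expect_cst P); apply: ae_expect.
    by apply: measurable_indic; exact: measurable_exponential_ge.
    exact: measurable_cst.
  apply: filterS exponential_ge0 => w w0; rewrite indicE mem_set//.
  exact: le_trans (ltW a0) w0.
(* With discount rate 0 this is the probability of the complementary event [V w < a]. *)
have := expect_exp_lt (lexx 0) a0.
rewrite add0r divff ?gt_eqF// mul1r.
rewrite (_ : (fun w => _) = (fun w => 1 - (a <= V w)%R%:R)); last first.
  apply/funext => w; rewrite oppr0 mul0r expR0 mul1r ltNge.
  by case: (a <= V w); rewrite ?subrr ?subr0.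
have ba := bmf_bool (R := R) (measurable_exponential_ge a).
rewrite expectB//; last exact: bmf_cst.
rewrite expect_cst bool_indic -prob_expect; last exact: measurable_exponential_ge.
by move=> h; move: h; lra.
Qed.

End ExponentialLaw.

(** * One step of the Markov chain *)

Definition vehicle_is (p n : nat) (a : source p) : Prop :=
  match a with
  | Init => False
  | Prof j | Crit j _ _ | Tau j _ | Ibt j _ | Bsize j _ => j = n
  end.

Lemma bmf_fibres {R : realType} {d : measure_display} {T : measurableType d}
    (S : countType) (X : T -> S) (H : S -> T -> R) (C : R) :
  (forall s, measurable (X @^-1` [set s])) -> (forall s, measurable_fun setT (H s)) ->
  (forall s w, `|H s w| <= C) -> bmf (fun w => H (X w) w).
Proof.
move=> mX mH HC; split; last by exists C.
move=> _ B mB; rewrite setTI.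
apply: (@measurable_fibres _ _ _ X (fun s => H s @^-1` B)) => s.
by apply: measurableI => //; rewrite -[X in measurable X]setTI; exact: mH.
Qed.

Section Step.
Context {R : realType} {prm : params R} {d : measure_display} {T : measurableType d}.
Context {P : probability T R} {tr : traffic prm T}.
Hypothesis hmodel : gap_model P tr.

Lemma measurable_stateT n s : measurable [set w | state tr n w = s].
Proof. by apply: measurable_state => a _; exact: (source_measurable hmodel). Qed.

Lemma bmf_state n (phi : nat * vtype prm -> R) (C : R) :
  (forall s, `|phi s| <= C) -> bmf (fun w => phi (state tr n w)).
Proof.
move=> phiC; apply: (@bmf_fibres _ _ _ _ (state tr n) (fun s _ => phi s) C) => //.
exact: measurable_stateT.
Qed.

Lemma state_eqE n s : [set w | state tr n w == s] = [set w | state tr n w = s].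
Proof. by apply/seteqP; split=> w /= /eqP. Qed.

Lemma bmf_state_eq n s : bmf (fun w => (state tr n w == s)%:R : R).
Proof. by apply: bmf_bool; rewrite state_eqE; exact: measurable_stateT. Qed.

Lemma expect_state_eq n s :
  expect P (fun w => (state tr n w == s)%:R) = prob P [set w | state tr n w = s].
Proof.
rewrite bool_indic state_eqE -prob_expect//; exact: measurable_stateT.
Qed.

Lemma expect_state_mul n s (g : T -> R) :
  bmf (g : sub_traffic tr (vehicle_is n.+1) -> R) ->
  expect P (fun w => (state tr n w == s)%:R * g w) =
  prob P [set w | state tr n w = s] * expect P g.
Proof.
move=> bg; rewrite (expect_mul_sources hmodel (K := vehicle_le n) (L := vehicle_is n.+1))//.
- by rewrite expect_state_eq.
- apply/seteqP; split=> // -[|j|j i r|j i|j m|j m] [] //= jn E; move: jn; rewrite E ltnn//.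
- apply: bmf_bool; rewrite state_eqE.
  by apply: (@measurable_state _ _ _ (sub_traffic tr (vehicle_le n)) tr) => a; exact: sub_trafficP.
Qed.

(** The Markov property in integrated form. On each fibre of the state, [H s] is independent of the
    state, so both sides contribute equally; the bound [C], uniform in [s], keeps the recombined
    function in [bmf]. *)
Lemma expect_state_step n (H : nat * vtype prm -> T -> R) (C : R) :
  (forall s, bmf (H s : sub_traffic tr (vehicle_is n.+1) -> R)) ->
  (forall s w, `|H s w| <= C) ->
  expect P (fun w => H (state tr n w) w) =
  expect P (fun w => expect P (H (state tr n w))).
Proof.
move=> bH HC.
have bHT s : bmf (H s) by exact: (bmf_sub_traffic hmodel (bH s)).
have bf : bmf (fun w => H (state tr n w) w).
  apply: (@bmf_fibres _ _ _ _ (state tr n) H C) => //; first exact: measurable_stateT.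
  by move=> s; case: (bHT s).
have bk : bmf (fun w => expect P (H (state tr n w))).
  apply: (@bmf_state n (fun s => expect P (H s)) C) => s.
  rewrite -[leRHS](expect_cst P); apply: expect_norm_le => //; exact: bmf_cst.
apply/eqP; rewrite -subr_eq0 -expectB//; apply/eqP.
apply: (@expect_partition _ _ _ _ _ (state tr n)).
- exact: bmf_sub.
- exact: measurable_stateT.
move=> s; rewrite (_ : (fun _ => _) = (fun w => (state tr n w == s)%:R * H s w
    - (state tr n w == s)%:R * expect P (H s))); last first.
  by apply/funext => w; case: eqP => [->|_]; rewrite ?mul1r ?mulr1// !mul0r mulr0 subrr.
have bs := bmf_state_eq n s.
rewrite expectB//; [|exact: bmf_mul|by apply: bmf_mul => //; exact: bmf_cst].
by rewrite expect_state_mul// expectZr// expect_state_eq subrr.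
Qed.

End Step.

(** * Service time given the predecessor gap *)

Lemma measurable_discount {R : realType} {d : measure_display} {T : measurableType d}
    (s : R) (g : T -> R) :
  measurable_fun setT g -> measurable_fun setT (fun w => expR (- s * g w)).
Proof.
move=> mg; have m1 : measurable_fun setT (fun w => - s * g w).
  by apply: measurable_funM => //; exact: measurable_cst.
exact: measurableT_comp (@measurable_expR R) m1.
Qed.

Section ClippedService.
Context {R : realType} {prm : params R} {T : Type}.
Variable tr : traffic prm T.

(* The exponential variables may be negative on a null set; clipping the gaps
   at 0 makes the discount factor of the service time bounded by 1. *)
Definition clip_gaps n (y : R) j w := \sum_(1 <= i < j) Num.max (seen_gap tr n y i w) 0.

Definition clip n (t : vtype prm) (s y : R) w : R :=
  expR (- s * (clip_gaps n y t.1.1 w + Delta prm t.2)) * (type_of tr n y w == t)%:R.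

Lemma clip_gaps_ge0 n y j w : 0 <= clip_gaps n y j w.
Proof. by apply: sumr_ge0 => i _; rewrite le_max lexx orbT. Qed.

Lemma clipE n t s y w : 0 <= y -> (forall i, 0 <= tau tr n i w) ->
  clip n t s y w = expR (- s * service tr n y w) * (type_of tr n y w == t)%:R.
Proof.
move=> y0 tau0; rewrite /clip; case: eqP => [<-|]; last by rewrite !mulr0.
rewrite /service (_ : clip_gaps n y _ w = \sum_(1 <= i < attempt tr n y w) seen_gap tr n y i w)//.
apply: eq_bigr => i _.
by rewrite max_l// /seen_gap; case: ifP => _ //; rewrite addr_ge0.
Qed.

End ClippedService.

Section ClippedMeasurability.
Context {R : realType} {prm : params R} {d : measure_display} {T : measurableType d}.
Variable tr : traffic prm T.
Variable K : set (source (nR prm)).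
Hypothesis mK : forall a, K a -> source_events tr a `<=` measurable.
Variables (n : nat) (y : T -> R).
Hypothesis my : measurable_fun setT y.
Hypothesis hprm : valid_params prm.

Lemma bmf_discount s (g : T -> R) : 0 <= s -> measurable_fun setT g ->
  (forall w, 0 <= g w) -> bmf (fun w => expR (- s * g w)).
Proof.
move=> s0 mg g0; split.
  apply: measurableT_comp => //; apply: measurable_funM => //; exact: measurable_cst.
by exists 1 => w; rewrite ger0_norm ?expR_ge0// mulNr expRN_le1// mulr_ge0.
Qed.

Lemma measurable_clip_gaps j : (forall i, (i < j)%N -> K (Tau _ n i)) ->
  measurable_fun setT (fun w => clip_gaps tr n (y w) j w).
Proof.
move=> Kt; apply: measurable_sum_nat => i /andP[_ ij].
apply: measurable_maxr; last exact: measurable_cst.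
by apply: (measurable_seen_gap mK) => //; exact: Kt.
Qed.

Lemma clip_le1 t s y0 w : 0 <= s -> `|clip tr n t s y0 w| <= 1.
Proof.
move=> s0; rewrite /clip normrM -[leRHS]mulr1 ler_pM//; last first.
  by case: eqP; rewrite ?normr1 ?normr0.
rewrite ger0_norm ?expR_ge0// mulNr expRN_le1// mulr_ge0// addr_ge0 ?clip_gaps_ge0//.
exact: Delta_ge0 hprm _.
Qed.

Lemma bmf_clip t s : 0 <= s -> (0 < t.1.1)%N -> K (Prof _ n) ->
  (forall i r, (i <= t.1.1)%N -> K (Crit n i r)) ->
  (forall i, (i <= t.1.1)%N -> K (Tau _ n i)) ->
  bmf (fun w => clip tr n t s (y w) w).
Proof.
move=> s0 t0 Kp Kc Kt; split; last by exists 1 => w; exact: clip_le1.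
have tN0 : (t.1.1 == 0)%N = false by case: t.1.1 t0.
apply: measurable_funM; last first.
  suff: bmf (fun w => (type_of tr n (y w) w == t)%:R : R) by case.
  apply: bmf_bool.
  rewrite (_ : [set _ | _] = [set w | type_of tr n (y w) w = t]).
    apply: (measurable_type_of mK) => //.
      by move=> i r _; rewrite tN0 orbF; exact: Kc.
    by move=> i; rewrite tN0 orbF; exact: Kt.
  by apply/seteqP; split=> w /= /eqP.
have [] // := @bmf_discount s (fun w => clip_gaps tr n (y w) t.1.1 w + Delta prm t.2) s0.
  apply: measurable_funD; last exact: measurable_cst.
  by apply: measurable_clip_gaps => i /ltnW; exact: Kt.
by move=> w; rewrite addr_ge0 ?clip_gaps_ge0//; exact: Delta_ge0 hprm _.
Qed.

End ClippedMeasurability.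

Section ServiceTransform.
Context {R : realType} {prm : params R} {d : measure_display} {T : measurableType d}.
Context {P : probability T R} {tr : traffic prm T}.
Hypothesis hprm : valid_params prm.
Hypothesis hmodel : gap_model P tr.

Lemma mT (a : source (nR prm)) : setT a -> source_events tr a `<=` measurable.
Proof. by move=> _; exact: (source_measurable hmodel). Qed.

Lemma measurable_tauT n i : measurable_fun setT (tau tr n i).
Proof. exact: (measurable_tau (K := setT) mT). Qed.

Lemma tau_ge0 n : {ae P, forall w i, 0 <= tau tr n i w}.
Proof.
apply/ae_foralln => i.
exact: (exponential_ge0 (q_gt0 hprm) (measurable_tauT n i) (tau_law hmodel n i)).
Qed.

Lemma u_gt0 i k r : attempt_le prm i -> 0 < u prm i k r.
Proof. by move=> hi; apply: le_lt_trans (Delta_ge0 hprm r) (Delta_lt_u hprm k r hi). Qed.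

Definition shift_at (y : R) (j : nat) : R := if j == 1%N then y else 0.

Lemma seen_gapE n y j w : seen_gap tr n y j w = shift_at y j + tau tr n j w.
Proof. by rewrite /seen_gap /shift_at; case: eqP => [->|_]; rewrite ?add0r. Qed.

Lemma shift_at_ge0 y j : 0 <= y -> 0 <= shift_at y j.
Proof. by rewrite /shift_at; case: ifP. Qed.

Lemma prob_long_gap n y j x :
  prob P [set w | x <= seen_gap tr n y j w] = expR (- q prm * Num.max (x - shift_at y j) 0).
Proof.
rewrite -(prob_exponential_ge (q_gt0 hprm) (measurable_tauT n j) (tau_law hmodel n j)).
by congr prob; apply/seteqP; split=> w /=; rewrite seen_gapE; lra.
Qed.

(** Almost surely the exponential part is nonnegative. The discount then splits off the
    deterministic shift, and a short gap means that the exponential part is below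
    [x - shift_at y j]; a negative threshold gives a null event, as the threshold 0 does. *)
Lemma expect_short_gap n s y j x : 0 <= s -> 0 <= y ->
  expect P (fun w => expR (- s * Num.max (seen_gap tr n y j w) 0)
                     * (seen_gap tr n y j w < x)%R%:R) =
  expR (- s * shift_at y j) * (q prm / (s + q prm))
  * (1 - expR (- (s + q prm) * Num.max (x - shift_at y j) 0)).
Proof.
move=> s0 y0; set yj := shift_at y j; have yj0 : 0 <= yj by exact: shift_at_ge0.
have mt := measurable_tauT n j.
have a0 : 0 <= Num.max (x - yj) 0 by rewrite le_max lexx orbT.
rewrite -mulrA -(expect_exp_lt (q_gt0 hprm) mt (tau_law hmodel n j) s0 a0).
have mlt (z : R) : measurable_fun setT (fun w => (tau tr n j w < z)%R%:R : R).
  by case: (bmf_bool (R := R) (measurable_exponential_lt mt z)).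
rewrite (_ : (fun w => _) = (fun w => expR (- s * Num.max (yj + tau tr n j w) 0)
   * (tau tr n j w < x - yj)%R%:R)); last first.
  by apply/funext => w; rewrite seen_gapE -/yj ltrBrDl.
have m1 : measurable_fun setT (fun w => expR (- s * Num.max (tau tr n j w) 0)).
  apply: measurableT_comp => //; apply: measurable_funM; first exact: measurable_cst.
  by apply: measurable_maxr => //; exact: measurable_cst.
have b1 : bmf (fun w => expR (- s * Num.max (tau tr n j w) 0)
     * (tau tr n j w < Num.max (x - yj) 0)%R%:R).
  apply: bmf_mul; last exact: bmf_bool (measurable_exponential_lt mt _).
  apply: bmf_discount => //; last by move=> w; rewrite le_max lexx orbT.
  by apply: measurable_maxr => //; exact: measurable_cst.
transitivity (expect P (fun w => expR (- s * yj)
    * (expR (- s * Num.max (tau tr n j w) 0) * (tau tr n j w < Num.max (x - yj) 0)%R%:R))).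
  apply: ae_expect.
  - apply: measurable_funM => //; apply: measurableT_comp => //.
    apply: measurable_funM; first exact: measurable_cst.
    apply: measurable_maxr; last exact: measurable_cst.
    by apply: measurable_funD => //; exact: measurable_cst.
  - by apply: measurable_funM; [exact: measurable_cst | case: b1].
  apply: filterS (tau_ge0 n) => w /(_ j) t0.
  rewrite (max_l (addr_ge0 yj0 t0)) (max_l t0) mulrDr expRD -mulrA; congr (_ * (_ * _)).
  by rewrite lt_max [X in _ || X]ltNge t0 orbF.
rewrite expectZ//; congr (_ * _); apply: ae_expect.
- by case: b1.
- apply: measurable_funM => //; apply: measurableT_comp => //.
  by apply: measurable_funM => //; exact: measurable_cst.
- by apply: filterS (tau_ge0 n) => w /(_ j) t0; rewrite max_l.
Qed.

Lemma prob_prof n r : expect P (fun w => (prof tr n w == r)%:R) = pr prm r.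
Proof.
rewrite bool_indic -(prof_law hmodel n r) prob_expect.
  by congr expect; apply/funext => w; congr (\1_ _ _); apply/seteqP; split=> w' /= /eqP.
exact: (measurable_prof (K := setT) mT).
Qed.

Lemma measurable_crit_eq n i r k : measurable [set w | crit tr n i r w == k].
Proof.
rewrite (_ : [set _ | _] = [set w | crit tr n i r w = k]).
  exact: (measurable_crit (K := setT) mT).
by apply/seteqP; split=> w /= /eqP.
Qed.

Lemma prob_crit n i r k : attempt_le prm i ->
  expect P (fun w => (crit tr n i r w == k)%:R) = pk prm i k r.
Proof.
move=> hi; rewrite bool_indic -(crit_law hmodel n r k hi).
rewrite -prob_expect; last exact: measurable_crit_eq.
by congr prob; apply/seteqP; split=> w /= /eqP.
Qed.

Lemma expect_crit_mul n i r k (g : T -> R) : attempt_le prm i ->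
  bmf (g : sub_traffic tr [set a | a <> Crit n i r] -> R) ->
  expect P (fun w => (crit tr n i r w == k)%:R * g w) = pk prm i k r * expect P g.
Proof.
move=> hi bg; rewrite -(prob_crit n r k hi).
rewrite (expect_mul_sources hmodel (K := [set Crit n i r])
  (L := [set a | a <> Crit n i r]))//.
- by apply/seteqP; split=> // a [/= ->].
- apply: bmf_bool; rewrite (_ : [set _ | _] = [set w | crit tr n i r w = k]).
    have mK := @sub_trafficP _ _ _ _ tr [set Crit n i r].
    exact: (measurable_crit mK _ erefl).
  by apply/seteqP; split=> w /= /eqP.
Qed.

Lemma expect_reject n s y j r : 0 <= s -> 0 <= y -> attempt_le prm j ->
  expect P (fun w => expR (- s * Num.max (seen_gap tr n y j w) 0)
                     * (seen_gap tr n y j w < u prm j (crit tr n j r w) r)%R%:R) =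
  expR (- s * shift_at y j) * (q prm / (s + q prm))
  * (1 - expT j r (fun x => expR (- (s + q prm) * Num.max (x - shift_at y j) 0))).
Proof.
move=> s0 y0 hj.
pose F k w := expR (- s * Num.max (seen_gap tr n y j w) 0)
              * (seen_gap tr n y j w < u prm j k r)%R%:R.
pose K : set (source (nR prm)) := [set a | a <> Crit n j r].
have bF k : bmf (F k : sub_traffic tr K -> R).
  have mK := @sub_trafficP _ _ _ _ tr K.
  have mg : measurable_fun setT (fun w : sub_traffic tr K => seen_gap tr n y j w).
    apply: (measurable_seen_gap mK (y := fun=> y)) => //; exact: measurable_cst.
  apply: bmf_mul; last exact: bmf_bool (measurable_exponential_lt mg _).
  apply: bmf_discount => //; last by move=> w; rewrite le_max lexx orbT.
  by apply: measurable_maxr => //; exact: measurable_cst.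
(* Splitting over the sampled critical gap leaves, for each [k], a function of [tau tr n j] alone,
   which is independent of the sample. *)
rewrite (_ : (fun w => _) = (fun w => \sum_k (crit tr n j r w == k)%:R * F k w)); last first.
  apply/funext => w; rewrite (bigD1 (crit tr n j r w))//= eqxx mul1r big1 ?addr0//.
  by move=> k kn; rewrite eq_sym (negbTE kn) mul0r.
rewrite expect_sum; last first.
  move=> k; apply: bmf_mul; first exact: bmf_bool (measurable_crit_eq _ _ _ _).
  exact: (bmf_sub_traffic hmodel (bF k)).
rewrite /expT -[in RHS](pk_sum hprm r hj) -sumrB mulr_sumr; apply: eq_bigr => k _.
rewrite expect_crit_mul// expect_short_gap//; ring.
Qed.

Lemma attempt_leW i j : attempt_le prm j -> (0 < i <= j)%N -> attempt_le prm i.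
Proof.
by rewrite /attempt_le; case: maxN => [N|]; rewrite ?andbT; lia.
Qed.

Lemma rejectsS n (y : T -> R) j w : (0 < j)%N ->
  rejects tr n y j.+1 w = rejects tr n y j w && ~~ accepts tr n (y w) j w.
Proof.
case: j => // j _; rewrite /rejects (_ : iota 1 j.+2.-1 = iota 1 j ++ [:: j.+1]) ?all_cat /= ?andbT//.
by have := iotaD 1 j 1; rewrite addn1 add1n.
Qed.

(** The transform of the gap seen at attempt [m], on the event that a driver of profile [r] rejects
    it, as computed in [expect_reject]. *)
Definition reject_factor (s y : R) m (r : 'I_(nR prm)) : R :=
  expR (- s * shift_at y m) * (q prm / (s + q prm))
  * (1 - expT m r (fun x => expR (- (s + q prm) * Num.max (x - shift_at y m) 0))).

(** Induction on [j]: attempt [j] involves only the sources [Crit] and [Tau] with index [j],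
    independent of the profile and of the earlier attempts, so that each rejection contributes one
    factor. *)
Lemma expect_rejects n s y j r : 0 <= s -> 0 <= y -> attempt_le prm j ->
  expect P (fun w => expR (- s * clip_gaps tr n y j w)
                     * (rejects tr n (fun=> y) j w && (prof tr n w == r))%:R) =
  pr prm r * \prod_(1 <= m < j) reject_factor s y m r.
Proof.
move=> s0 y0; elim: j => [|j IH] hj; first by rewrite /attempt_le in hj.
case: (posnP j) => [->|j0].
  rewrite big_geq// mulr1 -(prob_prof n r); congr expect; apply/funext => w.
  by rewrite /clip_gaps big_geq// mulr0 expR0 mul1r.
have hj' : attempt_le prm j by apply: (attempt_leW hj); rewrite j0 /=.
rewrite big_nat_recr//= mulrA -IH// /reject_factor -(expect_reject n r s0 y0 hj').
pose K : set (source (nR prm)) := [set a | match a with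
   | Prof _ => True | Crit _ i _ => (i < j)%N | Tau _ i => (i < j)%N | _ => False end].
pose L : set (source (nR prm)) := [set a | match a with
   | Crit _ i _ => i = j | Tau _ i => i = j | _ => False end].
rewrite -(expect_mul_sources hmodel (K := K) (L := L)).
- congr expect; apply/funext => w.
  rewrite /clip_gaps big_nat_recr//= mulrDr expRD rejectsS//.
  case: (eqVneq (prof tr n w) r) => [pr|_]; last by rewrite !andbF !(mulr0, mul0r).
  rewrite !andbT /accepts pr -ltNge; case: rejects => /=; last by rewrite !(mulr0, mul0r).
  by rewrite mulr1 mulrA.
- apply/seteqP; split=> // -[|i|m i r'|m i|m i|m i] [] //=; rewrite /K /L /= => ij E;
    by rewrite E ltnn in ij.
- have mK := @sub_trafficP _ _ _ _ tr K.
  have mc : measurable_fun setT (fun _ : sub_traffic tr K => y) by exact: measurable_cst.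
  apply: bmf_mul.
    apply: bmf_discount => //; last by move=> w; exact: clip_gaps_ge0.
    by apply: (measurable_clip_gaps mK mc) => i ij; exact: ij.
  apply: bmf_bool.
  rewrite (_ : [set _ | _] = [set w | rejects tr n (fun=> y) j w] `&` [set w | prof tr n w = r]).
    apply: measurableI; last exact: (measurable_prof mK).
    by apply: (measurable_rejects mK mc).
  by apply/seteqP; split=> w /= => [/andP[-> /eqP]|[-> ->]]; rewrite ?eqxx.
- have mL := @sub_trafficP _ _ _ _ tr L.
  have mg : measurable_fun setT (fun w : sub_traffic tr L => seen_gap tr n y j w).
    apply: (measurable_seen_gap mL (y := fun=> y)) => //; exact: measurable_cst.
  apply: bmf_mul.
    apply: bmf_discount => //; last by move=> w; rewrite le_max lexx orbT.
    by apply: measurable_maxr => //; exact: measurable_cst.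
  apply: bmf_bool.
  apply: (@measurable_fibres _ (sub_traffic tr L) _ (crit tr n j r)
    (fun k => [set w | seen_gap tr n y j w < u prm j k r])) => k.
  apply: measurableI; first exact: (measurable_crit mL).
  exact: (measurable_exponential_lt mg).
Qed.

(** Three independent ingredients contribute one factor each: the profile with the earlier
    rejections, the critical gap of attempt [j], and the gap seen there. The accepted gap is not
    part of the service time and enters only through its probability. *)
Lemma expect_clip n s y j l r : 0 <= s -> 0 <= y -> attempt_le prm j ->
  expect P (fun w => clip tr n (j, l, r) s y w) =
  pr prm r * pk prm j l r * (\prod_(1 <= m < j) reject_factor s y m r)
  * expR (- q prm * Num.max (u prm j l r - shift_at y j) 0) * expR (- s * Delta prm r).
Proof.
move=> s0 y0 hj.
have j0 : (0 < j)%N by case/andP: hj.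
pose g w := expR (- s * clip_gaps tr n y j w)
            * (rejects tr n (fun=> y) j w && (prof tr n w == r))%:R.
pose h w : R := (u prm j l r <= seen_gap tr n y j w)%R%:R.
pose K : set (source (nR prm)) := [set a | match a with
   | Prof _ => True | Crit _ i _ => (i < j)%N | Tau _ i => (i < j)%N | _ => False end].
have Kg (K' : set (source (nR prm))) : K `<=` K' -> bmf (g : sub_traffic tr K' -> R).
  move=> KK'; have mK := @sub_trafficP _ _ _ _ tr K'.
  have mc : measurable_fun setT (fun _ : sub_traffic tr K' => y) by exact: measurable_cst.
  apply: bmf_mul.
    apply: bmf_discount => //; last by move=> w; exact: clip_gaps_ge0.
    by apply: (measurable_clip_gaps mK mc) => i ij; exact: KK'.
  apply: bmf_bool.
  rewrite (_ : [set _ | _] = [set w | rejects tr n (fun=> y) j w] `&` [set w | prof tr n w = r]).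
    apply: measurableI; last by apply: (measurable_prof mK); exact: KK'.
    by apply: (measurable_rejects mK mc) => // *; exact: KK'.
  by apply/seteqP; split=> w /= => [/andP[-> /eqP]|[-> ->]]; rewrite ?eqxx.
have Lh (K' : set (source (nR prm))) : K' (Tau _ n j) -> bmf (h : sub_traffic tr K' -> R).
  move=> K't; have mK := @sub_trafficP _ _ _ _ tr K'.
  have mg : measurable_fun setT (fun w : sub_traffic tr K' => seen_gap tr n y j w).
    apply: (measurable_seen_gap mK (y := fun=> y)) => //; exact: measurable_cst.
  exact: bmf_bool (measurable_exponential_ge mg _).
transitivity (expect P (fun w => (crit tr n j r w == l)%:R * (g w * h w))
   * expR (- s * Delta prm r)).
  rewrite -expectZr; last first.
    apply: bmf_mul; first exact: bmf_bool (measurable_crit_eq _ _ _ _).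
    by apply: bmf_mul; [apply: (bmf_sub_traffic hmodel (Kg K _)) |
                        exact: (bmf_sub_traffic hmodel (Lh setT I))].
  congr expect; apply/funext => w; rewrite /clip /= mulrDr expRD /g /h.
  rewrite /type_of !xpair_eqE.
  case: (eqVneq (prof tr n w) r) => [pr|_]; last by rewrite !andbF !(mulr0, mul0r).
  have -> : (attempt tr n y w == j) && (crit tr n (attempt tr n y w) (prof tr n w) w == l)
     = (attempt tr n y w == j) && (crit tr n j r w == l).
    by rewrite pr; case: eqP => //= ->.
  rewrite (attempt_eq tr n (fun=> y))// !andbT [accepts _ _ _ _ _]/accepts pr.
  case: eqP => [->|_]; last by rewrite !(andbF, mulr0, mul0r).
  by rewrite mul1r andbT; case: (u prm j l r <= _); case: rejects;
    rewrite ?(mulr0, mul0r, mulr1) //= mulrC.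
rewrite expect_crit_mul//; last first.
  apply: bmf_mul; last exact: Lh.
  by apply: Kg => -[|i|m i r'|m i|m i|m i] //= + [_ ij _]; rewrite /K /= ij ltnn.
rewrite (expect_mul_sources hmodel (K := K) (L := [set Tau _ n j])).
- rewrite /g expect_rejects// /h bool_indic -prob_expect; last first.
    apply: measurable_exponential_ge.
    apply: (measurable_seen_gap (K := setT) mT (y := fun=> y)) => //; exact: measurable_cst.
  by rewrite prob_long_gap; ring.
- by apply/seteqP; split=> // a [Ka aE]; move: Ka; rewrite aE /K /= ltnn.
- exact: Kg.
- exact: Lh.
Qed.

(** The integrand of [Gy]. Unlike [clip], it may be unbounded on the null set where some [tau] is
    negative. *)
Definition disc n (t : vtype prm) (s y : R) w : R :=
  expR (- s * service tr n y w) * (type_of tr n y w == t)%:R.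

Lemma measurable_disc n t s (y : T -> R) : measurable_fun setT y ->
  measurable_fun setT (fun w => disc n t s (y w) w).
Proof.
move=> my.
rewrite (_ : (fun w => _) = (fun w => expR (- s * serv tr n y t.1.1 w)
   * (type_of tr n (y w) w == t)%:R)); last first.
  apply/funext => w; rewrite /disc; case: eqP => [h|_]; last by rewrite !mulr0.
  by rewrite serviceE h.
apply: measurable_funM.
  by apply: measurable_discount; exact: (measurable_serv (K := setT) mT).
suff: bmf (fun w => (type_of tr n (y w) w == t)%:R : R) by case.
apply: bmf_bool.
rewrite (_ : [set _ | _] = [set w | type_of tr n (y w) w = t]).
  exact: (measurable_type_of (K := setT) mT).
by apply/seteqP; split=> w /= /eqP.
Qed.

Lemma expect_disc n t s y : 0 <= s -> 0 <= y -> is_type t ->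
  expect P (fun w => disc n t s y w) = expect P (fun w => clip tr n t s y w).
Proof.
move=> s0 y0 ht; apply: ae_expect.
- by apply: (measurable_disc n t s (y := fun=> y)); exact: measurable_cst.
- suff: bmf (fun w => clip tr n t s y w) by case.
  apply: (bmf_clip (K := setT) mT (y := fun=> y)) => //.
  by case/andP: ht.
- by apply: filterS (tau_ge0 n) => w tau0; rewrite clipE.
Qed.

(** The sequence whose limit defines [Gy] is constant: the closed form in [expect_clip] does not
    involve the vehicle. *)
Lemma Gy_clip n t s y : 0 <= s -> 0 <= y -> is_type t ->
  Gy P tr t s y = expect P (fun w => clip tr n t s y w).
Proof.
move=> s0 y0 ht; rewrite /Gy.
rewrite (_ : (fun n => _) = fun=> expect P (fun w => clip tr n t s y w)).
  by rewrite lim_cst.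
apply/funext => m; rewrite -[LHS]/(expect P (fun w => disc m t s y w)) expect_disc//.
by case: t ht => -[j l] r hj; rewrite !expect_clip.
Qed.

Lemma Gy_first l r s y : 0 <= s -> 0 <= y ->
  (attempt_le prm 1) ->
  Gy P tr (1%N, l, r) s y =
      pr prm r * pk prm 1 l r * expR (- q prm * Num.max (u prm 1 l r - y) 0)
      * expR (- s * Delta prm r).
Proof.
move=> s0 y0 h1; rewrite (Gy_clip 0)// expect_clip// big_geq// mulr1.
by rewrite /shift_at.
Qed.

Lemma Gy_later j l r s y : 0 <= s -> 0 <= y -> (2 <= j)%N -> attempt_le prm j ->
  Gy P tr (j, l, r) s y =
        pr prm r * pk prm j l r
        * (1 - expT 1 r (fun x => expR (- (s + q prm) * Num.max (x - y) 0)))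
        * expR (- (s * (y + Delta prm r) + q prm * u prm j l r))
        * (q prm / (s + q prm)) ^+ j.-1
        * \prod_(2 <= m < j) (1 - expT m r (fun x => expR (- (s + q prm) * x))).
Proof.
move=> s0 y0 j2 hj; rewrite (Gy_clip 0)// expect_clip//.
(* Only the factor with [m = 1] contains [y]. In the others the critical gap is positive, so the
   maximum with 0 disappears, and [q prm / (s + q prm)] comes out [j - 2] times. *)
have -> : \prod_(1 <= m < j) reject_factor s y m r = reject_factor s y 1 r
    * ((q prm / (s + q prm)) ^+ j.-2
       * \prod_(2 <= m < j) (1 - expT m r (fun x => expR (- (s + q prm) * x)))).
  rewrite big_ltn//; congr (_ * _).
  rewrite -subn2 -prodr_const_nat -big_split/=; apply: eq_big_nat => m /andP[m2 mj].
  have hm : attempt_le prm m by apply: (attempt_leW hj); lia.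
  rewrite /reject_factor /shift_at (_ : (m == 1%N) = false); last by case: m m2 {mj hm} => [|[]].
  rewrite mulr0 expR0 mul1r; congr (_ * (1 - _)); apply: eq_bigr => k _.
  by rewrite subr0 max_l// ltW// u_gt0.
rewrite /reject_factor /shift_at eqxx.
have -> : (j == 1%N) = false by case: j j2 {hj} => [|[]].
rewrite subr0 max_l ?ltW ?u_gt0//.
have -> : expR (- (s * (y + Delta prm r) + q prm * u prm j l r)) =
    expR (- s * y) * expR (- q prm * u prm j l r) * expR (- s * Delta prm r).
  by rewrite -!expRD; congr expR; ring.
have -> : (q prm / (s + q prm)) ^+ j.-1 = q prm / (s + q prm) * (q prm / (s + q prm)) ^+ j.-2.
  by case: j j2 {hj} => [|[|j]] //= _; rewrite exprS.
set X := _ ^+ _; set Y := \prod_(_ <= _ < _) _; set Z := expT _ _ _; ring.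
Qed.

End ServiceTransform.

(** * Service time given the state *)

Section Lift.
Context {R : realType} {prm : params R} {d : measure_display} {T : measurableType d}.
Context {d' : measure_display} {U : measurableType d'}.
Variable tr : traffic prm T.

(** The same traffic on a product space, whose first coordinate is free to carry a random
    predecessor gap; Fubini's theorem requires measurability jointly in this gap and in the
    sources. *)
Definition lift : traffic prm (U * T) :=
  Traffic (fun z => init tr z.2) (fun n z => prof tr n z.2)
    (fun n i r z => crit tr n i r z.2) (fun n i z => tau tr n i z.2)
    (fun n m z => ibt tr n m z.2) (fun n m z => bsize tr n m z.2).

Lemma lift_events (K : set (source (nR prm))) :
  (forall a, K a -> source_events tr a `<=` measurable) ->
  forall a, K a -> source_events lift a `<=` measurable.
Proof.
move=> mK a Ka A hA.
suff [B hB <-] : exists2 B, source_events tr a B & snd @^-1` B = A.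
  rewrite -[X in measurable X]setTI; apply: measurable_snd => //.
  exact: mK _ Ka _ hB.
by case: a {Ka} hA => [|n|n i r|n i|n m|n m] [C hC <-]; eexists; try (exists C).
Qed.

End Lift.

Section TransformAfter.
Context {R : realType} {prm : params R} {d : measure_display} {T : measurableType d}.
Context {P : probability T R} {tr : traffic prm T}.
Hypothesis hprm : valid_params prm.
Hypothesis hmodel : gap_model P tr.
Local Notation mu := (@lebesgue_measure R).

Lemma measurable_ibtT n m : measurable_fun setT (ibt tr n m).
Proof. exact: (measurable_ibt (K := setT) (mT hmodel)). Qed.

Lemma ubar_ge0 (t : vtype prm) : is_type t -> 0 <= ubar t.
Proof. by case: t => -[i k] r hi; rewrite /ubar subr_ge0 ltW// Delta_lt_u. Qed.

(** Follows from the joint measurability of [clip] in the gap and the sources. The gap is cut off at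
    0 because [Gy] is identified with an expectation of [clip] only for nonnegative gaps. *)
Lemma bmf_Gy t s : 0 <= s -> is_type t -> bmf (fun y : R => Gy P tr t s (Num.max y 0)).
Proof.
move=> s0 ht; rewrite (_ : (fun y => _) =
    (fun y => expect P (fun w => clip tr 0 t s (Num.max y 0) w))); last first.
  by apply/funext => y; rewrite (Gy_clip hprm hmodel 0)// le_max lexx orbT.
apply: (bmf_expect_snd P (X2 := @id T) (@measurable_id _ T setT)
  (H := fun z : R * T => clip tr 0 t s (Num.max z.1 0) z.2)) => //.
apply: (bmf_clip (T := (R * T)%type) (tr := lift tr) (K := setT) (n := 0)
  (y := fun z : R * T => Num.max z.1 0) (lift_events (mT hmodel))) => //.
  by apply: measurable_maxr => //; exact: measurable_cst.
by case/andP: ht.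
Qed.

(** The average of [Gy] over the exponential time [x] until the next batch: the leftover gap is
    [ubar t - x] if [x < ubar t] and 0 otherwise, the latter with probability
    [expR (- lam prm * ubar t)]. *)
Definition transform_idle t' s (t : vtype prm) : R :=
  (\int[mu]_(x in `[0, ubar t])
            (lam prm * expR (- lam prm * x) * Gy P tr t' s (ubar t - x)))%R
         + Gy P tr t' s 0 * expR (- lam prm * ubar t).

Definition transform_after t' s (st : nat * vtype prm) : R :=
  if st.1 == 0%N then transform_idle t' s st.2 else Gy P tr t' s (ubar st.2).

(** The idle time is a source of its own, independent of those that determine [clip]. Integrating
    out the latter leaves [Gy] at a random gap, whose mean is an integral against the exponential
    law. *)
Lemma expect_clip_leftover n t' s st : 0 <= s -> is_type t' -> is_type st.2 ->
  expect P (fun w => clip tr n t' s (leftover tr n st w) w) = transform_after t' s st.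
Proof.
case: st => x t s0 ht' /= ht; rewrite /leftover /transform_after /=.
case: eqP => _; last by rewrite (Gy_clip hprm hmodel n)// ubar_ge0.
pose K : set (source (nR prm)) := [set Ibt _ n 0].
pose L : set (source (nR prm)) := [set a | match a with
   | Prof _ | Crit _ _ _ | Tau _ _ => True | _ => False end].
have KL : K `&` L = set0 by apply/seteqP; split=> // a [/= ->].
pose H (z : sub_traffic tr K * sub_traffic tr L) :=
  clip tr n t' s (Num.max (ubar t - ibt tr n 0 z.1) 0) z.2.
have bH : bmf H.
  apply: (bmf_clip (T := (sub_traffic tr K * sub_traffic tr L)%type)
    (tr := @lift _ _ _ (sub_traffic tr L) _ (sub_traffic tr K) tr) (K := L) (n := n)
    (y := fun z => Num.max (ubar t - ibt tr n 0 z.1) 0)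
    (lift_events (@sub_trafficP _ _ _ _ tr L))) => //; last by case/andP: ht'.
  apply: measurable_maxr; last exact: measurable_cst.
  apply: measurable_funB; first exact: measurable_cst.
  by apply: measurableT_comp => //; exact: (measurable_ibt (@sub_trafficP _ _ _ _ tr K)).
rewrite (expect_decouple_sources hmodel KL bH).
have u0 := ubar_ge0 ht.
pose h x := Gy P tr t' s (Num.max (ubar t - x) 0).
have bh : bmf h.
  apply: (bmf_comp (X := fun x : R => ubar t - x)
    (f := fun y => Gy P tr t' s (Num.max y 0))); last exact: bmf_Gy.
  by apply: measurable_funB => //; exact: measurable_cst.
transitivity (expect P (fun w => h (ibt tr n 0 w) * (ibt tr n 0 w < ubar t)%R%:R
    + Gy P tr t' s 0 * (ubar t <= ibt tr n 0 w)%R%:R)).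
  congr expect; apply/funext => w1; rewrite /H /=.
  rewrite -(Gy_clip hprm hmodel n) ?le_max ?lexx ?orbT// /h.
  case: ltP => h1; rewrite ?mulr1 ?mulr0 ?addr0// add0r.
  by rewrite max_r// subr_le0.
have mV := measurable_ibtT n 0.
have bV : bmf (fun w => (ubar t <= ibt tr n 0 w)%R%:R : R).
  exact: bmf_bool (measurable_exponential_ge mV _).
rewrite expectD; last 2 first.
- apply: bmf_mul; last exact: bmf_bool (measurable_exponential_lt mV _).
  exact: (bmf_comp mV bh).
- by apply: bmf_mul => //; exact: bmf_cst.
rewrite expectZ// bool_indic -prob_expect; last exact: measurable_exponential_ge.
have lawV := ibt_law hmodel n 0.
rewrite (prob_exponential_ge (lam_gt0 hprm) mV lawV) max_l//; congr (_ + _).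
rewrite (expect_exponential_lt (lam_gt0 hprm) mV lawV bh u0).
apply: eq_Rintegral => z; rewrite inE /= in_itv /= => /andP[_ zu].
by rewrite /h max_l// subr_ge0.
Qed.

Lemma bmf_clip_leftover n t' s st : 0 <= s -> is_type t' ->
  bmf ((fun w => clip tr n t' s (leftover tr n st w) w) : sub_traffic tr (vehicle_is n) -> R).
Proof.
move=> s0 ht'; have mK := @sub_trafficP _ _ _ _ tr (vehicle_is n).
apply: (bmf_clip mK) => //; last by case/andP: ht'.
exact: (measurable_leftover mK).
Qed.

(** [phi] has to vanish at states without a valid type: there [ubar] may be negative, and the
    formula for the inner expectation may fail. *)
Lemma expect_clip_state n t' s (phi : nat * vtype prm -> R) (C : R) :
  0 <= s -> is_type t' -> (forall st, `|phi st| <= C) ->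
  (forall st, ~~ is_type st.2 -> phi st = 0) ->
  expect P (fun w => phi (state tr n w)
    * clip tr n.+1 t' s (leftover tr n.+1 (state tr n w) w) w) =
  expect P (fun w => phi (state tr n w) * transform_after t' s (state tr n w)).
Proof.
move=> s0 ht' phiC phi0.
pose H st w := phi st * clip tr n.+1 t' s (leftover tr n.+1 st w) w.
have bc st := bmf_clip_leftover n.+1 st s0 ht'.
rewrite (@expect_state_step _ _ _ _ _ _ hmodel n H C).
- congr expect; apply/funext => w; set st := state tr n w.
  rewrite /H expectZ; last exact: (bmf_sub_traffic hmodel (bc st)).
  case: (boolP (is_type st.2)) => hst; last by rewrite phi0// !mul0r.
  by rewrite expect_clip_leftover.
- by move=> st; apply: bmf_mul => //; exact: bmf_cst.
- move=> st w; rewrite normrM -[C]mulr1 ler_pM// clip_le1//.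
Qed.

(** Numerator of the conditional expectation in [Gt]. Almost surely [disc] may be replaced by
    [clip], and the Markov property turns it into [transform_after], whose value at an idle
    departure is written as the busy value plus a correction. *)
Lemma expect_disc_state n t t' s : 0 <= s -> is_type t -> is_type t' ->
  expect P (fun w => expR (- s * G tr n.+1 w) * (J tr n.+2 w == t')%:R
                     * \1_[set w | J tr n.+1 w = t] w) =
  Gy P tr t' s (ubar t) * prob P [set w | J tr n.+1 w = t]
  + (transform_idle t' s t - Gy P tr t' s (ubar t))
    * prob P [set w | X tr n w = 0%N /\ J tr n.+1 w = t].
Proof.
move=> s0 ht ht'.
pose phi (st : nat * vtype prm) : R := (st.2 == t)%:R.
transitivity (expect P (fun w => phi (state tr n w)
    * clip tr n.+1 t' s (leftover tr n.+1 (state tr n w) w) w)).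
  apply: ae_expect.
  - rewrite (_ : (fun w => _) = (fun w => disc (tr := tr) n.+1 t' s
        (leftover tr n.+1 (state tr n w) w) w * phi (state tr n w))); last first.
      apply/funext => w; congr (_ * _); rewrite indicE /phi.
      suff -> : (w \in [set w | J tr n.+1 w = t]) = ((state tr n w).2 == t) by [].
      by apply/idP/eqP => [/set_mem|h]; [|apply/mem_set].
    move=> _ B mB; rewrite setTI.
    apply: (@measurable_fibres _ _ _ (state tr n) (fun st =>
      (fun w => disc (tr := tr) n.+1 t' s (leftover tr n.+1 st w) w * phi st) @^-1` B)) => st.
    apply: measurableI; first exact: (measurable_stateT hmodel).
    rewrite -[X in measurable X]setTI.
    suff : measurable_fun setT
       (fun w => disc (tr := tr) n.+1 t' s (leftover tr n.+1 st w) w * phi st).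
      by move=> /(_ measurableT B mB).
    apply: measurable_funM; last exact: measurable_cst.
    apply: (measurable_disc hmodel).
    exact: (measurable_leftover (K := setT) (mT hmodel)).
  - suff: bmf (fun w => phi (state tr n w)
        * clip tr n.+1 t' s (leftover tr n.+1 (state tr n w) w) w) by case.
    apply: (@bmf_fibres _ _ _ _ (state tr n)
      (fun st w => phi st * clip tr n.+1 t' s (leftover tr n.+1 st w) w) 1).
    + exact: (measurable_stateT hmodel).
    + move=> st; apply: measurable_funM; first exact: measurable_cst.
      by have := bmf_sub_traffic hmodel (bmf_clip_leftover n.+1 st s0 ht'); case.
    + move=> st w; rewrite normrM -[1]mulr1 ler_pM ?clip_le1//.
      by rewrite /phi; case: eqP; rewrite ?normr1 ?normr0.
  apply: filterS (tau_ge0 hprm hmodel n.+1) => w tau0.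
  rewrite indicE /phi; case: (eqVneq (state tr n w).2 t) => h; last first.
    by rewrite (memNset (A := [set w | J tr n.+1 w = t]) (elimN eqP h)) mulr0 mul0r.
  rewrite (mem_set (A := [set w | J tr n.+1 w = t]) h) mulr1 mul1r clipE//.
  rewrite /leftover h; case: ifP => _; last exact: ubar_ge0.
  by rewrite le_max lexx orbT.
rewrite (@expect_clip_state n t' s phi 1)//; last 2 first.
- by move=> st; rewrite /phi; case: eqP; rewrite ?normr1 ?normr0.
- by move=> st; rewrite /phi; case: eqP => [->|//]; rewrite ht.
set Gb := Gy P tr t' s (ubar t).
have mE : measurable [set w | J tr n.+1 w = t].
  exact: (@measurable_countable_fun _ _ _ (state tr n) [set st | st.2 = t]
    (measurable_stateT hmodel n)).
have mF : measurable [set w | X tr n w = 0%N /\ J tr n.+1 w = t].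
  exact: (@measurable_countable_fun _ _ _ (state tr n) [set st | st.1 = 0%N /\ st.2 = t]
    (measurable_stateT hmodel n)).
rewrite !prob_expect// -!expectZ; [|exact: bmf_indic..].
rewrite -expectD; [|by apply: bmf_mul; [exact: bmf_cst | exact: bmf_indic]..].
congr expect; apply/funext => w; rewrite !indicE /phi /transform_after.
rewrite (_ : (w \in [set w | J tr n.+1 w = t]) = ((state tr n w).2 == t)); last first.
  by apply/idP/eqP => [/set_mem|h]; [|apply/mem_set].
rewrite (_ : (w \in [set w | X tr n w = 0%N /\ J tr n.+1 w = t]) =
    ((state tr n w).1 == 0%N) && ((state tr n w).2 == t)); last first.
  apply/idP/andP => [/set_mem[h1 h2]|[/eqP h1 /eqP h2]]; last exact/mem_set.
  by split; apply/eqP.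
case: eqP => [->|_]; last by rewrite andbF !mulr0 mul0r addr0.
by case: eqP => _ /=; rewrite !(mul1r, mulr1, mulr0, addr0)// addrC subrK.
Qed.

End TransformAfter.

(** * Expectations in steady state *)

Lemma cvg_big_sum {R : realType} (I : Type) (s : seq I) (a : I -> nat -> R) (l : I -> R) :
  (forall i, a i n @[n --> \oo] --> l i) ->
  (\sum_(i <- s) a i n) @[n --> \oo] --> \sum_(i <- s) l i.
Proof.
move=> al; elim: s => [|i s IH].
  rewrite big_nil; under eq_fun do rewrite big_nil; exact: cvg_cst.
by rewrite big_cons; under eq_fun do rewrite big_cons; exact: cvgD.
Qed.

Section SteadyState.
Context {R : realType} {prm : params R} {d : measure_display} {T : measurableType d}.
Context {P : probability T R} {tr : traffic prm T}.
Hypothesis hmodel : gap_model P tr.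
Hypothesis hsteady : steady_state P tr.
Local Notation S := (nat * vtype prm)%type.
Implicit Types (phi psi : S -> R).

Definition mean n phi : R := expect P (fun w => phi (state tr n w)).
(** Plays the role of the expectation under the stationary law, which is not constructed as a
    measure. *)
Definition limmean phi : R := limn (mean ^~ phi).
Definition bounded (phi : S -> R) : Prop := exists C : R, forall s, `|phi s| <= C.

Let p n (s : S) : R := prob P (state tr n @^-1` [set s]).
Let plim s : R := limn (p ^~ s).

Lemma bounded_bmf n phi : bounded phi -> bmf (fun w => phi (state tr n w)).
Proof. by move=> [C phiC]; exact: (bmf_state hmodel n phiC). Qed.

Lemma bounded_add phi psi : bounded phi -> bounded psi -> bounded (fun s => phi s + psi s).
Proof.
move=> [C hC] [D hD]; exists (C + D) => s.
by rewrite (le_trans (ler_normD _ _))// lerD.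
Qed.

Lemma bounded_mul phi psi : bounded phi -> bounded psi -> bounded (fun s => phi s * psi s).
Proof. by move=> [C hC] [D hD]; exists (C * D) => s; rewrite normrM ler_pM. Qed.

Lemma bounded_cst (c : R) : bounded (fun=> c).
Proof. by exists `|c| => s; exact: lexx. Qed.

Lemma bounded_bool (b : S -> bool) : bounded (fun s => (b s)%:R).
Proof. by exists 1 => s; case: (b s); rewrite ?normr1 ?normr0. Qed.

(** The error is the contribution of the states outside of [F], where [phi] is at most [C] in
    absolute value. *)
Lemma mean_split n phi (C : R) (F : seq S) : uniq F -> (forall s, `|phi s| <= C) ->
  `|mean n phi - \sum_(s <- F) phi s * p n s| <= C * (1 - \sum_(s <- F) p n s).
Proof.
move=> uF phiC; have bphi : bounded phi by exists C.
have pE s : p n s = expect P (fun w => (state tr n w == s)%:R).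
  by rewrite expect_state_eq.
have bs s := bmf_state_eq hmodel n s.
have sumF (c : S -> R) w : \sum_(s <- F) c s * (state tr n w == s)%:R
    = c (state tr n w) * (state tr n w \in F)%:R.
  case: (boolP (state tr n w \in F)) => hF; last first.
    rewrite mulr0 big1_seq// => s /andP[_ sF]; case: eqP => [h|]; last by rewrite mulr0.
    by rewrite h sF in hF.
  rewrite (bigD1_seq (state tr n w))//= eqxx big1 ?addr0// => s sn.
  by rewrite eq_sym (negbTE sn) mulr0.
have Ec (c : S -> R) : \sum_(s <- F) c s * p n s
    = expect P (fun w => c (state tr n w) * (state tr n w \in F)%:R).
  under eq_bigr => s _ do rewrite pE -expectZ//.
  rewrite -expect_sum; last by move=> s; apply: bmf_mul => //; exact: bmf_cst.
  by congr expect; apply/funext => w; rewrite sumF.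
have -> : \sum_(s <- F) p n s = \sum_(s <- F) 1 * p n s.
  by apply: eq_bigr => s _; rewrite mul1r.
have bF : bmf (fun w => (state tr n w \in F)%:R : R).
  exact: (bounded_bmf n (bounded_bool (fun s => s \in F))).
have bphiT := bounded_bmf n bphi.
rewrite !Ec /mean -expectB//; last exact: bmf_mul.
rewrite -[X in C * (X - _)](expect_cst P) -expectB; last 2 first.
- exact: bmf_cst.
- by apply: bmf_mul => //; exact: bmf_cst.
have b1 : bmf (fun w => 1 - 1 * (state tr n w \in F)%:R : R).
  by apply: bmf_sub; [exact: bmf_cst | apply: bmf_mul => //; exact: bmf_cst].
rewrite -expectZ//; apply: expect_norm_le.
- by apply: bmf_sub => //; exact: bmf_mul.
- by apply: bmf_mul => //; exact: bmf_cst.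
move=> w; case: (_ \in F); first by rewrite !mulr1 subrr normr0 subrr mulr0.
by rewrite !mulr0 !subr0 mulr1.
Qed.

Lemma p_cvg s : p n s @[n --> \oo] --> plim s.
Proof. by have [h _] := hsteady; exact: h. Qed.

Lemma tight (e : R) : 0 < e -> exists2 F : seq S, uniq F & 1 - e < \sum_(s <- F) plim s.
Proof.
move=> e0; have [_] := hsteady; rewrite -/p => hsum.
have : ((1 - e)%:E < \esum_(s in setT) (plim s)%:E)%E.
  rewrite (_ : (\esum_(s in setT) _)%E = 1%E)//.
  by rewrite lte_fin ltrBlDr ltrDl.
move=> /ereal_sup_gt[_ [A [finA _] <-]].
rewrite fsbig_finite//= sumEFin lte_fin => h.
by exists (finmap.enum_fset (fset_set A)) => //; exact: finmap.fset_uniq.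
Qed.

(** A Cauchy argument: on a finite set carrying almost all of the limit mass the means converge
    because the point masses do, and the rest is controlled by [mean_split]. *)
Lemma mean_cvg phi : bounded phi -> mean n phi @[n --> \oo] --> limmean phi.
Proof.
move=> [C phiC].
have C0 : 0 <= C by exact: le_trans (phiC (0%N, (state tr 0 point).2)).
apply: cauchy_cvg; apply: cauchy_exP => e e0.
(* The remainder is at most [C] times this mass, hence at most [e / 2]; adding 1 to [C] covers
   [C = 0]. *)
have e1 : 0 < e / (2 * (C + 1)) by rewrite divr_gt0// mulr_gt0// ltr_wpDl.
have [F uF hF] := tight e1.
exists (\sum_(s <- F) phi s * plim s).
have c1 : (\sum_(s <- F) phi s * p n s) @[n --> \oo] --> \sum_(s <- F) phi s * plim s.
  by apply: cvg_big_sum => s; apply: cvgM; [exact: cvg_cst | exact: p_cvg].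
have c2 : (\sum_(s <- F) p n s) @[n --> \oo] --> \sum_(s <- F) plim s.
  by apply: cvg_big_sum => s; exact: p_cvg.
have e2 : 0 < e / 2 by rewrite divr_gt0.
suff : \forall n \near \oo, ball (\sum_(s <- F) phi s * plim s) e (mean n phi) by [].
near=> n.
have h1 : `|\sum_(s <- F) phi s * plim s - \sum_(s <- F) phi s * p n s| < e / 2.
  by near: n; exact: (cvgrPdist_lt _ _).1 c1 _ e2.
have h2 : 1 - e / (2 * (C + 1)) < \sum_(s <- F) p n s.
  by near: n; exact: (cvgr_gt _ c2 _ hF).
have h3 := mean_split n uF phiC.
rewrite /ball/= -(subrKC (\sum_(s <- F) phi s * p n s) (mean n phi)).
rewrite opprD addrA (le_lt_trans (ler_normB _ _))//.
rewrite [ltRHS](splitr e) ltr_leD//.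
rewrite (le_trans h3)//.
have h4 : 1 - \sum_(s <- F) p n s <= e / (2 * (C + 1)) by move: h2; lra.
apply: le_trans (ler_wpM2l C0 h4) _.
have C1 : 0 < C + 1 by rewrite ltr_wpDl.
have -> : C * (e / (2 * (C + 1))) = e / 2 * (C / (C + 1)) by field; rewrite gt_eqF.
by rewrite ler_piMr ?(ltW e2)// ler_pdivrMr// mul1r lerDl.
Unshelve. all: by end_near.
Qed.

Lemma limmean_unique phi (l : R) : mean n phi @[n --> \oo] --> l -> limmean phi = l.
Proof. by move=> h; apply/cvg_lim. Qed.

Lemma limmeanD phi psi : bounded phi -> bounded psi ->
  limmean (fun s => phi s + psi s) = limmean phi + limmean psi.
Proof.
move=> bphi bpsi; apply: limmean_unique.
rewrite (_ : (fun n => _) = (fun n => mean n phi + mean n psi)).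
  by apply: cvgD; exact: mean_cvg.
by apply/funext => n; rewrite /mean expectD//; exact: bounded_bmf.
Qed.

Lemma limmeanZ c phi : bounded phi -> limmean (fun s => c * phi s) = c * limmean phi.
Proof.
move=> bphi; apply: limmean_unique.
rewrite (_ : (fun n => _) = (fun n => c * mean n phi)).
  by apply: cvgM; [exact: cvg_cst | exact: mean_cvg].
by apply/funext => n; rewrite /mean expectZ//; exact: bounded_bmf.
Qed.

Lemma limmeanB phi psi : bounded phi -> bounded psi ->
  limmean (fun s => phi s - psi s) = limmean phi - limmean psi.
Proof.
move=> bphi bpsi; rewrite -[in RHS]mulN1r -limmeanZ// -limmeanD//.
  by congr limmean; apply/funext => s; rewrite mulN1r.
by apply: bounded_mul => //; exact: bounded_cst.
Qed.

Lemma limmean_cst c : limmean (fun=> c) = c.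
Proof.
apply: limmean_unique; rewrite (_ : (fun n => _) = fun=> c); first exact: cvg_cst.
by apply/funext => n; rewrite /mean expect_cst.
Qed.

Lemma bounded_sum (I : Type) (r : seq I) (Q : pred I) (phi : I -> S -> R) :
  (forall i, bounded (phi i)) -> bounded (fun s => \sum_(i <- r | Q i) phi i s).
Proof.
move=> bphi; elim: r => [|i r IH].
  by under eq_fun do rewrite big_nil; exact: bounded_cst.
under eq_fun do rewrite big_cons.
by case: (Q i) => //; exact: bounded_add.
Qed.

Lemma limmean_sum (I : Type) (r : seq I) (Q : pred I) (phi : I -> S -> R) :
  (forall i, bounded (phi i)) ->
  limmean (fun s => \sum_(i <- r | Q i) phi i s) = \sum_(i <- r | Q i) limmean (phi i).
Proof.
move=> bphi; elim: r => [|i r IH].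
  by rewrite big_nil; under eq_fun do rewrite big_nil; exact: limmean_cst.
rewrite big_cons -IH; under eq_fun do rewrite big_cons.
by case: (Q i) => //; rewrite limmeanD//; exact: bounded_sum.
Qed.

Lemma limmean_norm_le phi psi : bounded phi -> bounded psi ->
  (forall s, `|phi s| <= psi s) -> `|limmean phi| <= limmean psi.
Proof.
move=> bphi bpsi h.
have c1 : `|mean n phi| @[n --> \oo] --> `|limmean phi|.
  by apply: cvg_norm; exact: mean_cvg.
have c2 := mean_cvg bpsi.
rewrite -(cvg_lim (@Rhausdorff R) c1) -(cvg_lim (@Rhausdorff R) c2).
apply: ler_lim; [by apply/cvg_ex; eexists; exact: c1 | by apply/cvg_ex; eexists; exact: c2 |].
by apply: nearW => n; apply: expect_norm_le => //; exact: bounded_bmf.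
Qed.

Lemma limmean_ge0 phi : bounded phi -> (forall s, 0 <= phi s) -> 0 <= limmean phi.
Proof.
move=> bphi h; apply: le_trans (normr_ge0 (limmean phi)) _.
by apply: limmean_norm_le => // s; rewrite ger0_norm.
Qed.

Lemma limmean_tail phi (C e : R) (F : seq S) : 0 <= C -> uniq F ->
  1 - e < \sum_(s <- F) plim s -> (forall s, `|phi s| <= C) ->
  (forall s, s \in F -> phi s = 0) -> `|limmean phi| <= C * e.
Proof.
move=> C0 uF hF phiC phi0.
have bphi : bounded phi by exists C.
have c1 : `|mean n phi| @[n --> \oo] --> `|limmean phi|.
  by apply: cvg_norm; exact: mean_cvg.
have c2 : (C * (1 - \sum_(s <- F) p n s)) @[n --> \oo] --> C * (1 - \sum_(s <- F) plim s).
  apply: cvgM; first exact: cvg_cst.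
  apply: cvgB; first exact: cvg_cst.
  by apply: cvg_big_sum => s; exact: p_cvg.
apply: (@le_trans _ _ (C * (1 - \sum_(s <- F) plim s))); last first.
  by apply: ler_wpM2l => //; move: hF; lra.
rewrite -(cvg_lim (@Rhausdorff R) c1) -(cvg_lim (@Rhausdorff R) c2).
apply: ler_lim; [by apply/cvg_ex; eexists; exact: c1 | by apply/cvg_ex; eexists; exact: c2 |].
apply: nearW => n; have := mean_split n uF phiC.
rewrite big1_seq ?subr0// => s /andP[_ /phi0 ->]; rewrite mul0r//.
Qed.

(** Dominated convergence for the limit functional. Up to a small mass only finitely many states
    matter, and from the largest of their ranks on, [A n] and [B] coincide on all of them. *)
Lemma limmean_indicator_cvg phi (A : nat -> pred S) (B : pred S) : bounded phi ->
  (forall s, exists N, forall n, (N <= n)%N -> A n s = B s) ->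
  limmean (fun s => phi s * (A n s)%:R) @[n --> \oo] --> limmean (fun s => phi s * (B s)%:R).
Proof.
move=> bphi AB; have [C phiC] := bphi.
have C0 : 0 <= C by exact: le_trans (phiC (0%N, (state tr 0 point).2)).
apply/cvgrPdist_lt => e e0.
have e1 : 0 < e / (C + 1) by rewrite divr_gt0// ltr_wpDl.
have [F uF hF] := tight e1.
pose N s := sval (cid (AB s)).
exists (\max_(s <- F) N s)%N => // n /= Nn.
rewrite -limmeanB; last 2 first.
- by apply: bounded_mul => //; exact: bounded_bool.
- by apply: bounded_mul => //; exact: bounded_bool.
apply: (@le_lt_trans _ _ (C * (e / (C + 1)))).
  apply: limmean_tail hF _ _ => // s.
    rewrite -mulrBr normrM -[leRHS]mulr1 ler_pM//.
    by case: (B s); case: (A n s); rewrite ?subrr ?subr0 ?sub0r ?normrN ?normr1 ?normr0.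
  move=> sF; suff -> : A n s = B s by rewrite subrr.
  apply: (svalP (cid (AB s))); apply: leq_trans Nn.
  by apply: leq_bigmax_seq.
have C1 : 0 < C + 1 by rewrite ltr_wpDl.
rewrite mulrCA mulrC gtr_pMl//.
by rewrite ltr_pdivrMr// mul1r ltrDl.
Qed.

(** Gives a meaning to the series over attempts even when their number is unbounded: the partial
    sums are limit means of indicators truncated at [n], and each state eventually lies inside the
    truncation. *)
Lemma series_limmean (a : nat) phi k r : bounded phi ->
  (\sum_(a <= i < n.+1 | attempt_le prm i) limmean (fun s => phi s * (s.2 == (i, k, r))%:R))
    @[n --> \oo] -->
  limmean (fun s => phi s * [&& attempt_le prm s.2.1.1, (a <= s.2.1.1)%N,
                                s.2.1.2 == k & s.2.2 == r]%:R).
Proof.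
move=> bphi.
pose A n (s : S) := [&& attempt_le prm s.2.1.1, (a <= s.2.1.1)%N,
  s.2.1.2 == k & s.2.2 == r] && (s.2.1.1 < n.+1)%N.
rewrite (_ : (fun n => _) = (fun n => limmean (fun s => phi s * (A n s)%:R))).
  apply: limmean_indicator_cvg => // s; exists s.2.1.1 => n sn.
  by rewrite /A ltnS sn andbT.
apply/funext => n; rewrite -limmean_sum; last first.
  by move=> i; apply: bounded_mul => //; exact: bounded_bool.
congr limmean; apply/funext => -[x [[i k'] r']]; rewrite -mulr_sumr /A /=; congr (_ * _).
case: (boolP ([&& _, _, _ & _] && _)) => [/andP[/and4P[hi ai /eqP kk /eqP rr] ilt]|hn].
  rewrite big_mkcond (bigD1_seq i)/= ?iota_uniq ?mem_index_iota ?ai//.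
  rewrite hi kk rr eqxx big1 ?addr0// => j ji; case: ifP => // _.
  by rewrite !xpair_eqE eq_sym (negbTE ji).
rewrite big_seq_cond big1// => j /andP[]; rewrite mem_index_iota => /andP[aj jn] hj.
case: eqP => // -[ij kk rr]; move: hn.
by rewrite ij hj aj jn kk rr !eqxx.
Qed.

End SteadyState.

(** * Attempts *)

Section Attempts.
Context {R : realType} {prm : params R} {d : measure_display} {T : measurableType d}.
Context {P : probability T R} {tr : traffic prm T}.
Hypothesis hprm : valid_params prm.
Hypothesis hmodel : gap_model P tr.
Local Notation S := (nat * vtype prm)%type.
Local Notation E_ := (mean (P := P) (tr := tr)).
Local Notation L := (limmean (P := P) (tr := tr)).

Definition jt (t : vtype prm) (s : S) : R := (s.2 == t)%:R.
Definition idle_jt (t : vtype prm) (s : S) : R := ((s.1 == 0%N) && (s.2 == t))%:R.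

Lemma bounded_jt t : bounded (jt t).
Proof. exact: bounded_bool. Qed.

Lemma bounded_idle_jt t : bounded (idle_jt t).
Proof. exact: (bounded_bool (fun s : S => (s.1 == 0%N) && (s.2 == t))). Qed.

Lemma prob_mean (Q : pred S) n : prob P [set w | Q (state tr n w)] = E_ n (fun s => (Q s)%:R).
Proof.
rewrite /mean bool_indic -prob_expect//.
exact: (@measurable_countable_fun _ _ _ (state tr n) [set s | Q s] (measurable_stateT hmodel n)).
Qed.

Lemma prob_J n t : prob P [set w | J tr n.+1 w = t] = E_ n (jt t).
Proof.
rewrite -(prob_mean (fun s => s.2 == t)); congr prob.
by apply/seteqP; split=> w /= /eqP.
Qed.

Lemma prob_idle_J n t : prob P [set w | X tr n w = 0%N /\ J tr n.+1 w = t] =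
  E_ n (idle_jt t).
Proof.
rewrite -(prob_mean (fun s => (s.1 == 0%N) && (s.2 == t))); congr prob.
apply/seteqP; split=> w /=; last by move=> /andP[/eqP h1 /eqP h2].
by move=> [h1 h2]; apply/andP; split; apply/eqP.
Qed.

Lemma measurable_Y n (K : set (source (nR prm))) :
  vehicle_le n `<=` K -> K (Ibt _ n.+1 0) ->
  measurable_fun setT (Y tr n.+1 : sub_traffic tr K -> R).
Proof.
move=> nK Ki; have mK := @sub_trafficP _ _ _ _ tr K.
move=> _ B mB; rewrite setTI.
apply: (@measurable_fibres _ (sub_traffic tr K) _ (state tr n)
  (fun s => leftover tr n.+1 s @^-1` B)) => s.
apply: measurableI.
  by apply: (@measurable_state _ _ _ (sub_traffic tr K) tr) => a /nK; exact: mK.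
by rewrite -[X in measurable X]setTI; apply: (measurable_leftover mK).
Qed.

Lemma makes_attemptE n i w : makes_attempt tr n i w = rejects tr n (Y tr n) i w.
Proof. by apply/propext; split=> /rejectsP. Qed.

Lemma makesE n t : makes tr n t = [set w | [/\ rejects tr n (Y tr n) t.1.1 w,
   prof tr n w = t.2 & crit tr n t.1.1 t.2 w = t.1.2]].
Proof.
apply/seteqP; split=> w; rewrite /makes /samples /=.
  by rewrite makes_attemptE => -[h1 [h2 h3]].
by rewrite makes_attemptE => -[h1 h2 h3].
Qed.

Lemma measurable_rejects_Y n i r (K : set (source (nR prm))) :
  vehicle_le n `<=` K -> K (Ibt _ n.+1 0) -> K (Prof _ n.+1) ->
  (forall m r, (m < i)%N -> K (Crit n.+1 m r)) ->
  (forall m, (m < i)%N -> K (Tau _ n.+1 m)) ->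
  measurable ([set w | rejects tr n.+1 (Y tr n.+1) i w && (prof tr n.+1 w == r)]
     : set (sub_traffic tr K)).
Proof.
move=> nK Ki Kp Kc Kt; have mK := @sub_trafficP _ _ _ _ tr K.
rewrite (_ : [set _ | _] = [set w | rejects tr n.+1 (Y tr n.+1) i w]
  `&` [set w | prof tr n.+1 w = r]); last first.
  by apply/seteqP; split=> w /= => [/andP[-> /eqP]|[-> ->]]; rewrite ?eqxx.
apply: measurableI; last exact: (measurable_prof mK).
by apply: (measurable_rejects mK (measurable_Y nK Ki)).
Qed.

Definition prob_attempt n i r : R :=
  prob P [set w | rejects tr n (Y tr n) i w && (prof tr n w == r)].

Lemma makes_accepts n t : (0 < t.1.1)%N ->
  [set w | accepts tr n.+1 (Y tr n.+1 w) t.1.1 w] `&` makes tr n.+1 t =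
  [set w | J tr n.+2 w = t].
Proof.
case: t => -[i k] r /= i0; rewrite makesE; apply/seteqP; split=> w /=.
  move=> [ha [hr hp hc]]; rewrite /J /= -/(Y tr n.+1 w) /type_of hp.
  have /eqP -> : attempt tr n.+1 (Y tr n.+1 w) w == i by rewrite attempt_eq// ha.
  by rewrite hc.
rewrite /J /= -/(Y tr n.+1 w) => -[hi hc hp].
have : attempt tr n.+1 (Y tr n.+1 w) w == i by apply/eqP.
rewrite attempt_eq// => /andP[ha hr]; split=> //; split=> //.
by rewrite -hp -[in LHS]hi.
Qed.

Lemma attempt_samples n t :
  [set w | attempt tr n.+1 (Y tr n.+1 w) w = t.1.1] `&` samples tr n.+1 t =
  [set w | J tr n.+2 w = t].
Proof.
case: t => -[i k] r; apply/seteqP; split=> w /=.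
  move=> [hi [/= hp hc]]; rewrite /J /= -/(Y tr n.+1 w) /type_of hp.
  by rewrite hi hc.
rewrite /J /= -/(Y tr n.+1 w) => -[hi hc hp]; split=> //; split=> //=.
by rewrite -hp -[in LHS]hi.
Qed.

Lemma measurable_makes n t : measurable (makes tr n.+1 t).
Proof.
rewrite makesE (_ : [set _ | _] = [set w | rejects tr n.+1 (Y tr n.+1) t.1.1 w
  && (prof tr n.+1 w == t.2)] `&` [set w | crit tr n.+1 t.1.1 t.2 w = t.1.2]); last first.
  apply/seteqP; split=> w /=; first by move=> [-> -> ->]; rewrite eqxx.
  by move=> [/andP[-> /eqP ->] ->].
apply: measurableI; last exact: (measurable_crit (K := setT) (mT hmodel)).
by apply: (sub_traffic_measurable (K := setT) hmodel); exact: measurable_rejects_Y.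
Qed.

(** The critical gap of attempt [i] is not consulted at the earlier attempts, hence is independent
    of whether attempt [i] takes place. *)
Lemma prob_makes n i k r : attempt_le prm i ->
  prob P (makes tr n.+1 (i, k, r)) = pk prm i k r * prob_attempt n.+1 i r.
Proof.
move=> hi.
pose K : set (source (nR prm)) := [set a | a <> Crit n.+1 i r].
have mE : measurable ([set w | rejects tr n.+1 (Y tr n.+1) i w && (prof tr n.+1 w == r)]
     : set (sub_traffic tr K)).
  apply: measurable_rejects_Y => //.
  - by move=> a an E; rewrite E /= ltnn in an.
  - by move=> m r' mi [E _]; rewrite E ltnn in mi.
have mE' := sub_traffic_measurable hmodel mE.
rewrite prob_expect; last exact: measurable_makes.
rewrite /prob_attempt prob_expect; last exact: mE'.
rewrite -bool_indic -(expect_crit_mul hmodel k hi (bmf_bool mE)).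
congr expect; apply/funext => w; rewrite makesE -natrM mulnb indicE; congr ((nat_of_bool _)%:R).
apply/idP/andP => [/set_mem [/= h1 h2 h3]|[/eqP h3 /andP[h1 /eqP h2]]].
  by rewrite h1 h2 h3 !eqxx.
exact/mem_set.
Qed.

(** From the second attempt on, the gap is a fresh exponential variable, independent of all that
    decides whether the attempt is made and with which critical gap. *)
Lemma prob_J_later n i k r : (2 <= i)%N -> attempt_le prm i ->
  prob P [set w | J tr n.+2 w = (i, k, r)] =
  expR (- q prm * u prm i k r) * prob P (makes tr n.+1 (i, k, r)).
Proof.
move=> i2 hi; rewrite -makes_accepts /=; last exact: ltnW.
have i1 : (i == 1%N) = false by case: i i2 {hi} => [|[]].
have -> : expR (- q prm * u prm i k r) = prob P [set w | u prm i k r <= tau tr n.+1 i w].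
  rewrite (prob_exponential_ge (q_gt0 hprm) (measurable_tauT hmodel n.+1 i)
    (tau_law hmodel n.+1 i)) max_l// ltW//.
  exact: (u_gt0 hprm).
pose K : set (source (nR prm)) := [set a | a <> Tau _ n.+1 i].
have mM : measurable (makes tr n.+1 (i, k, r) : set (sub_traffic tr K)).
  rewrite makesE (_ : [set _ | _] = [set w | rejects tr n.+1 (Y tr n.+1) i w
    && (prof tr n.+1 w == r)] `&` [set w | crit tr n.+1 i r w = k]); last first.
    apply/seteqP; split=> w /=; first by move=> [-> -> ->]; rewrite eqxx.
    by move=> [/andP[-> /eqP ->] ->].
  apply: measurableI; last exact: (measurable_crit (@sub_trafficP _ _ _ _ tr K)).
  apply: measurable_rejects_Y => //.
  - by move=> a an E; rewrite E /= ltnn in an.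
  - by move=> m mi [E]; rewrite E ltnn in mi.
have mt : measurable_fun setT (tau tr n.+1 i : sub_traffic tr [set Tau _ n.+1 i] -> R).
  exact: (measurable_tau (@sub_trafficP _ _ _ _ tr [set Tau _ n.+1 i])).
rewrite -(prob_setI_sources hmodel _ (measurable_exponential_ge mt _) mM); last first.
  by apply/seteqP; split=> // a [/= ->].
congr prob; apply/seteqP; split=> w [/= ha hm]; split=> //=; move: ha;
  move: hm; rewrite makesE /accepts /seen_gap i1 => -[/= _ -> ->]//.
Qed.

Lemma prob_attempt1 n r : prob_attempt n 1 r = pr prm r.
Proof.
rewrite -(prof_law hmodel n r); congr prob.
by apply/seteqP; split=> w /= /eqP.
Qed.

(** The drivers who fail at attempt [i] are those who make it less those who succeed, the latter
    being counted by the value of their critical gap. *)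
Lemma prob_attemptS n i r : (0 < i)%N ->
  prob_attempt n.+1 i.+1 r =
  prob_attempt n.+1 i r - \sum_k prob P [set w | J tr n.+2 w = (i, k, r)].
Proof.
move=> i0.
have mA j : measurable [set w | rejects tr n.+1 (Y tr n.+1) j w && (prof tr n.+1 w == r)].
  apply: (sub_traffic_measurable (K := setT) hmodel).
  exact: measurable_rejects_Y.
have mJ k : measurable [set w | J tr n.+2 w = (i, k, r)].
  exact: (@measurable_countable_fun _ _ _ (state tr n.+1) [set st | st.2 = (i, k, r)]
    (measurable_stateT hmodel n.+1)).
rewrite /prob_attempt !prob_expect//.
under eq_bigr => k _ do rewrite prob_expect//.
rewrite -expect_sum; last by move=> k; exact: bmf_indic.
rewrite -expectB; [|exact: bmf_indic|by apply: bmf_sum => k; exact: bmf_indic].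
congr expect; apply/funext => w; rewrite -!bool_indic rejectsS//.
have -> : \sum_k \1_[set w | J tr n.+2 w = (i, k, r)] w =
  (accepts tr n.+1 (Y tr n.+1 w) i w && rejects tr n.+1 (Y tr n.+1) i w
   && (prof tr n.+1 w == r))%:R :> R.
  transitivity (\sum_k ((attempt tr n.+1 (Y tr n.+1 w) w == i)
      && (crit tr n.+1 i r w == k) && (prof tr n.+1 w == r))%:R : R).
    apply: eq_bigr => k _; rewrite indicE; congr ((nat_of_bool _)%:R).
    apply/idP/andP => [/set_mem|[/andP[/eqP h1 /eqP h2] /eqP h3]].
      rewrite /J /= -/(Y tr n.+1 w) => -[h1 h2 h3].
      by rewrite -h2 -[in X in crit _ _ X]h1 -h3 !eqxx h1 eqxx.
    by apply/mem_set; rewrite /J /= -/(Y tr n.+1 w) /type_of h3 h1 h2.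
  rewrite (bigD1 (crit tr n.+1 i r w))//= eqxx andbT big1 ?addr0 ?attempt_eq//.
  by move=> k kn; rewrite eq_sym (negbTE kn) andbF.
by case: accepts; case: rejects; case: eqP; rewrite /= ?subrr ?subr0.
Qed.

End Attempts.

(** * Steady-state limits of the attempt and success probabilities *)

Section Limits.
Context {R : realType} {prm : params R} {d : measure_display} {T : measurableType d}.
Context {P : probability T R} {tr : traffic prm T}.
Hypothesis hprm : valid_params prm.
Hypothesis hmodel : gap_model P tr.
Hypothesis hsteady : steady_state P tr.
Local Notation S := (nat * vtype prm)%type.
Local Notation E_ := (mean (P := P) (tr := tr)).
Local Notation L := (limmean (P := P) (tr := tr)).

(** One step of the dynamics describes vehicle [n + 1], whereas the limits in the definitions run
    over all [n]; dropping the first term reconciles the two. *)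
Lemma limn_shift (a : nat -> R) (l : R) : a n.+1 @[n --> \oo] --> l -> limn a = l.
Proof. by move=> h; apply/cvg_lim => //; rewrite -(cvg_shiftS a). Qed.

Lemma cvg_prob_J t : prob P [set w | J tr n.+1 w = t] @[n --> \oo] --> L (jt t).
Proof.
under eq_fun do rewrite (prob_J hmodel).
exact: (mean_cvg hmodel hsteady (bounded_jt t)).
Qed.

Lemma f0E t : f0 P tr t = L (idle_jt t).
Proof.
rewrite /f0 /f /limC /=; congr (limn _); apply/funext => n.
rewrite /expectC /= /mean; congr expect; apply/funext => w.
rewrite /idle_jt -[X tr n w]/((state tr n w).1) -[J tr n.+1 w]/((state tr n w).2).
by case: (state tr n w) => -[|x] t' /=; case: (t' == t); rewrite ?expr0 ?exprS ?mul0r ?mulr0 ?mul1r.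
Qed.

Lemma limn_prob_J t : limn (fun n => prob P [set w | J tr n w = t]) = L (jt t).
Proof. by apply: limn_shift; exact: cvg_prob_J. Qed.

Lemma limmean_jt_ge0 t : 0 <= L (jt t).
Proof. by apply: (limmean_ge0 hmodel hsteady (bounded_jt t)) => s; exact: ler0n. Qed.

(* The limit probability that a driver has profile r and makes an i-th attempt. *)
Definition lim_attempt i r : R :=
  pr prm r - \sum_(1 <= m < i) \sum_k L (jt (m, k, r)).

Lemma cvg_prob_attempt i r : (0 < i)%N ->
  prob_attempt (P := P) (tr := tr) n.+1 i r @[n --> \oo] --> lim_attempt i r.
Proof.
case: i => // i _; elim: i => [|i IH].
  rewrite /lim_attempt big_geq// subr0.
  by under eq_fun do rewrite (prob_attempt1 hmodel); exact: cvg_cst.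
rewrite /lim_attempt big_nat_recr//= opprD addrA.
under eq_fun do rewrite (prob_attemptS hmodel)//.
apply: cvgB; first exact: IH.
by apply: cvg_big_sum => k; rewrite (cvg_shiftS (fun n => prob P [set w | J tr n.+1 w = _]));
   exact: cvg_prob_J.
Qed.

Lemma lim_attemptS i r : (0 < i)%N ->
  lim_attempt i.+1 r = lim_attempt i r - \sum_k L (jt (i, k, r)).
Proof. by move=> i0; rewrite /lim_attempt big_nat_recr//= opprD addrA. Qed.

Lemma lim_attempt1 r : lim_attempt 1 r = pr prm r.
Proof. by rewrite /lim_attempt big_geq// subr0. Qed.

Lemma prob_ge0 (A : set T) : 0 <= prob P A.
Proof. by rewrite /prob fine_ge0. Qed.

Lemma prob_le (A B : set T) : measurable A -> measurable B -> A `<=` B -> prob P A <= prob P B.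
Proof. by move=> mA mB AB; rewrite -lee_fin !probE//; apply: le_measure; rewrite ?inE. Qed.

Lemma lim_attempt_ge0 i r : (0 < i)%N -> 0 <= lim_attempt i r.
Proof.
move=> i0; have c := cvg_prob_attempt (r := r) i0.
rewrite -(cvg_lim (@Rhausdorff R) c); apply: limr_ge; first by apply/cvg_ex; eexists; exact: c.
by apply: nearW => n; exact: prob_ge0.
Qed.

Lemma cvg_prob_makes i k r : attempt_le prm i ->
  prob P (makes tr n.+1 (i, k, r)) @[n --> \oo] --> pk prm i k r * lim_attempt i r.
Proof.
move=> hi; under eq_fun do rewrite (prob_makes hmodel)//.
by apply: cvgM; [exact: cvg_cst | apply: cvg_prob_attempt; case/andP: hi].
Qed.

Lemma cvg_prob_JS t : prob P [set w | J tr n.+2 w = t] @[n --> \oo] --> L (jt t).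
Proof.
by rewrite (cvg_shiftS (fun n => prob P [set w | J tr n.+1 w = _])); exact: cvg_prob_J.
Qed.

Lemma limmean_jt_later i k r : (2 <= i)%N -> attempt_le prm i ->
  L (jt (i, k, r)) = expR (- q prm * u prm i k r) * (pk prm i k r * lim_attempt i r).
Proof.
move=> i2 hi; rewrite -(cvg_lim (@Rhausdorff R) (cvg_prob_JS (t := (i, k, r)))).
apply/cvg_lim => //; under eq_fun do rewrite (prob_J_later hprm hmodel)//.
by apply: cvgM; [exact: cvg_cst | exact: cvg_prob_makes].
Qed.

Lemma limmean_jt_le i k r : attempt_le prm i ->
  L (jt (i, k, r)) <= pk prm i k r * lim_attempt i r.
Proof.
move=> hi; have c1 := cvg_prob_JS (t := (i, k, r)); have c2 := cvg_prob_makes (k := k) (r := r) hi.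
rewrite -(cvg_lim (@Rhausdorff R) c1) -(cvg_lim (@Rhausdorff R) c2).
apply: ler_lim; [by apply/cvg_ex; eexists; exact: c1 | by apply/cvg_ex; eexists; exact: c2 |].
apply: nearW => n; rewrite -makes_accepts; last by case/andP: hi.
apply: prob_le; [|exact: (measurable_makes hmodel)|exact: subIsetr].
rewrite makes_accepts; last by case/andP: hi.
exact: (@measurable_countable_fun _ _ _ (state tr n.+1) [set st | st.2 = (i, k, r)]
  (measurable_stateT hmodel n.+1)).
Qed.

Lemma lim_attemptS_le i r : (0 < i)%N -> lim_attempt i.+1 r <= lim_attempt i r.
Proof.
move=> i0; rewrite lim_attemptS// gerBl; apply: sumr_ge0 => k _; exact: limmean_jt_ge0.
Qed.

Lemma PS_lim i k r : attempt_le prm i -> 0 < pk prm i k r -> 0 < lim_attempt i r ->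
  PS P tr (i, k, r) = L (jt (i, k, r)) / (pk prm i k r * lim_attempt i r).
Proof.
move=> hi pk0 D0; apply: limn_shift.
rewrite (_ : (fun n => _) = (fun n => prob P [set w | J tr n.+2 w = (i, k, r)]
    / prob P (makes tr n.+1 (i, k, r)))); last first.
  by apply/funext => n; rewrite /cprob makes_accepts//=; case/andP: hi.
apply: cvgM; first exact: cvg_prob_JS.
by apply: cvgV; [rewrite gt_eqF// mulr_gt0 | exact: cvg_prob_makes].
Qed.

Lemma prob_samples n i k r : attempt_le prm i ->
  prob P (samples tr n (i, k, r)) = pk prm i k r * pr prm r.
Proof.
move=> hi.
have bg : bmf ((fun w => (prof tr n w == r)%:R) : sub_traffic tr [set a | a <> Crit n i r] -> R).
  apply: bmf_bool; rewrite (_ : [set _ | _] = [set w | prof tr n w = r]).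
    exact: (measurable_prof (@sub_trafficP _ _ _ _ tr [set a | a <> Crit n i r])).
  by apply/seteqP; split=> w /= /eqP.
rewrite -(prob_prof hmodel n r) -(expect_crit_mul hmodel k hi bg) prob_expect.
  congr expect; apply/funext => w; rewrite -natrM mulnb indicE; congr ((nat_of_bool _)%:R).
  apply/idP/andP => [/set_mem [/= -> ->]|[/eqP h1 /eqP h2]]; first by rewrite !eqxx.
  exact/mem_set.
apply: measurableI; first exact: (measurable_prof (K := setT) (mT hmodel)).
exact: (measurable_crit (K := setT) (mT hmodel)).
Qed.

Lemma piS_lim i k r : attempt_le prm i ->
  piS P tr (i, k, r) = L (jt (i, k, r)) / (pk prm i k r * pr prm r).
Proof.
move=> hi; apply: limn_shift.
rewrite (_ : (fun n => _) = (fun n => prob P [set w | J tr n.+2 w = (i, k, r)]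
    / (pk prm i k r * pr prm r))); last first.
  by apply/funext => n; rewrite /cprob attempt_samples prob_samples.
by apply: cvgM; [exact: cvg_prob_JS | exact: cvg_cst].
Qed.

(** Induction by [lim_attemptS]. [PS] is under control only when its conditioning event keeps a
    positive probability in the limit, so degenerate attempts are treated apart. *)
Lemma lim_attempt_prod i r : attempt_le prm i -> 0 < pr prm r ->
  lim_attempt i r = pr prm r *
    \prod_(1 <= m < i) (1 - \sum_(km < nK prm) pk prm m km r * PS P tr (m, km, r)).
Proof.
move=> + pr0; elim: i => [|i IH] hi; first by rewrite /attempt_le in hi.
have [->|i0] := posnP i; first by rewrite lim_attempt1 big_geq// mulr1.
have hi' : attempt_le prm i by apply: (attempt_leW hi); rewrite i0 /=.
rewrite big_nat_recr//= mulrA -IH//.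
(* If attempt [i] has limit probability 0, so has the next one, and both sides are 0 whatever the
   value of [PS]. *)
have := lim_attempt_ge0 r i0; rewrite le_eqVlt => /predU1P[D0|D0].
  rewrite -D0 mul0r; apply/le_anti; rewrite lim_attempt_ge0// andbT {1}D0.
  exact: lim_attemptS_le.
rewrite lim_attemptS// mulrBr mulr1 mulr_sumr; congr (_ - _); apply: eq_bigr => k _.
(* A critical gap of weight 0 contributes 0 to both sides, again whatever the value of [PS]. *)
have := pk_ge0 hprm k r hi'; rewrite le_eqVlt => /predU1P[pk0|pk0].
  rewrite -pk0 mul0r mulr0; apply/le_anti; rewrite limmean_jt_ge0 andbT.
  by rewrite (le_trans (limmean_jt_le k r hi'))// -pk0 mul0r.
rewrite PS_lim//; field; rewrite !gt_eqF//.
Qed.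

Lemma piS_prod i k r : attempt_le prm i -> 0 < pr prm r -> 0 < pk prm i k r ->
  piS P tr (i, k, r) = PS P tr (i, k, r) *
    \prod_(1 <= m < i) (1 - \sum_(km < nK prm) pk prm m km r * PS P tr (m, km, r)).
Proof.
move=> hi pr0 pk0; have i0 : (0 < i)%N by case/andP: hi.
set p := \prod_(_ <= _ < _) _.
have Dp : lim_attempt i r = pr prm r * p by exact: lim_attempt_prod.
rewrite piS_lim//; have := lim_attempt_ge0 r i0; rewrite le_eqVlt => /predU1P[D0|D0].
  (* As [pr prm r] is positive, an attempt of limit probability 0 forces the product to vanish. *)
  have p0 : p = 0.
    by apply/eqP; move/eqP: Dp; rewrite -D0 eq_sym mulf_eq0 gt_eqF.
  rewrite p0 mulr0; suff -> : L (jt (i, k, r)) = 0 by rewrite mul0r.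
  apply/le_anti; rewrite limmean_jt_ge0 andbT.
  by rewrite (le_trans (limmean_jt_le k r hi))// -D0 mulr0.
have p0 : 0 < p by move: D0; rewrite Dp pmulr_rgt0.
by rewrite PS_lim// Dp; field; rewrite !gt_eqF.
Qed.

Lemma PS_later i k r : (2 <= i)%N -> attempt_le prm i ->
  0 < limn (fun n => prob P (makes tr n (i, k, r))) ->
  PS P tr (i, k, r) = expR (- q prm * u prm i k r).
Proof.
move=> i2 hi; have i0 : (0 < i)%N by case/andP: hi.
rewrite (limn_shift (cvg_prob_makes (k := k) (r := r) hi)) => h.
have D0 := lim_attempt_ge0 r i0.
have {}D0 : 0 < lim_attempt i r.
  by rewrite lt_neqAle D0 andbT; apply: contraTneq h => <-; rewrite mulr0 ltxx.
have pk0 : 0 < pk prm i k r by move: h; rewrite pmulr_lgt0.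
by rewrite PS_lim// limmean_jt_later//; field; rewrite !gt_eqF.
Qed.

Lemma Gt_formula t t' s : is_type t -> is_type t' -> 0 <= s ->
    0 < limn (fun n => prob P [set w | J tr n w = t]) ->
    Gt P tr t t' s =
      Gy P tr t' s (ubar t) * (1 - fbar P tr t)
      + transform_idle (P := P) (tr := tr) t' s t * fbar P tr t.
Proof.
move=> ht ht' s0; rewrite limn_prob_J => pi0.
(* The denominator of [fbar] is the limit probability of type [t]; the weights that cancel are
   positive because this probability is. *)
have -> : fbar P tr t = L (idle_jt t) / L (jt t).
  rewrite /fbar f0E; case: t ht pi0 => -[i k] r hi pi0 /=.
  rewrite piS_lim//; have i0 : (0 < i)%N by case/andP: hi.
  have h := lt_le_trans pi0 (limmean_jt_le k r hi).
  have D0 := lim_attempt_ge0 r i0.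
  have {}D0 : 0 < lim_attempt i r.
    by rewrite lt_neqAle D0 andbT; apply: contraTneq h => <-; rewrite mulr0 ltxx.
  have pk0 : 0 < pk prm i k r by move: h; rewrite pmulr_lgt0.
  have pr0 : 0 < pr prm r.
    apply: lt_le_trans D0 _; rewrite /lim_attempt gerBl.
    by apply: sumr_ge0 => m _; apply: sumr_ge0 => k' _; exact: limmean_jt_ge0.
  by field; rewrite !gt_eqF.
set Gb := Gy P tr t' s (ubar t); set Gi := transform_idle t' s t.
have -> : Gb * (1 - L (idle_jt t) / L (jt t)) + Gi * (L (idle_jt t) / L (jt t)) =
    (Gb * L (jt t) + (Gi - Gb) * L (idle_jt t)) / L (jt t).
  by field; rewrite gt_eqF.
apply: limn_shift.
rewrite (_ : (fun n => _) = (fun n =>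
    (Gb * E_ n (jt t) + (Gi - Gb) * E_ n (idle_jt t)) / E_ n (jt t))); last first.
  apply/funext => n; rewrite /cexpect (expect_disc_state hprm hmodel n s0 ht ht').
  by rewrite !(prob_J hmodel) (prob_idle_J hmodel).
have c1 := mean_cvg hmodel hsteady (bounded_jt t).
have c2 := mean_cvg hmodel hsteady (bounded_idle_jt t).
apply: cvgM; last by apply: cvgV c1; rewrite gt_eqF.
by apply: cvgD; apply: cvgM => //; exact: cvg_cst.
Qed.

End Limits.

(** * First attempts *)

Section FirstAttempt.
Context {R : realType} {prm : params R} {d : measure_display} {T : measurableType d}.
Context {P : probability T R} {tr : traffic prm T}.
Hypothesis hprm : valid_params prm.
Hypothesis hmodel : gap_model P tr.
Hypothesis hsteady : steady_state P tr.
Local Notation S := (nat * vtype prm)%type.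
Local Notation E_ := (mean (P := P) (tr := tr)).
Local Notation L := (limmean (P := P) (tr := tr)).

Definition typed (s : S) : bool := is_type s.2.

(** The initial state carries a valid type, which excludes that the maximal number of attempts is
    0. *)
Lemma attempt_le1 : attempt_le prm 1.
Proof.
have := init_type hmodel point; rewrite /is_type => h.
by apply: (attempt_leW h); case/andP: h => -> _.
Qed.

Lemma transform_after_le1 t' s st : 0 <= s -> is_type t' -> typed st ->
  `|transform_after (P := P) (tr := tr) t' s st| <= 1.
Proof.
move=> s0 ht' hst; rewrite -(expect_clip_leftover hprm hmodel 1 s0 ht' hst).
have b := bmf_sub_traffic hmodel (bmf_clip_leftover hprm 1 st s0 ht').
rewrite -[leRHS](expect_cst P); apply: expect_norm_le => //; first exact: bmf_cst.
by move=> w; exact: clip_le1.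
Qed.

Section Bounded.
Hypothesis hbounded : attempts_bounded P tr.

Lemma ae_typed n : {ae P, forall w, typed (state tr n w)}.
Proof.
apply: (ae_prob1 (P := P) (E := [set w | typed (state tr n w)])); last exact: hbounded.
exact: (@measurable_countable_fun _ _ _ (state tr n) [set s | typed s]
  (measurable_stateT hmodel n)).
Qed.

Lemma limmean_typed phi : bounded phi -> L (fun s => phi s * (typed s)%:R) = L phi.
Proof.
move=> bphi; rewrite /limmean; congr (limn _); apply/funext => n.
apply: ae_expect.
- by have [] := bounded_bmf hmodel n (bounded_mul bphi (bounded_bool typed)).
- by have [] := bounded_bmf hmodel n bphi.
- by apply: filterS (ae_typed n) => w ->; rewrite mulr1.
Qed.

Lemma sumN_limmean a phi k r : bounded phi ->
  sumN prm a (fun i => L (fun s => phi s * (s.2 == (i, k, r))%:R)) =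
  L (fun s => phi s * [&& attempt_le prm s.2.1.1, (a <= s.2.1.1)%N,
                                s.2.1.2 == k & s.2.2 == r]%:R).
Proof. by move=> bphi; apply/cvg_lim => //; exact: (series_limmean hmodel hsteady). Qed.

Lemma limmean_total phi : bounded phi ->
  L phi = \sum_(r < nR prm) \sum_(k < nK prm)
    sumN prm 1 (fun i => L (fun s => phi s * (s.2 == (i, k, r))%:R)).
Proof.
move=> bphi; rewrite -limmean_typed//.
have b r k : bounded (fun s : S => phi s * [&& attempt_le prm s.2.1.1, (1 <= s.2.1.1)%N,
                                s.2.1.2 == k & s.2.2 == r]%:R).
  by apply: bounded_mul => //; exact: bounded_bool.
under eq_bigr => r _.
  under eq_bigr => k _ do rewrite sumN_limmean//.
  rewrite -(limmean_sum hmodel hsteady)//; over.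
rewrite -(limmean_sum hmodel hsteady); last by move=> r; exact: bounded_sum.
congr limmean; apply/funext => s; rewrite (bigD1 s.2.2)//= (bigD1 s.2.1.2)//=.
rewrite big1 ?addr0; last by move=> k kn; rewrite eq_sym (negbTE kn) !andbF mulr0.
rewrite big1 ?addr0; last first.
  move=> r rn; rewrite big1// => k _.
  by rewrite eq_sym [s.2.2 == r]eq_sym (negbTE rn) !andbF mulr0.
rewrite !eqxx !andbT; congr (_ * (nat_of_bool _)%:R).
by rewrite /typed /is_type; case: (boolP (attempt_le prm _)) => //= /andP[].
Qed.

(** Discount rate 0 turns the transform into the probability of type [t']. Stationarity enters here:
    the type probabilities of consecutive vehicles have the same limit. *)
Lemma limmean_jt_transform t' : is_type t' ->
  L (jt t') = L (fun s => (typed s)%:R * transform_after (P := P) (tr := tr) t' 0 s).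
Proof.
move=> ht'.
have bk : bounded (fun s => (typed s)%:R * transform_after (P := P) (tr := tr) t' 0 s).
  exists 1 => s; case: (boolP (typed s)) => hs; last by rewrite mul0r normr0.
  by rewrite mul1r transform_after_le1.
rewrite -(cvg_lim (@Rhausdorff R) (mean_cvg hmodel hsteady bk)).
apply: limn_shift.
rewrite (_ : (fun n => _) = (fun n => E_ n (fun s => (typed s)%:R
    * transform_after (P := P) (tr := tr) t' 0 s))); first exact: mean_cvg.
apply/funext => n.
rewrite /mean -(@expect_clip_state _ _ _ _ _ _ hprm hmodel n t' 0 (fun s => (typed s)%:R) 1)//;
  last 2 first.
- by move=> s; case: typed; rewrite ?normr1 ?normr0.
- by move=> s /negbTE; rewrite /typed => ->.
apply: ae_expect.
- by have [] := bounded_bmf hmodel n.+1 (bounded_jt t').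
- suff: bmf (fun w => (typed (state tr n w))%:R
        * clip tr n.+1 t' 0 (leftover tr n.+1 (state tr n w) w) w) by case.
  apply: (@bmf_fibres _ _ _ _ (state tr n)
      (fun st w => (typed st)%:R * clip tr n.+1 t' 0 (leftover tr n.+1 st w) w) 1).
  + exact: (measurable_stateT hmodel).
  + move=> st; apply: measurable_funM; first exact: measurable_cst.
    by have := bmf_sub_traffic hmodel (bmf_clip_leftover hprm n.+1 st (lexx 0) ht'); case.
  + move=> st w; rewrite normrM -[leRHS]mulr1 ler_pM ?clip_le1//.
    by case: typed; rewrite ?normr1 ?normr0.
- by apply: filterS (ae_typed n) => w ->; rewrite mul1r /clip oppr0 mul0r expR0 mul1r.
Qed.

(** Correction to [expR (- q prm * v k r t)], the success probability at a first attempt after a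
    busy departure, when the predecessor of type [t] leaves an empty queue instead. *)
Definition first_coef k r (t : vtype prm) : R :=
  1 - expR (- lam prm * vcheck k r t) - expR (- q prm * vhat k r t)
  + lam prm / (lam prm + q prm)
    * expR (- (lam prm + q prm) * vcheck k r t - q prm * v k r t)
  + q prm / (lam prm + q prm) * expR (- lam prm * ubar t - q prm * u prm 1 k r).

Lemma v_ge0 k r (t : vtype prm) : is_type t -> 0 <= v k r t.
Proof.
case: t => -[i l] r0 hi; have := limited_reuse hprm l r0 k r hi.
by rewrite /v /=; lra.
Qed.

Lemma vhatE k r (t : vtype prm) : is_type t -> vhat k r t = v k r t.
Proof. by move=> ht; rewrite /vhat max_l// v_ge0. Qed.

Lemma vcheckE k r (t : vtype prm) : is_type t -> vcheck k r t = 0.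
Proof. by move=> ht; rewrite /vcheck max_r// oppr_le0 v_ge0. Qed.

Lemma first_coefE k r (t : vtype prm) : is_type t ->
  first_coef k r t = - expR (- q prm * v k r t)
  + lam prm / (lam prm + q prm) * expR (- q prm * v k r t)
  + q prm / (lam prm + q prm) * expR (- lam prm * ubar t - q prm * u prm 1 k r).
Proof.
move=> ht; rewrite /first_coef vhatE// vcheckE// !mulr0 expR0 add0r -mulNr.
by rewrite subrr add0r.
Qed.

(** Write [t] for [s.2]. After a busy departure the fresh part of the gap has to cover
    [u prm 1 k r - ubar t], that is [v k r t]. After an idle one it has to cover [v k r t + x] if
    the batch comes at time [x < ubar t], and all of [u prm 1 k r] otherwise; averaging over [x]
    produces [first_coef]. *)
Lemma transform_after_first k r s : typed s ->
  transform_after (P := P) (tr := tr) (1%N, k, r) 0 s =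
  pk prm 1 k r * pr prm r
  * (expR (- q prm * v k r s.2) + (s.1 == 0%N)%:R * first_coef k r s.2).
Proof.
case: s => x t ht; have h1 := attempt_le1; have u0 := ubar_ge0 hprm ht.
have v0 := v_ge0 k r ht.
have vE : u prm 1 k r = v k r t + ubar t by case: (t) => -[i l] r0; rewrite /v /ubar /=; ring.
have GE y : 0 <= y <= ubar t -> Gy P tr (1%N, k, r) 0 y =
    pr prm r * pk prm 1 k r * expR (- q prm * (u prm 1 k r - y)).
  move=> /andP[y0 yu]; rewrite (Gy_first hprm hmodel)// oppr0 mul0r expR0 mulr1.
  by rewrite max_l//; move: v0; rewrite vE; lra.
rewrite /transform_after /=; case: eqP => _; last first.
  rewrite mul0r addr0 GE ?u0 ?lexx// vE addrK; ring.
rewrite mul1r first_coefE// /transform_idle GE ?u0 ?lexx// subr0.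
have l0 := lam_gt0 hprm; have q0 := q_gt0 hprm.
transitivity (pr prm r * pk prm 1 k r * expR (- q prm * v k r t)
   * (lam prm / (q prm + lam prm) * (1 - expR (- (q prm + lam prm) * ubar t)))
   + pr prm r * pk prm 1 k r * expR (- q prm * u prm 1 k r) * expR (- lam prm * ubar t)).
  congr (_ + _); rewrite -(Rintegral_exponentialZ l0 _ (ltW q0) u0).
  apply: eq_Rintegral => z; rewrite inE /= in_itv /= => /andP[z0 zu].
  rewrite GE; last by rewrite subr_ge0 zu gerBl.
  congr (_ * _); rewrite -[RHS]mulrA -expRD; congr (_ * expR _).
  by rewrite vE; ring.
have -> : expR (- (q prm + lam prm) * ubar t) =
    expR (- lam prm * ubar t - q prm * u prm 1 k r) / expR (- q prm * v k r t).
  by rewrite -expRN -expRD; congr expR; rewrite vE; ring.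
rewrite expRD -[expR (- q prm * u prm 1 k r)](_ : expR (- (q prm * u prm 1 k r)) = _); last first.
  by rewrite mulNr.
have e0 : expR (- q prm * v k r t) != 0 by rewrite gt_eqF// expR_gt0.
by field; rewrite e0 andbT gt_eqF// addr_gt0.
Qed.

Lemma eq_sumN a (F G : nat -> R) :
  (forall i, (a <= i)%N -> attempt_le prm i -> F i = G i) -> sumN prm a F = sumN prm a G.
Proof.
move=> FG; rewrite /sumN; congr (limn _); apply/funext => n.
rewrite big_nat_cond [RHS]big_nat_cond; apply: eq_bigr => i /andP[/andP[ai _] hi].
exact: FG.
Qed.

(** Convergence is known for the series of [G] only. If [c = 0], both sides vanish even if
    [sumN prm a F] is a junk limit; otherwise the series of [F] inherits convergence. *)
Lemma sumN_scale a (c : R) (F G : nat -> R) (l : R) :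
  (forall i, (a <= i)%N -> attempt_le prm i -> c * F i = G i) ->
  (\sum_(a <= i < n.+1 | attempt_le prm i) G i) @[n --> \oo] --> l ->
  c * sumN prm a F = sumN prm a G.
Proof.
move=> FG cG; have [c0|c0] := eqVneq c 0.
  rewrite c0 mul0r; apply/esym/cvg_lim => //.
  rewrite (_ : (fun n => _) = fun=> 0); first exact: cvg_cst.
  apply/funext => n; rewrite big_nat_cond big1// => i /andP[/andP[ai _] hi].
  by rewrite -FG// c0 mul0r.
rewrite (eq_sumN (G := fun i => c^-1 * G i)); last first.
  by move=> i ai hi; rewrite -FG// mulKf.
rewrite /sumN (cvg_lim (@Rhausdorff R) cG).
rewrite (_ : (fun n => _) = (fun n => c^-1 * \sum_(a <= i < n.+1 | attempt_le prm i) G i)); last first.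
  by apply/funext => n; rewrite mulr_sumr.
rewrite (_ : limn _ = c^-1 * l); first by rewrite mulVKf.
by apply/cvg_lim => //; apply: cvgM => //; exact: cvg_cst.
Qed.

Lemma sumN_recl (F : nat -> R) (l : R) :
  (\sum_(2 <= i < n.+1 | attempt_le prm i) F i) @[n --> \oo] --> l ->
  sumN prm 1 F = F 1%N + sumN prm 2 F.
Proof.
move=> cF; apply: limn_shift.
rewrite /sumN (cvg_lim (@Rhausdorff R) cF).
rewrite (_ : (fun n => _) = (fun n => F 1%N + \sum_(2 <= i < n.+2 | attempt_le prm i) F i)).
  apply: cvgD; first exact: cvg_cst.
  by rewrite (cvg_shiftS (fun n => \sum_(2 <= i < n.+1 | attempt_le prm i) F i)).
by apply/funext => n; rewrite big_ltn_cond// attempt_le1.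
Qed.

(** If [pr prm r] or [pk prm 1 l r] vanishes, [PS] carries no information, but both sides are 0. *)
Lemma limmean_jt_first l r : L (jt (1%N, l, r)) = pr prm r * pk prm 1 l r * PS P tr (1%N, l, r).
Proof.
have h1 := attempt_le1.
have le := limmean_jt_le hmodel hsteady l r h1; rewrite lim_attempt1 in le.
have ge := limmean_jt_ge0 hmodel hsteady (1%N, l, r).
have := pk_ge0 hprm l r h1; rewrite le_eqVlt => /predU1P[pk0|pk0].
  by rewrite -pk0 mulr0 mul0r; apply/le_anti; rewrite ge andbT (le_trans le)// -pk0 mul0r.
have := pr_ge0 hprm r; rewrite le_eqVlt => /predU1P[pr0|pr0].
  by rewrite -pr0 !mul0r; apply/le_anti; rewrite ge andbT (le_trans le)// -pr0 mulr0.
rewrite (PS_lim hmodel hsteady)// ?lim_attempt1//.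
by field; rewrite !gt_eqF.
Qed.

(** From the second attempt on, success with critical gap [x] has probability [expR (- q prm * x)],
    so each failure contributes an explicit factor; only the first attempt leaves the unknown
    [PS]. *)
Lemma lim_attempt_later i r : (2 <= i)%N -> attempt_le prm i ->
  lim_attempt (P := P) (tr := tr) i r =
  pr prm r * (1 - \sum_(l < nK prm) pk prm 1 l r * PS P tr (1%N, l, r))
  * \prod_(2 <= m < i) (1 - expT m r (fun x => expR (- q prm * x))).
Proof.
elim: i => // i IH i2 hi; have [i1|i1] := ltnP 1 i; last first.
  have -> : i = 1%N by apply/eqP; rewrite eqn_leq i1.
  rewrite big_geq// mulr1 lim_attemptS// lim_attempt1 mulrBr mulr1 mulr_sumr.
  by congr (_ - _); apply: eq_bigr => k _; rewrite limmean_jt_first mulrA.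
have hi' : attempt_le prm i by apply: (attempt_leW hi); rewrite (ltnW i1) /=.
rewrite lim_attemptS ?(ltnW i1)// big_nat_recr//= mulrA -IH// mulrBr mulr1.
congr (_ - _); rewrite /expT mulr_sumr; apply: eq_bigr => k _.
by rewrite (limmean_jt_later hprm hmodel hsteady)//; ring.
Qed.

(** With [phi_idle], the two parts of [transform_after_first] without the weights of [k] and [r]:
    the value as after a busy departure, and the correction for an idle one. The factor [typed]
    makes both bounded. *)
Definition phi_gap k r (s : S) : R := (typed s)%:R * expR (- q prm * v k r s.2).
Definition phi_idle k r (s : S) : R :=
  (typed s)%:R * ((s.1 == 0%N)%:R * first_coef k r s.2).

Lemma bounded_phi_gap k r : bounded (phi_gap k r).
Proof.
exists 1 => s; rewrite /phi_gap; case: (boolP (typed s)) => hs; last by rewrite mul0r normr0.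
rewrite mul1r ger0_norm ?expR_ge0// mulNr expRN_le1// mulr_ge0 ?v_ge0// ltW//.
exact: q_gt0 hprm.
Qed.

Lemma bounded_phi_idle k r : bounded (phi_idle k r).
Proof.
(* By [first_coefE] the coefficient has three terms, each at most 1 in absolute value. *)
exists 3 => s; rewrite /phi_idle; case: (boolP (typed s)) => hs; last by rewrite mul0r normr0.
rewrite mul1r; case: eqP => _; last by rewrite mul0r normr0.
rewrite mul1r first_coefE//.
have l0 := lam_gt0 hprm; have q0 := q_gt0 hprm.
set a := expR (- q prm * v k r s.2); set b := expR (_ - _).
have a0 : 0 <= a by exact: expR_ge0.
have b0 : 0 <= b by exact: expR_ge0.
have a1 : a <= 1 by rewrite /a mulNr expRN_le1// mulr_ge0 ?v_ge0// ltW.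
have b1 : b <= 1.
  rewrite /b mulNr -opprD expRN_le1// addr_ge0// mulr_ge0 ?(ltW l0) ?(ltW q0)//.
    exact: ubar_ge0.
  by rewrite ltW// (u_gt0 hprm)//; exact: attempt_le1.
set x := lam prm / _; set y := q prm / _.
have x0 : 0 <= x by rewrite divr_ge0// ltW// addr_gt0.
have y0 : 0 <= y by rewrite divr_ge0// ltW// addr_gt0.
have x1 : x <= 1 by rewrite ler_pdivrMr ?addr_gt0// mul1r lerDl ltW.
have y1 : y <= 1 by rewrite ler_pdivrMr ?addr_gt0// mul1r lerDr ltW.
by rewrite ler_norml; apply/andP; split; nra.
Qed.

Lemma limmean_phi_gap k r t : is_type t ->
  L (fun s => phi_gap k r s * (s.2 == t)%:R) = expR (- q prm * vhat k r t) * L (jt t).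
Proof.
move=> ht; rewrite -(limmeanZ hmodel hsteady) ?vhatE//; last exact: bounded_jt.
congr limmean; apply/funext => s; rewrite /phi_gap /jt /typed.
by case: eqP => [->|_]; rewrite ?mulr0// ht mul1r.
Qed.

Lemma limmean_phi_idle k r t : is_type t ->
  L (fun s => phi_idle k r s * (s.2 == t)%:R) = first_coef k r t * f0 P tr t.
Proof.
move=> ht; rewrite (f0E (tr := tr)) -(limmeanZ hmodel hsteady); last exact: bounded_idle_jt.
congr limmean; apply/funext => s; rewrite /phi_idle /idle_jt /typed.
by case: (eqVneq s.2 t) => [->|_]; rewrite ?andbF ?mulr0// ht andbT mul1r mulr1 mulrC.
Qed.

(** The left factor is the proportion of drivers of profile [r0] who fail at their first attempt;
    with it, [cc] becomes the contribution to the mean of [phi_gap] of predecessors who needed at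
    least two attempts. The factor is not known to be nonzero, hence [sumN_scale]. *)
Lemma cc_scale k r0 r :
  (1 - \sum_(l < nK prm) pk prm 1 l r0 * PS P tr (1%N, l, r0)) * cc k r0 r =
  \sum_(l < nK prm) sumN prm 2 (fun i => L (fun s => phi_gap k r s * (s.2 == (i, l, r0))%:R)).
Proof.
rewrite /cc mulr_sumr; apply: eq_bigr => l _.
have cs := series_limmean hmodel hsteady (a := 2) (k := l) (r := r0) (bounded_phi_gap k r).
apply: sumN_scale cs => i i2 hi; rewrite limmean_phi_gap// (limmean_jt_later hprm hmodel hsteady)//.
rewrite lim_attempt_later// mulrDr expRD; ring.
Qed.

(** The success probability at a first attempt is the mean of [phi_gap] plus that of [phi_idle],
    both expanded over the predecessor's type. Predecessors with one attempt give the unknowns [PS]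
    directly; those with more give [cc] and, by [cc_scale], first-attempt unknowns again, which
    closes the system. *)
Lemma PS_first_system k r : 0 < pr prm r -> 0 < pk prm 1 k r ->
    PS P tr (1%N, k, r)
    + \sum_(r0 < nR prm) \sum_(l < nK prm)
        (- pr prm r0 * expR (- q prm * vhat k r (1%N, l, r0)) + cc k r0 r)
        * pk prm 1 l r0 * PS P tr (1%N, l, r0)
    = \sum_(r0 < nR prm) \sum_(l < nK prm) sumN prm 1 (fun i =>
        first_coef k r (i, l, r0) * f0 P tr (i, l, r0))
      + \sum_(r0 < nR prm) cc k r0 r.
Proof.
move=> pr0 pk0; have h1 := attempt_le1.
have -> : PS P tr (1%N, k, r) = L (phi_gap k r) + L (phi_idle k r).
  rewrite (PS_lim hmodel hsteady)// ?lim_attempt1//.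
  rewrite limmean_jt_transform// -(limmeanD hmodel hsteady);
    [|exact: bounded_phi_gap|exact: bounded_phi_idle].
  rewrite (_ : (fun s => _) = (fun s => pk prm 1 k r * pr prm r
     * (phi_gap k r s + phi_idle k r s))).
    rewrite (limmeanZ hmodel hsteady).
      by rewrite mulrAC divff ?mul1r// mulf_neq0// gt_eqF.
    by apply: bounded_add; [exact: bounded_phi_gap | exact: bounded_phi_idle].
  apply/funext => s; rewrite /phi_gap /phi_idle.
  case: (boolP (typed s)) => hs; last by rewrite !mul0r addr0 mulr0.
  by rewrite !mul1r transform_after_first.
rewrite !limmean_total; [|exact: bounded_phi_idle|exact: bounded_phi_gap].
have -> : \sum_(r0 < nR prm) \sum_(l < nK prm) sumN prm 1 (fun i =>
      first_coef k r (i, l, r0) * f0 P tr (i, l, r0)) =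
    \sum_(r0 < nR prm) \sum_(l < nK prm)
      sumN prm 1 (fun i => L (fun s => phi_idle k r s * (s.2 == (i, l, r0))%:R)).
  apply: eq_bigr => r0 _; apply: eq_bigr => l _; apply: eq_sumN => i _ hi.
  by rewrite limmean_phi_idle.
rewrite -addrA addrCA; congr (_ + _).
rewrite -big_split/=; apply: eq_bigr => r0 _.
have -> : \sum_(l < nK prm)
      sumN prm 1 (fun i => L (fun s => phi_gap k r s * (s.2 == (i, l, r0))%:R)) =
    \sum_(l < nK prm) pr prm r0 * expR (- q prm * vhat k r (1%N, l, r0))
        * pk prm 1 l r0 * PS P tr (1%N, l, r0)
    + (1 - \sum_(l < nK prm) pk prm 1 l r0 * PS P tr (1%N, l, r0)) * cc k r0 r.
  rewrite cc_scale -big_split/=; apply: eq_bigr => l _.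
  have cs := series_limmean hmodel hsteady (a := 2) (k := l) (r := r0) (bounded_phi_gap k r).
  rewrite (sumN_recl cs).
  by congr (_ + _); rewrite limmean_phi_gap// limmean_jt_first; ring.
set a := \sum_(l < nK prm) _; set b := \sum_(l < nK prm) _.
have -> : \sum_(l < nK prm) (- pr prm r0 * expR (- q prm * vhat k r (1%N, l, r0)) + cc k r0 r)
        * pk prm 1 l r0 * PS P tr (1%N, l, r0) = b * cc k r0 r - a.
  by rewrite /a /b mulr_suml -sumrB; apply: eq_bigr => l _; ring.
by ring.
Qed.

End Bounded.
End FirstAttempt.

(** * Complex-valued expectations *)

Section Complex.
Context {R : rcfType}.
Implicit Types x y : R[i].

Lemma complexP x y : complex.Re x = complex.Re y -> complex.Im x = complex.Im y -> x = y.
Proof. by case: x y => [a b] [c e] /= -> ->. Qed.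

Lemma cReM x y : complex.Re (x * y) =
  complex.Re x * complex.Re y - complex.Im x * complex.Im y.
Proof. by case: x y => [a b] [c e]. Qed.

Lemma cImM x y : complex.Im (x * y) =
  complex.Re x * complex.Im y + complex.Im x * complex.Re y.
Proof. by case: x y => [a b] [c e]. Qed.

Lemma cReD x y : complex.Re (x + y) = complex.Re x + complex.Re y.
Proof. by case: x y => [a b] [c e]. Qed.

Lemma cImD x y : complex.Im (x + y) = complex.Im x + complex.Im y.
Proof. by case: x y => [a b] [c e]. Qed.

Lemma cRe_sum I (s : seq I) (Q : pred I) (F : I -> R[i]) :
  complex.Re (\sum_(i <- s | Q i) F i) = \sum_(i <- s | Q i) complex.Re (F i).
Proof. by elim/big_rec2: _ => [//|i x y _ <-]; rewrite cReD. Qed.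

Lemma cIm_sum I (s : seq I) (Q : pred I) (F : I -> R[i]) :
  complex.Im (\sum_(i <- s | Q i) F i) = \sum_(i <- s | Q i) complex.Im (F i).
Proof. by elim/big_rec2: _ => [//|i x y _ <-]; rewrite cImD. Qed.

Lemma cRe_nat n : complex.Re (n%:R : R[i]) = n%:R.
Proof. by rewrite -(rmorph_nat (real_complex R)). Qed.

Lemma cIm_nat n : complex.Im (n%:R : R[i]) = 0.
Proof. by rewrite -(rmorph_nat (real_complex R)). Qed.

Lemma cReM_nat x n : complex.Re (x * n%:R) = complex.Re x * n%:R.
Proof. by rewrite cReM cRe_nat cIm_nat mulr0 subr0. Qed.

Lemma cImM_nat x n : complex.Im (x * n%:R) = complex.Im x * n%:R.
Proof. by rewrite cImM cRe_nat cIm_nat mulr0 add0r. Qed.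

Lemma norm_Re_le1 x : `|x| <= 1 -> `|complex.Re x| <= 1.
Proof.
move=> h; rewrite -lecR (_ : 1%:C%C = 1)//.
exact: le_trans (normc_ge_Re x) h.
Qed.

Lemma norm_Im_le1 x : `|x| <= 1 -> `|complex.Im x| <= 1.
Proof.
move=> h; have -> : complex.Im x = - complex.Re (x * 'i%C) by rewrite ReiNIm opprK.
by rewrite normrN norm_Re_le1// normrM (normc_def 'i%C) /= expr0n expr1n add0r sqrtr1 mulr1.
Qed.

Lemma norm_powM_le1 x n (b : bool) : `|x| <= 1 -> `|x ^+ n * b%:R| <= 1.
Proof.
move=> h; rewrite normrM normrX -[leRHS]mulr1 ler_pM ?exprn_ile1//.
by case: b; rewrite ?normr1 ?normr0.
Qed.

End Complex.

Definition bmfC {R : realType} d (T : measurableType d) (Z : T -> R[i]) : Prop :=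
  bmf (fun w => complex.Re (Z w)) /\ bmf (fun w => complex.Im (Z w)).

Section ComplexExpectation.
Context {R : realType} {d : measure_display} {T : measurableType d}.
Implicit Types Z W : T -> R[i].

Lemma bmfC_mul Z W : bmfC Z -> bmfC W -> bmfC (fun w => Z w * W w).
Proof.
move=> [rZ iZ] [rW iW]; split.
  by under eq_fun do rewrite cReM; apply: bmf_sub; exact: bmf_mul.
by under eq_fun do rewrite cImM; apply: bmf_add; exact: bmf_mul.
Qed.

Lemma bmfC_cst (c : R[i]) : bmfC (fun _ : T => c).
Proof. by split; exact: bmf_cst. Qed.

Lemma bmfC_bool (b : T -> bool) :
  measurable [set w | b w] -> bmfC (fun w => (b w)%:R : R[i]).
Proof.
move=> mb; split.
  by under eq_fun do rewrite cRe_nat; exact: bmf_bool.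
by under eq_fun do rewrite cIm_nat; exact: bmf_cst.
Qed.

Lemma bmfC_pow (z : R[i]) (X : T -> nat) : `|z| <= 1 -> measurable_fun setT X ->
  bmfC (fun w => z ^+ X w).
Proof.
move=> z1 mX.
have mXk k : measurable (X @^-1` [set k]) by rewrite -[X in measurable X]setTI; exact: mX.
have zn k : `|z ^+ k| <= 1 by rewrite normrX exprn_ile1.
split.
- apply: (@bmf_fibres _ _ _ _ X (fun k _ => complex.Re (z ^+ k)) 1) => //.
  by move=> k _; exact: norm_Re_le1.
- apply: (@bmf_fibres _ _ _ _ X (fun k _ => complex.Im (z ^+ k)) 1) => //.
  by move=> k _; exact: norm_Im_le1.
Qed.

Variable P : probability T R.

Lemma expectCZ (c : R[i]) Z : bmfC Z -> expectC P (fun w => c * Z w) = c * expectC P Z.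
Proof.
move=> [rZ iZ]; apply: complexP; rewrite ?cReM ?cImM /expectC /=.
  under eq_fun do rewrite cReM; rewrite expectB ?expectZ//;
  by apply: bmf_mul => //; exact: bmf_cst.
under eq_fun do rewrite cImM; rewrite expectD ?expectZ//;
by apply: bmf_mul => //; exact: bmf_cst.
Qed.

Lemma norm_expectC_le1 Z : bmfC Z -> (forall w, `|Z w| <= 1) ->
  `|complex.Re (expectC P Z)| <= 1 /\ `|complex.Im (expectC P Z)| <= 1.
Proof.
move=> [rZ iZ] Z1; rewrite -(expect_cst P 1); split; apply: expect_norm_le => //;
  by [exact: bmf_cst | move=> w; exact: norm_Re_le1 | move=> w; exact: norm_Im_le1].
Qed.

Lemma ae_expectC Z W : measurable_fun setT (fun w => complex.Re (Z w)) ->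
  measurable_fun setT (fun w => complex.Im (Z w)) -> bmfC W ->
  {ae P, forall w, Z w = W w} -> expectC P Z = expectC P W.
Proof.
move=> rZ iZ [[rW _] [iW _]] ZW; apply: complexP.
  apply: (ae_expect rZ rW).
  by apply: (filterS _ ZW) => w /= ->.
apply: (ae_expect iZ iW).
by apply: (filterS _ ZW) => w /= ->.
Qed.

End ComplexExpectation.

Section ComplexModel.
Context {R : realType} {prm : params R} {d : measure_display} {T : measurableType d}.
Context {P : probability T R} {tr : traffic prm T}.
Hypothesis hmodel : gap_model P tr.
Local Notation S := (nat * vtype prm)%type.

Lemma expectC_mul_sources K L' (Z W : T -> R[i]) : K `&` L' = set0 ->
  bmfC (Z : sub_traffic tr K -> R[i]) -> bmfC (W : sub_traffic tr L' -> R[i]) ->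
  expectC P (fun w => Z w * W w) = expectC P Z * expectC P W.
Proof.
move=> KL [rZ iZ] [rW iW].
have M f g : bmf (f : sub_traffic tr K -> R) -> bmf (g : sub_traffic tr L' -> R) ->
    bmf (fun w : T => f w * g w) /\ expect P (fun w => f w * g w) = expect P f * expect P g.
  move=> bf bg; split; first by apply: bmf_mul; exact: (bmf_sub_traffic hmodel).
  exact: (expect_mul_sources hmodel KL bf bg).
have [b1 e1] := M _ _ rZ rW; have [b2 e2] := M _ _ iZ iW.
have [b3 e3] := M _ _ rZ iW; have [b4 e4] := M _ _ iZ rW.
apply: complexP; rewrite ?cReM ?cImM /expectC /=.
  by under eq_fun do rewrite cReM; rewrite expectB// e1 e2.
by under eq_fun do rewrite cImM; rewrite expectD// e3 e4.
Qed.

Lemma expectC_state_step n (H : S -> T -> R[i]) :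
  (forall s, bmfC (H s : sub_traffic tr (vehicle_is n.+1) -> R[i])) ->
  (forall s w, `|H s w| <= 1) ->
  expectC P (fun w => H (state tr n w) w) =
  expectC P (fun w => expectC P (H (state tr n w))).
Proof.
move=> bH H1; apply: complexP; rewrite /expectC /=.
  apply: (expect_state_step hmodel (H := fun s w => complex.Re (H s w)) (C := 1)).
    by move=> s; have [] := bH s.
  by move=> s w; exact: norm_Re_le1.
apply: (expect_state_step hmodel (H := fun s w => complex.Im (H s w)) (C := 1)).
  by move=> s; have [] := bH s.
by move=> s w; exact: norm_Im_le1.
Qed.

Lemma expectC_vehicle n (g : vehicle_mspace tr -> R[i]) : bmfC g ->
  expectC P (fun w => g (vehicle tr n w)) = expectC P (fun w => g (vehicle tr 0 w)).
Proof.
move=> [rg ig]; apply: complexP.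
  exact: (expect_vehicle hmodel n rg).
exact: (expect_vehicle hmodel n ig).
Qed.

End ComplexModel.

(** * Arrivals during a service time *)

Section ArrivalTransform.
Context {R : realType} {prm : params R}.
Local Notation S := (nat * vtype prm)%type.

(** The counterpart for arrivals of the discounted service time; [s] is a fixed state, so that only
    the sources of vehicle [n] remain random. *)
Definition arrival_disc T (tr : traffic prm T) (z : R[i]) (t : vtype prm) n (s : S) w : R[i] :=
  let y := leftover tr n s w in
  z ^+ arrivals tr n (service tr n y w) w * (type_of tr n y w == t)%:R.

Lemma norm_arrival_disc T (tr : traffic prm T) z t n s w : `|z| <= 1 ->
  `|arrival_disc tr z t n s w| <= 1.
Proof. exact: norm_powM_le1. Qed.

Lemma arrival_disc_busy T (tr : traffic prm T) z t n x t0 : x != 0%N ->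
  arrival_disc tr z t n (x, t0) = arrival_disc tr z t n (1%N, t0).
Proof. by move=> /negbTE x0; apply/funext => w; rewrite /arrival_disc /leftover /= x0. Qed.

(** The list of sources matters: [Bsize _ n 0] is absent, which makes the batch that ends an idle
    period independent of the later arrivals, and no critical gap beyond attempt [t.1.1] occurs, so
    that [vehicle_sources] suffices. *)
Lemma bmfC_arrival_disc d (T : measurableType d) (tr : traffic prm T)
    (K : set (source (nR prm))) z t n s :
  (forall a, K a -> source_events tr a `<=` measurable) -> `|z| <= 1 -> (0 < t.1.1)%N ->
  K (Prof _ n) -> (forall i r, (0 < i <= t.1.1)%N -> K (Crit n i r)) ->
  (forall i, K (Tau _ n i)) -> (forall m, K (Ibt _ n m)) ->
  (forall m, (0 < m)%N -> K (Bsize _ n m)) ->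
  bmfC (arrival_disc tr z t n s).
Proof.
move=> mK z1 t0 Kp Kc Kt Ki Kb.
have tN0 : (t.1.1 == 0)%N = false by case: t.1.1 t0.
have my : measurable_fun setT (leftover tr n s) by exact: (measurable_leftover mK).
rewrite (_ : arrival_disc _ _ _ _ _ = (fun w =>
    z ^+ arrivals tr n (serv tr n (leftover tr n s) t.1.1 w) w
    * (type_of tr n (leftover tr n s w) w == t)%:R)); last first.
  apply/funext => w; rewrite /arrival_disc; case: eqP => [tE|_]; last by rewrite !mulr0.
  by rewrite serviceE tE.
apply: bmfC_mul.
  apply: bmfC_pow => //; apply: (measurable_arrivals mK).
    by apply: (measurable_serv mK).
  by move=> m m0; split; [exact: Ki | exact: Kb].
apply: bmfC_bool; rewrite (_ : [set _ | _] = [set w | type_of tr n (leftover tr n s w) w = t]).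
  apply: (measurable_type_of mK) => //.
  move=> i r; rewrite tN0 orbF => /orP[i0 it|/eqP -> _]; apply: Kc; first by rewrite i0 it.
  by rewrite t0 /=.
by apply/seteqP; split=> w /= /eqP.
Qed.

Context {d : measure_display} {T : measurableType d}.
Context {P : probability T R} {tr : traffic prm T}.
Hypothesis hmodel : gap_model P tr.
Variables (t' : vtype prm) (z : R[i]).
Hypothesis ht' : is_type t'.
Hypothesis z1 : `|z| <= 1.

Let t'0 : (0 < t'.1.1)%N. Proof. by case/andP: ht'. Qed.

Definition arrival_pgf (s : S) : R[i] := expectC P (arrival_disc tr z t' 0 s).

Lemma bmfC_arrival_discT n s : bmfC (arrival_disc tr z t' n s).
Proof. exact: (bmfC_arrival_disc (K := setT) s (mT hmodel)). Qed.

Lemma expectC_arrival_disc n s : expectC P (arrival_disc tr z t' n s) = arrival_pgf s.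
Proof.
have b : bmfC (arrival_disc (coord tr) z t' 0 s : vehicle_mspace tr -> R[i]).
  apply: (bmfC_arrival_disc s (@coord_eventsP _ _ _ _ tr)) => // i r /andP[i0 it].
  by split=> //; apply: (attempt_leW ht'); rewrite i0 it.
exact: (expectC_vehicle hmodel n b).
Qed.

Lemma arrival_pgf_busy x t : x != 0%N -> arrival_pgf (x, t) = arrival_pgf (1%N, t).
Proof. by move=> x0; rewrite /arrival_pgf arrival_disc_busy. Qed.

Lemma norm_arrival_pgf s :
  `|complex.Re (arrival_pgf s)| <= 1 /\ `|complex.Im (arrival_pgf s)| <= 1.
Proof.
apply: norm_expectC_le1; first exact: bmfC_arrival_discT.
by move=> w; exact: norm_arrival_disc.
Qed.

Lemma expectC_bsize n : expectC P (fun w => z ^+ bsize tr n 0 w) = B P tr z.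
Proof.
have b : bmfC ((fun x => z ^+ bsize (coord tr) 0 0 x) : vehicle_mspace tr -> R[i]).
  by apply: bmfC_pow => //; exact: (measurable_bsize (@coord_eventsP _ _ _ _ tr)).
exact: (expectC_vehicle hmodel n b).
Qed.

(* If vehicle n left s behind, z to the number of vehicles present when the
   service of vehicle n + 1 ends, on the event that the latter has type t'. *)
Let H n (s : S) w : R[i] :=
  z ^+ (if s.1 == 0%N then bsize tr n.+1 0 w else s.1) * arrival_disc tr z t' n.+1 s w.

(** The expectation of [H n s], by [expectC_H]; it is the same for all [n]. *)
Definition step_pgf (s : S) : R[i] :=
  (if s.1 == 0%N then B P tr z else z ^+ s.1) * arrival_pgf s.

Let K0 n : set (source (nR prm)) := [set a | vehicle_is n.+1 a /\ a <> Bsize _ n.+1 0].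

Let bmfC_K0 n s : bmfC (arrival_disc tr z t' n.+1 s : sub_traffic tr (K0 n) -> R[i]).
Proof.
apply: (bmfC_arrival_disc s (@sub_trafficP _ _ _ _ tr (K0 n))) => // m m0.
by split=> // -[m00]; rewrite m00 in m0.
Qed.

Let expectC_H n s : expectC P (H n s) = step_pgf s.
Proof.
rewrite /step_pgf /H; case: ifP => _; last first.
  rewrite expectCZ ?expectC_arrival_disc//; exact: bmfC_arrival_discT.
rewrite (@expectC_mul_sources _ _ _ _ _ _ hmodel [set Bsize _ n.+1 0] (K0 n)).
- by rewrite expectC_bsize expectC_arrival_disc.
- by apply/seteqP; split=> // a [/= -> [_]].
- apply: bmfC_pow => //.
  exact: (measurable_bsize (@sub_trafficP _ _ _ _ tr [set Bsize _ n.+1 0])).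
- exact: bmfC_K0.
Qed.

Let bmfC_H n s : bmfC (H n s : sub_traffic tr (vehicle_is n.+1) -> R[i]).
Proof.
have mK := @sub_trafficP _ _ _ _ tr (vehicle_is n.+1).
apply: bmfC_mul; last exact: (bmfC_arrival_disc s mK).
apply: bmfC_pow => //; case: (s.1 == 0%N); last exact: measurable_cst.
exact: (measurable_bsize mK).
Qed.

Let norm_H n s w : `|H n s w| <= 1.
Proof. by rewrite /H /arrival_disc mulrA -exprD norm_powM_le1. Qed.

(** The extra factor [z] compensates for the departing vehicle. This requires that [.-1] does not
    truncate, hence that some vehicle is present: after an idle period this holds almost surely
    because batches have size at least 1. *)
Lemma expectC_step n :
  expectC P (fun w => z * (z ^+ X tr n.+1 w * (J tr n.+2 w == t')%:R)) =
  expectC P (fun w => step_pgf (state tr n w)).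
Proof.
transitivity (expectC P (fun w => H n (state tr n w) w)); last first.
  rewrite (expectC_state_step hmodel (bmfC_H n) (norm_H n)).
  by congr expectC; apply/funext => w; exact: expectC_H.
have bS k (phi : S -> R[i]) : (forall s, `|phi s| <= 1) -> bmfC (fun w => phi (state tr k w)).
  move=> phi1; split.
    by apply: (@bmf_state _ _ _ _ _ _ hmodel k (fun s => complex.Re (phi s)) 1) => s; exact: norm_Re_le1.
  by apply: (@bmf_state _ _ _ _ _ _ hmodel k (fun s => complex.Im (phi s)) 1) => s; exact: norm_Im_le1.
have [[rZ _] [iZ _]] : bmfC (fun w => z * (z ^+ X tr n.+1 w * (J tr n.+2 w == t')%:R)).
  apply: (bS n.+1 (fun s => z * (z ^+ s.1 * (s.2 == t')%:R))) => s.
  by rewrite mulrA -exprS norm_powM_le1.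
apply: (ae_expectC rZ iZ).
- have bH s : bmfC (H n s).
    have [b1 b2] := bmfC_H n s.
    by split; [exact: (bmf_sub_traffic hmodel b1) | exact: (bmf_sub_traffic hmodel b2)].
  split.
    apply: (bmf_fibres (X := state tr n) (H := fun s w => complex.Re (H n s w)) (C := 1)).
    + exact: (measurable_stateT hmodel).
    + by move=> s; case: (bH s) => -[].
    + by move=> s w; apply: norm_Re_le1.
  apply: (bmf_fibres (X := state tr n) (H := fun s w => complex.Im (H n s w)) (C := 1)).
  + exact: (measurable_stateT hmodel).
  + by move=> s; case: (bH s) => _ [].
  + by move=> s w; apply: norm_Im_le1.
have mb : measurable [set w | (1 <= bsize tr n.+1 0 w)%N].
  rewrite -[X in measurable X]setTI.
  exact: (measurable_bsize (K := setT) (mT hmodel) (n := n.+1) (m := 0%N) I _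
    (Y := [set k | (1 <= k)%N])).
apply: (filterS _ (ae_prob1 mb (bsize_ge1 hmodel n.+1 0))) => w /= b1.
rewrite /H /X /J /= /arrival_disc -/(Y tr n.+1 w).
set x := if _ then _ else _; have x0 : (0 < x)%N.
  by rewrite /x; case: eqP => [_ //|/eqP]; rewrite lt0n.
by rewrite mulrA -exprS prednK ?addn_gt0 ?x0// exprD mulrA.
Qed.

End ArrivalTransform.

(** * The functional equation for the generating functions *)

Section ComplexLimits.
Context {R : realType} {prm : params R} {d : measure_display} {T : measurableType d}.
Context {P : probability T R} {tr : traffic prm T}.
Hypothesis hmodel : gap_model P tr.
Hypothesis hsteady : steady_state P tr.
Local Notation S := (nat * vtype prm)%type.
Local Notation E_ := (mean (P := P) (tr := tr)).
Local Notation L := (limmean (P := P) (tr := tr)).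
Implicit Types (phi psi : S -> R[i]) (Q : pred S).

Definition boundedC phi : Prop :=
  bounded (fun s => complex.Re (phi s)) /\ bounded (fun s => complex.Im (phi s)).

Lemma boundedC_add phi psi : boundedC phi -> boundedC psi -> boundedC (fun s => phi s + psi s).
Proof.
move=> [r1 i1] [r2 i2]; split.
  by under eq_fun do rewrite cReD; exact: bounded_add.
by under eq_fun do rewrite cImD; exact: bounded_add.
Qed.

Lemma boundedC_mul phi psi : boundedC phi -> boundedC psi -> boundedC (fun s => phi s * psi s).
Proof.
have bN (g : S -> R) : bounded g -> bounded (fun s => - g s).
  by move=> [C h]; exists C => s; rewrite normrN.
move=> [r1 i1] [r2 i2]; split.
  under eq_fun do rewrite cReM.
  by apply: bounded_add; [exact: bounded_mul | apply: bN; exact: bounded_mul].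
by under eq_fun do rewrite cImM; apply: bounded_add; exact: bounded_mul.
Qed.

Lemma boundedC_cst c : boundedC (fun=> c).
Proof. by split; exact: bounded_cst. Qed.

Lemma boundedC_le1 phi : (forall s, `|phi s| <= 1) -> boundedC phi.
Proof.
by move=> h; split; exists 1 => s; [exact: norm_Re_le1 | exact: norm_Im_le1].
Qed.

Lemma boundedC_bool Q : boundedC (fun s => (Q s)%:R).
Proof. by apply: boundedC_le1 => s; case: (Q s); rewrite ?normr1 ?normr0. Qed.

Lemma boundedC_sub phi psi : boundedC phi -> boundedC psi -> boundedC (fun s => phi s - psi s).
Proof.
move=> bphi bpsi; under eq_fun do rewrite -[psi _]mul1r -mulNr.
by apply: boundedC_add => //; apply: boundedC_mul => //; exact: boundedC_cst.
Qed.

Definition limmeanC phi : R[i] :=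
  Complex (L (fun s => complex.Re (phi s))) (L (fun s => complex.Im (phi s))).

Lemma limmeanCD phi psi : boundedC phi -> boundedC psi ->
  limmeanC (fun s => phi s + psi s) = limmeanC phi + limmeanC psi.
Proof.
move=> [r1 i1] [r2 i2]; apply: complexP; rewrite ?cReD ?cImD /limmeanC /=.
  by rewrite -(limmeanD hmodel hsteady)//; congr limmean; apply/funext => s; rewrite cReD.
by rewrite -(limmeanD hmodel hsteady)//; congr limmean; apply/funext => s; rewrite cImD.
Qed.

Lemma limmeanCZ c phi : boundedC phi -> limmeanC (fun s => c * phi s) = c * limmeanC phi.
Proof.
move=> [r1 i1]; have bc (a : R) (g : S -> R) : bounded g -> bounded (fun s => a * g s).
  by move=> bg; apply: bounded_mul => //; exact: bounded_cst.
apply: complexP; rewrite ?cReM ?cImM /limmeanC /=.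
  rewrite -!(limmeanZ hmodel hsteady)// -(limmeanB hmodel hsteady); [|exact: bc..].
  by congr limmean; apply/funext => s; rewrite cReM.
rewrite -!(limmeanZ hmodel hsteady)// -(limmeanD hmodel hsteady); [|exact: bc..].
by congr limmean; apply/funext => s; rewrite cImM.
Qed.

Lemma limmeanC_bool_eq0 phi Q : boundedC phi -> L (fun s => (Q s)%:R) = 0 ->
  limmeanC (fun s => phi s * (Q s)%:R) = 0.
Proof.
have h (g : S -> R) : bounded g -> L (fun s => (Q s)%:R) = 0 ->
    L (fun s => g s * (Q s)%:R) = 0.
  move=> bg LQ; have [C gC] := bg; have bQ := bounded_bool Q.
  apply/eqP; rewrite -normr_eq0; apply/eqP/le_anti; rewrite normr_ge0 andbT.
  have -> : (0 : R) = L (fun s => C * (Q s)%:R).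
    by rewrite (limmeanZ hmodel hsteady)// LQ mulr0.
  apply: (limmean_norm_le hmodel hsteady).
  - exact: bounded_mul.
  - by apply: bounded_mul => //; exact: bounded_cst.
  - by move=> s; rewrite normrM normr_nat ler_wpM2r.
move=> [r1 i1] LQ; apply: complexP; rewrite /limmeanC /=.
  by under [X in limmean X]eq_fun do rewrite cReM_nat; exact: h.
by under [X in limmean X]eq_fun do rewrite cImM_nat; exact: h.
Qed.

Lemma sumNC_Complex a (F : nat -> R[i]) : sumNC prm a F =
  Complex (sumN prm a (fun i => complex.Re (F i))) (sumN prm a (fun i => complex.Im (F i))).
Proof.
rewrite /sumNC /limC /sumN; congr Complex; congr (limn _); apply/funext => n.
  exact: cRe_sum.
exact: cIm_sum.
Qed.

Lemma limmeanC_total phi : attempts_bounded P tr -> boundedC phi ->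
  limmeanC phi = \sum_(r < nR prm) \sum_(k < nK prm)
    sumNC prm 1 (fun i => limmeanC (fun s => phi s * (s.2 == (i, k, r))%:R)).
Proof.
move=> hb [rphi iphi]; apply: complexP.
  rewrite cRe_sum /limmeanC /= (limmean_total hmodel hsteady hb rphi).
  apply: eq_bigr => r _; rewrite cRe_sum; apply: eq_bigr => k _; rewrite sumNC_Complex /=.
  apply: eq_sumN => i _ _; congr limmean; apply/funext => s; by rewrite cReM_nat.
rewrite cIm_sum /limmeanC /= (limmean_total hmodel hsteady hb iphi).
apply: eq_bigr => r _; rewrite cIm_sum; apply: eq_bigr => k _; rewrite sumNC_Complex /=.
apply: eq_sumN => i _ _; congr limmean; apply/funext => s; by rewrite cImM_nat.
Qed.

Lemma fE t z : f P tr t z = limmeanC (fun s => z ^+ s.1 * (s.2 == t)%:R).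
Proof. by []. Qed.

Section FunctionalEquation.
Variables (t' : vtype prm) (z : R[i]).
Hypothesis ht' : is_type t'.
Hypothesis z1 : `|z| <= 1.
Local Notation pgf := (arrival_pgf (P := P) (tr := tr) t' z).
Local Notation Psi := (step_pgf (P := P) (tr := tr) t' z).

Lemma boundedC_pgf : boundedC pgf.
Proof.
by split; exists 1 => s; have [] := norm_arrival_pgf hmodel ht' z1 s.
Qed.

Lemma boundedC_pow : boundedC (fun s => z ^+ s.1).
Proof. by apply: boundedC_le1 => s; rewrite normrX exprn_ile1. Qed.

Lemma boundedC_Psi : boundedC Psi.
Proof.
apply: boundedC_mul boundedC_pgf.
rewrite (_ : (fun s => _) = (fun s => (s.1 == 0%N)%:R * B P tr z + (s.1 != 0%N)%:R * z ^+ s.1)).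
  apply: boundedC_add; apply: boundedC_mul; [exact: boundedC_bool|exact: boundedC_cst|
    exact: boundedC_bool|exact: boundedC_pow].
by apply/funext => s; case: eqP; rewrite !(mul0r, mul1r, addr0, add0r).
Qed.

(** [expectC_step] relates vehicle [n + 1] to the state at [n]; in the limit the shift of the index
    disappears. *)
Lemma limmeanC_step : z * f P tr t' z = limmeanC Psi.
Proof.
have b1 : boundedC (fun s => z ^+ s.1 * (s.2 == t')%:R).
  by apply: boundedC_mul; [exact: boundedC_pow | exact: boundedC_bool].
rewrite fE -limmeanCZ//.
have [rz iz] : boundedC (fun s => z * (z ^+ s.1 * (s.2 == t')%:R)).
  by apply: boundedC_mul => //; exact: boundedC_cst.
have [rP iP] := boundedC_Psi.
have h n := expectC_step hmodel ht' z1 n.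
apply: complexP; rewrite /limmeanC /=.
  apply: limn_shift; apply: cvg_trans (mean_cvg hmodel hsteady rP).
  by apply: near_eq_cvg; apply: nearW => n; have := congr1 (@complex.Re R) (h n).
apply: limn_shift; apply: cvg_trans (mean_cvg hmodel hsteady iP).
by apply: near_eq_cvg; apply: nearW => n; have := congr1 (@complex.Im R) (h n).
Qed.

(** By the Markov property the numerator is [c] times the probability of [Q]. The case distinction
    reflects the division by 0 when this probability vanishes. *)
Lemma cexpectC_arrivals n Q c : (forall s, Q s -> pgf s = c) ->
  cexpectC P (fun w => z ^+ A tr n.+1 w * (J tr n.+2 w == t')%:R)
    [set w | Q (state tr n w)] =
  if E_ n (fun s => (Q s)%:R) == 0 then 0 else c.
Proof.
move=> Qc; rewrite /cexpectC (prob_mean hmodel).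
case: eqVneq => [->|q0]; first by rewrite rmorph0 invr0 mulr0.
pose H (s : S) w := arrival_disc tr z t' n.+1 s w * (Q s)%:R.
transitivity (expectC P (fun w => H (state tr n w) w)
    / real_complex R (E_ n (fun s => (Q s)%:R))).
  congr (_ / _); congr expectC; apply/funext => w; rewrite /H indicE.
  congr (_ * _); rewrite (_ : (_ \in _) = Q (state tr n w)); last first.
    by apply/idP/idP => [/set_mem//|h]; apply/mem_set.
  by case: (Q _); rewrite ?rmorph1 ?rmorph0.
have bD s : bmfC (arrival_disc tr z t' n.+1 s : sub_traffic tr (vehicle_is n.+1) -> R[i]).
  by apply: (bmfC_arrival_disc s (@sub_trafficP _ _ _ _ tr (vehicle_is n.+1))) => //;
     case/andP: ht'.
rewrite (expectC_state_step hmodel (H := H)).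
- rewrite (_ : (fun w => _) = (fun w => c * (Q (state tr n w))%:R)).
    rewrite expectCZ; last first.
      apply: bmfC_bool.
      exact: (@measurable_countable_fun _ _ _ (state tr n) [set s | Q s]
        (measurable_stateT hmodel n)).
    rewrite (_ : expectC P _ = real_complex R (E_ n (fun s => (Q s)%:R))).
      by rewrite mulfK// fmorph_eq0.
    apply: complexP; rewrite /expectC /=.
      by congr expect; apply/funext => w; rewrite cRe_nat.
    by under eq_fun do rewrite cIm_nat; rewrite expect_cst.
  apply/funext => w; rewrite /H; under eq_fun do rewrite mulrC.
  rewrite expectCZ; last exact: (bmfC_arrival_discT hmodel).
  rewrite (expectC_arrival_disc hmodel)// mulrC.
  by case: (boolP (Q _)) => [/Qc ->|_]; rewrite ?mulr0.
- by move=> s; apply: bmfC_mul => //; exact: bmfC_cst.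
- move=> s w; rewrite /H normrM -[leRHS]mulr1 ler_pM ?norm_arrival_disc//.
  by case: (Q s); rewrite ?normr1 ?normr0.
Qed.

(* A divergent sequence has the junk limit [point]. *)
Lemma limn_norm_le1 (a : nat -> R) : (forall n, `|a n| <= 1) ->
  `|limn a| <= Num.max 1 `|point : R|.
Proof.
move=> a1; have [ca|/dvgP ->] := pselect (cvgn a); last by rewrite le_max lexx orbT.
rewrite le_max; apply/orP; left.
have c : `|a n| @[n --> \oo] --> `|limn a| by exact: cvg_norm.
rewrite -(cvg_lim (@Rhausdorff R) c); apply: limr_le; first by apply/cvg_ex; eexists; exact: c.
exact: nearW.
Qed.

(** A sequence with a nonzero limit is eventually nonzero, so [a] is eventually constant. *)
Lemma limC_switch (a : nat -> R[i]) (p : nat -> R) (l : R) (c : R[i]) :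
  (forall n, a n = if p n == 0 then 0 else c) -> p n @[n --> \oo] --> l ->
  l != 0 -> limC a = c.
Proof.
move=> aE cp l0.
have h : \forall n \near \oo, c = a n.
  near=> n; rewrite aE; case: eqVneq => // p0; exfalso.
  have : `|l - p n| < `|l|.
    by near: n; move/cvgrPdist_lt: cp; apply; rewrite normr_gt0.
  by rewrite p0 subr0 ltxx.
have C (g : R[i] -> R) : limn (fun n => g (a n)) = g c.
  apply/cvg_lim => //; apply: (@cvg_trans _ ((fun=> g c) @ \oo)); last exact: cvg_cst.
  by apply: near_eq_cvg; apply: filterS h => n ->.
by rewrite /limC !C; case: (c).
Unshelve. all: by end_near.
Qed.

(** The bound has to be uniform over infinitely many types, including those for which the limit does
    not exist; hence a constant that also bounds the junk limit. *)
Lemma boundedC_limC (a : S -> nat -> R[i]) :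
  (forall s n, `|complex.Re (a s n)| <= 1 /\ `|complex.Im (a s n)| <= 1) ->
  boundedC (fun s => limC (a s)).
Proof.
move=> h; split; exists (Num.max 1 `|point : R|) => s; apply: limn_norm_le1 => n;
  by have [] := h s n.
Qed.

Let busy t : pred S := fun s => (s.2 == t) && (1 <= s.1)%N.
Let idle t : pred S := fun s => (s.2 == t) && (s.1 == 0%N).

Lemma cexpectC_busy n t :
  cexpectC P (fun w => z ^+ A tr n.+1 w * (J tr n.+2 w == t')%:R)
    [set w | J tr n.+1 w = t /\ (1 <= X tr n w)%N] =
  if E_ n (fun s => (busy t s)%:R) == 0 then 0 else pgf (1%N, t).
Proof.
rewrite -(cexpectC_arrivals (Q := busy t) n); last first.
  by move=> [x t0] /andP[/= /eqP -> x1]; apply: arrival_pgf_busy; rewrite -lt0n.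
congr cexpectC; apply/seteqP; split=> w /=; first by move=> [/eqP h1 h2]; apply/andP.
by move=> /andP[/eqP h1 h2].
Qed.

Lemma cexpectC_idle n t :
  cexpectC P (fun w => z ^+ A tr n.+1 w * (J tr n.+2 w == t')%:R)
    [set w | J tr n.+1 w = t /\ X tr n w = 0%N] =
  if E_ n (fun s => (idle t s)%:R) == 0 then 0 else pgf (0%N, t).
Proof.
rewrite -(cexpectC_arrivals (Q := idle t) n); last first.
  by move=> [x t0] /andP[/= /eqP -> /eqP ->].
congr cexpectC; apply/seteqP; split=> w /=.
  by move=> [/eqP h1 /eqP h2]; apply/andP.
by move=> /andP[/eqP h1 /eqP h2].
Qed.

Lemma Apgf_busy t : L (fun s => (busy t s)%:R) != 0 -> Apgf P tr t t' z = pgf (1%N, t).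
Proof.
apply: limC_switch (cexpectC_busy ^~ t) _.
exact: (mean_cvg hmodel hsteady (bounded_bool (busy t))).
Qed.

Lemma Astar_idle t : L (fun s => (idle t s)%:R) != 0 -> Astar P tr t t' z = pgf (0%N, t).
Proof.
apply: limC_switch (cexpectC_idle ^~ t) _.
exact: (mean_cvg hmodel hsteady (bounded_bool (idle t))).
Qed.

Let switch_le1 (b : bool) s : `|complex.Re (if b then 0 else pgf s)| <= 1 /\
  `|complex.Im (if b then 0 else pgf s)| <= 1.
Proof.
by case: b; [rewrite /= normr0 | exact: (norm_arrival_pgf hmodel ht' z1)].
Qed.

Lemma boundedC_Apgf : boundedC (fun s => Apgf P tr s.2 t' z).
Proof. by apply: boundedC_limC => s n; rewrite cexpectC_busy; exact: switch_le1. Qed.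

Lemma boundedC_Astar : boundedC (fun s => Astar P tr s.2 t' z).
Proof. by apply: boundedC_limC => s n; rewrite cexpectC_idle; exact: switch_le1. Qed.

(** [phiA] and [phiB] are the functions of the state whose limit means are the two sums of the
    functional equation; [0 ^+ s.1] is the indicator of an empty queue. *)
Let phiA (s : S) : R[i] := Apgf P tr s.2 t' z * z ^+ s.1.
Let phiB (s : S) : R[i] := (B P tr z * Astar P tr s.2 t' z - Apgf P tr s.2 t' z) * 0 ^+ s.1.

Lemma boundedC_phiA : boundedC phiA.
Proof. by apply: boundedC_mul boundedC_pow; exact: boundedC_Apgf. Qed.

Lemma boundedC_phiB : boundedC phiB.
Proof.
apply: boundedC_mul.
  apply: boundedC_sub boundedC_Apgf.
  by apply: boundedC_mul boundedC_Astar; exact: boundedC_cst.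
by apply: boundedC_le1 => s; rewrite normrX normr0 exprn_ile1.
Qed.

Lemma limmeanC_support phi Q : boundedC phi ->
  (L (fun s => (Q s)%:R) != 0 -> forall s, Q s -> phi s = 0) ->
  limmeanC (fun s => phi s * (Q s)%:R) = 0.
Proof.
move=> bphi phi0; have [|LQ] := eqVneq (L (fun s => (Q s)%:R)) 0.
  exact: limmeanC_bool_eq0.
rewrite (_ : (fun s => _) = fun=> 0).
  by apply: complexP; rewrite /limmeanC /= limmean_cst.
apply/funext => s; case: (boolP (Q s)) => [Qs|_]; last by rewrite mulr0.
by rewrite phi0// mul0r.
Qed.

(* When a conditioning event has limit probability 0, Apgf and Astar are
   unrelated to arrival_pgf, but the corresponding terms vanish. *)
Lemma limmeanC_step_type t :
  limmeanC (fun s => Psi s * (s.2 == t)%:R) =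
  limmeanC (fun s => (phiA s + phiB s) * (s.2 == t)%:R).
Proof.
have bP := boundedC_Psi; have bAB := boundedC_add boundedC_phiA boundedC_phiB.
pose D s := Psi s - (phiA s + phiB s).
have bD : boundedC D by exact: boundedC_sub.
have bt (phi : S -> R[i]) Q : boundedC phi -> boundedC (fun s => phi s * (Q s)%:R).
  by move=> bphi; apply: boundedC_mul => //; exact: boundedC_bool.
have Dbusy : limmeanC (fun s => D s * (busy t s)%:R) = 0.
  apply: limmeanC_support => // /Apgf_busy h [x t0] /andP[/= /eqP -> x1].
  have x0 : x != 0%N by rewrite -lt0n.
  rewrite /D /step_pgf /phiA /phiB /= h (negbTE x0) arrival_pgf_busy// expr0n (negbTE x0).
  by rewrite mulr0 addr0 mulrC subrr.
have Didle : limmeanC (fun s => D s * (idle t s)%:R) = 0.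
  apply: limmeanC_support => // /Astar_idle h [x t0] /andP[/= /eqP -> /eqP ->].
  by rewrite /D /step_pgf /phiA /phiB /= h !expr0 !mulr1 [X in _ - X]addrC subrK subrr.
transitivity (limmeanC (fun s => D s * (busy t s)%:R)
    + limmeanC (fun s => D s * (idle t s)%:R)
    + limmeanC (fun s => (phiA s + phiB s) * (s.2 == t)%:R)); last first.
  by rewrite Dbusy Didle !add0r.
have b1 := bt _ (busy t) bD; have b2 := bt _ (idle t) bD.
have b3 := bt _ (fun s => s.2 == t) bAB.
rewrite -(limmeanCD b1 b2) -(limmeanCD (boundedC_add b1 b2) b3).
congr limmeanC; apply/funext => s.
rewrite -mulrDr -natrD (_ : (_ + _)%N = (s.2 == t)); last first.
  by rewrite /busy /idle; case: (s.2 == t) => //; case: (s.1).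
by rewrite -mulrDl /D subrK.
Qed.

(** By total probability both sums are limit means. The comparison with [step_pgf] is made type by
    type, because [Apgf] and [Astar] are tied to [arrival_pgf] only under conditioning events of
    positive limit probability. *)
Lemma generating_system : attempts_bounded P tr ->
    z * f P tr t' z
    - \sum_(r0 < nR prm) \sum_(k < nK prm)
        sumNC prm 1 (fun i => Apgf P tr (i, k, r0) t' z * f P tr (i, k, r0) z)
    = \sum_(r0 < nR prm) \sum_(k < nK prm)
        sumNC prm 1 (fun i =>
          (B P tr z * Astar P tr (i, k, r0) t' z - Apgf P tr (i, k, r0) t' z)
          * f P tr (i, k, r0) 0).
Proof.
move=> hb.
have sA : \sum_(r0 < nR prm) \sum_(k < nK prm)
    sumNC prm 1 (fun i => Apgf P tr (i, k, r0) t' z * f P tr (i, k, r0) z) = limmeanC phiA.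
  rewrite (limmeanC_total hb boundedC_phiA).
  apply: eq_bigr => r _; apply: eq_bigr => k _; congr sumNC; apply/funext => i.
  rewrite fE -limmeanCZ; last by apply: boundedC_mul; [exact: boundedC_pow|exact: boundedC_bool].
  by congr limmeanC; apply/funext => s; rewrite /phiA mulrA; case: eqP => [->|_]; rewrite ?mulr0.
have sB : \sum_(r0 < nR prm) \sum_(k < nK prm) sumNC prm 1 (fun i =>
      (B P tr z * Astar P tr (i, k, r0) t' z - Apgf P tr (i, k, r0) t' z)
      * f P tr (i, k, r0) 0) = limmeanC phiB.
  rewrite (limmeanC_total hb boundedC_phiB).
  apply: eq_bigr => r _; apply: eq_bigr => k _; congr sumNC; apply/funext => i.
  rewrite fE -limmeanCZ; last first.
    apply: boundedC_mul; last exact: boundedC_bool.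
    by apply: boundedC_le1 => s; rewrite normrX normr0 exprn_ile1.
  by congr limmeanC; apply/funext => s; rewrite /phiB mulrA; case: eqP => [->|_]; rewrite ?mulr0.
have step : limmeanC Psi = limmeanC phiA + limmeanC phiB.
  rewrite -(limmeanCD boundedC_phiA boundedC_phiB) (limmeanC_total hb boundedC_Psi).
  rewrite (limmeanC_total hb (boundedC_add boundedC_phiA boundedC_phiB)).
  apply: eq_bigr => r _; apply: eq_bigr => k _; congr sumNC; apply/funext => i.
  exact: limmeanC_step_type.
apply: (etrans (congr1 (fun x => z * f P tr t' z - x) sA)); apply: etrans (esym sB).
have e := etrans limmeanC_step step.
by apply: (etrans (congr1 (fun x => x - _) e)); rewrite addrC addKr.
Qed.

End FunctionalEquation.
End ComplexLimits.

Theorem theorem1 (R : realType) (prm : params R)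
    (d : measure_display) (T : measurableType d) (P : probability T R)
    (tr : traffic prm T)
    (hprm : valid_params prm) (hmodel : gap_model P tr)
    (hstable : stable P tr) (hsteady : steady_state P tr) :
  (* partial service-time transform given the type of the predecessor *)
  (forall (t t' : vtype prm) (s : R), is_type t -> is_type t' -> 0 <= s ->
    0 < limn (fun n => prob P [set w | J tr n w = t]) ->
    Gt P tr t t' s =
      Gy P tr t' s (ubar t) * (1 - fbar P tr t)
      + ((\int[lebesgue_measure]_(x in `[0, ubar t])
            (lam prm * expR (- lam prm * x) * Gy P tr t' s (ubar t - x)))
         + Gy P tr t' s 0 * expR (- lam prm * ubar t)) * fbar P tr t) /\
  (* (a) *)
  (attempts_bounded P tr ->
   forall (t' : vtype prm) (z : R[i]), is_type t' -> `|z| <= 1 ->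
    z * f P tr t' z
    - \sum_(r0 < nR prm) \sum_(k < nK prm)
        sumNC prm 1 (fun i => Apgf P tr (i, k, r0) t' z * f P tr (i, k, r0) z)
    = \sum_(r0 < nR prm) \sum_(k < nK prm)
        sumNC prm 1 (fun i =>
          (B P tr z * Astar P tr (i, k, r0) t' z - Apgf P tr (i, k, r0) t' z)
          * f P tr (i, k, r0) 0)) /\
  (* (b) *)
  (forall (l : 'I_(nK prm)) (r : 'I_(nR prm)) (s y : R), 0 <= s -> 0 <= y ->
    (exists2 t : vtype prm, is_type t & y <= ubar t) ->
    Gy P tr (1%N, l, r) s y =
      pr prm r * pk prm 1 l r * expR (- q prm * Num.max (u prm 1 l r - y) 0)
      * expR (- s * Delta prm r) /\
    (forall j : nat, (2 <= j)%N -> attempt_le prm j ->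
      Gy P tr (j, l, r) s y =
        pr prm r * pk prm j l r
        * (1 - expT 1 r (fun x => expR (- (s + q prm) * Num.max (x - y) 0)))
        * expR (- (s * (y + Delta prm r) + q prm * u prm j l r))
        * (q prm / (s + q prm)) ^+ j.-1
        * \prod_(2 <= m < j) (1 - expT m r (fun x => expR (- (s + q prm) * x)))))
  /\
  (* (c) *)
  (forall (i : nat) (k : 'I_(nK prm)) (r : 'I_(nR prm)), attempt_le prm i ->
    0 < pr prm r -> 0 < pk prm i k r ->
    piS P tr (i, k, r) =
      PS P tr (i, k, r)
      * \prod_(1 <= m < i)
          (1 - \sum_(km < nK prm) pk prm m km r * PS P tr (m, km, r))) /\
  (forall (i : nat) (k : 'I_(nK prm)) (r : 'I_(nR prm)),
    (2 <= i)%N -> attempt_le prm i ->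
    0 < limn (fun n => prob P (makes tr n (i, k, r))) ->
    PS P tr (i, k, r) = expR (- q prm * u prm i k r)) /\
  (attempts_bounded P tr ->
   forall (k : 'I_(nK prm)) (r : 'I_(nR prm)), 0 < pr prm r -> 0 < pk prm 1 k r ->
    PS P tr (1%N, k, r)
    + \sum_(r0 < nR prm) \sum_(l < nK prm)
        (- pr prm r0 * expR (- q prm * vhat k r (1%N, l, r0)) + cc k r0 r)
        * pk prm 1 l r0 * PS P tr (1%N, l, r0)
    = \sum_(r0 < nR prm) \sum_(l < nK prm) sumN prm 1 (fun i =>
        (1 - expR (- lam prm * vcheck k r (i, l, r0))
         - expR (- q prm * vhat k r (i, l, r0))
         + lam prm / (lam prm + q prm)
           * expR (- (lam prm + q prm) * vcheck k r (i, l, r0)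
                   - q prm * v k r (i, l, r0))
         + q prm / (lam prm + q prm)
           * expR (- lam prm * ubar (i, l, r0) - q prm * u prm 1 k r))
        * f0 P tr (i, l, r0))
      + \sum_(r0 < nR prm) cc k r0 r).
Proof.
split.
  by move=> t t' s ht ht' s0 hpos; exact: (Gt_formula hprm hmodel hsteady).
split.
  by move=> hb t' z ht' z1; exact: (generating_system hmodel hsteady ht' z1 hb).
split.
  move=> l r s y s0 y0 _; split; first exact: (Gy_first hprm hmodel l r s0 y0 (attempt_le1 hmodel)).
  by move=> j j2 hj; exact: (Gy_later hprm hmodel l r s0 y0 j2 hj).
split; first by move=> i k r hi pr0 pk0; exact: (piS_prod hprm hmodel hsteady hi pr0 pk0).
split; first by move=> i k r i2 hi hpos; exact: (PS_later hprm hmodel hsteady i2 hi hpos).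
by move=> hb k r pr0 pk0; exact: (PS_first_system hprm hmodel hsteady hb pr0 pk0).
Qed.
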